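(* Let $\Omega\subseteq\mathbb{R}^3$ be open and bounded. Then the embedding $D_{(\operatorname{curl}^{\#})_{\mathrm{red}}}\hookrightarrow L_2(\Omega)^3$ is compact and, in particular, $\operatorname{curl}^{\#}$ is selfadjoint and its spectrum $\sigma(\operatorname{curl}^{\#})$ is discrete.
   Context: Let $\operatorname{curl}_c\colon C_c^\infty(\Omega)^3\subseteq L_2(\Omega)^3\to L_2(\Omega)^3$, $\Psi\mapsto(\partial_2\Psi_3-\partial_3\Psi_2,\ \partial_3\Psi_1-\partial_1\Psi_3,\ \partial_1\Psi_2-\partial_2\Psi_1)$, where $C_c^\infty(\Omega)$ is the space of compactly supported infinitely differentiable functions on $\Omega$. It is closable and symmetric; put $\operatorname{curl}_0=\overline{\operatorname{curl}_c}$ (closure) and $\operatorname{curl}=\operatorname{curl}_0^{\ast}$, whose domain is $\{\Psi\in L_2(\Omega)^3 : \operatorname{curl}\Psi\in L_2(\Omega)^3\}$ with $\operatorname{curl}\Psi$ taken in the distributional sense. The operator $\operatorname{curl}^{\#}\subseteq\operatorname{curl}$ is the restriction of $\operatorname{curl}$ to $$\operatorname{dom}(\operatorname{curl}^{\#})=\{\Psi\in\operatorname{dom}(\operatorname{curl}) : \operatorname{curl}\Psi\in\overline{\operatorname{ran}}(\operatorname{curl}_0)\},$$ where $\overline{\operatorname{ran}}$ denotes the closure of the range. For a closed densely defined linear operator $T\colon\operatorname{dom}(T)\subseteq X\to Y$ between Hilbert spaces, the reduced operator is $T_{\mathrm{red}}\colon\operatorname{dom}(T)\cap\ker(T)^\perp\subseteq\ker(T)^\perp\to\overline{\operatorname{ran}}(T)$,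 $x\mapsto Tx$, and $D_{T_{\mathrm{red}}}=\operatorname{dom}(T)\cap\ker(T)^\perp$ equipped with the graph norm of $T_{\mathrm{red}}$. ''Discrete'' refers to $\sigma(\operatorname{curl}^{\#})$ as a set: it is a discrete subset of $\mathbb{R}$, i.e. it has no accumulation point in $\mathbb{R}$ (the eigenvalue $0$ may have infinite multiplicity). *)

(* Defs.v *)
From HB Require Import structures.
From mathcomp Require Import all_boot all_order all_algebra.
From mathcomp Require Import sesquilinear ring_quotient generic_quotient complex ring lra.
From mathcomp Require Import all_classical all_reals all_analysis measurable_realfun.
Set Implicit Arguments.
Unset Strict Implicit.
Unset Printing Implicit Defensive.
Import Order.TTheory GRing.Theory Num.Theory.
Import numFieldNormedType.Exports.
Local Open Scope classical_set_scope.
Local Open Scope ring_scope.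

HB.mixin Record NormedModule_hasInner (C : numClosedFieldType) H
    & NormedModule C H := {
  inner : {dot H for @Num.conj C};
  inner_norm : forall x : H, `|x| ^+ 2 = inner x x
}.

#[short(type="innerProductType")]
HB.structure Definition InnerProduct (C : numClosedFieldType) :=
  {H of NormedModule C H & NormedModule_hasInner C H}.

Local Notation Re := (@complex.Re _).
Local Notation Im := (@complex.Im _).
Section dot_norm.
Variables (C : numClosedFieldType) (V : lmodType C).
Variable form : {dot V for @Num.conj C}.

Definition dot_norm (x : V) : C := sqrtC (form x x).

Let CS (u v : V) : `|form u v| ^+ 2 <= form u u * form v v.
Proof.
have [->|v0] := eqVneq v 0.
  by rewrite (linear0r form u) (linear0r form 0) normr0 expr0n mulr0.
have vv : 0 < form v v by rewrite dnorm_gt0.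
have vvr : (form v v)^* = form v v by apply: conj_Creal; exact: gtr0_real.
set a := form u v / form v v.
have := dnorm_ge0 form (u - a *: v).
rewrite dnormB dnormZ linearZr_LR /=.
have -> : a^* * form u v = `|form u v| ^+ 2 / form v v.
  by rewrite normCK rmorphM/= fmorphV/= vvr; ring.
have -> : `|a| ^+ 2 * form v v = `|form u v| ^+ 2 / form v v.
  rewrite normrM normfV exprMn exprVn (ger0_norm (ltW vv)).
  by field; exact: lt0r_neq0.
rewrite (rmorphM Num.conj)/= fmorphV/= vvr (rmorphXn Num.conj)/= (conj_Creal (normr_real _)).
rewrite opprD addrA addrK subr_ge0 ler_pdivrMr//.
Qed.

Lemma dot_normD x y : dot_norm (x + y) <= dot_norm x + dot_norm y.
Proof.
rewrite -(@ler_pXn2r _ 2)//; last 2 first.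
- by rewrite nnegrE sqrt_dnorm_ge0.
- by rewrite nnegrE addr_ge0 // sqrt_dnorm_ge0.
rewrite sqrrD !sqrtCK dnormD [leRHS]addrAC lerD2l.
have re : form x y + (form x y)^* \is Num.real.
  by rewrite CrealE rmorphD/= conjCK addrC.
apply: (le_trans (real_ler_norm re)).
apply: (le_trans (ler_normD _ _)); rewrite norm_conjC -mulr2n lerMn2r/=.
rewrite -(ler_pXn2r (n := 2)) ?nnegrE ?mulr_ge0 ?sqrt_dnorm_ge0 //.
by rewrite exprMn !sqrtCK CS.
Qed.

Lemma dot_normZ a x : dot_norm (a *: x) = `|a| * dot_norm x.
Proof.
by rewrite /dot_norm dnormZ sqrtCM ?nnegrE ?exprn_ge0// sqrCK.
Qed.

Lemma dot_norm_eq0 x : dot_norm x = 0 -> x = 0.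
Proof. by move/eqP; rewrite sqrt_dnorm_eq0 => /eqP. Qed.
End dot_norm.

Section complex_integral.
Context d (T : measurableType d) (R : realType).
Variable mu : {measure set T -> \bar R}.

Definition cintegrable (h : T -> R[i]) :=
  mu.-integrable setT (EFin \o (Re \o h)) /\
  mu.-integrable setT (EFin \o (Im \o h)).

Definition cintegral (h : T -> R[i]) : R[i] :=
  Complex (\int[mu]_x Re (h x)) (\int[mu]_x Im (h x)).

Lemma cintegrable0 : cintegrable (fun=> 0).
Proof. by split; exact: integrable0. Qed.

Lemma cintegrableD f g : cintegrable f -> cintegrable g ->
  cintegrable (fun x => f x + g x).
Proof.
move=> [rf jf] [rg jg]; split.
- rewrite (_ : _ \o _ = ((EFin \o (Re \o f)) \+
    (EFin \o (Re \o g)))%E); first exact: integrableD.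
  by apply/funext => x /=; rewrite raddfD.
- rewrite (_ : _ \o _ = ((EFin \o (Im \o f)) \+
    (EFin \o (Im \o g)))%E); first exact: integrableD.
  by apply/funext => x /=; rewrite raddfD.
Qed.

Lemma cintegralD f g : cintegrable f -> cintegrable g ->
  cintegral (fun x => f x + g x) = cintegral f + cintegral g.
Proof.
move=> [rf jf] [rg jg]; rewrite /cintegral.
rewrite [RHS]/(_ + _)/=; congr Complex.
- by rewrite -RintegralD//; apply: eq_Rintegral => x _; rewrite raddfD.
- by rewrite -RintegralD//; apply: eq_Rintegral => x _; rewrite raddfD.
Qed.

Lemma cintegrableZ a f : cintegrable f -> cintegrable (fun x => a * f x).
Proof.
case: a => p q [rf jf]; split.
- rewrite (_ : _ \o _ = ((fun x => p%:E * (Re (f x))%:E) \+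
    (fun x => (- q)%:E * (Im (f x))%:E))%E).
    by apply: integrableD => //; exact: integrableZl.
  by apply/funext => x /=; case: (f x) => u v /=; rewrite -!EFinM -EFinD mulNr.
- rewrite (_ : _ \o _ = ((fun x => p%:E * (Im (f x))%:E) \+
    (fun x => q%:E * (Re (f x))%:E))%E).
    by apply: integrableD => //; exact: integrableZl.
  by apply/funext => x /=; case: (f x) => u v /=; rewrite -!EFinM -EFinD.
Qed.

Lemma cintegralZ a f : cintegrable f ->
  cintegral (fun x => a * f x) = a * cintegral f.
Proof.
case: a => p q [rf jf]; rewrite /cintegral.
have Z r (g : T -> R) : mu.-integrable setT (EFin \o g) ->
    mu.-integrable setT (EFin \o (fun x => r * g x)).
  move=> ig; rewrite (_ : _ \o _ = (fun x => r%:E * (EFin \o g) x)%E).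
    exact: integrableZl.
  by apply/funext => x /=; rewrite EFinM.
rewrite [RHS]/(_ * _)/=; congr Complex.
- rewrite -!RintegralZl// -RintegralB//; [|exact: Z..].
  by apply: eq_Rintegral => x _; case: (f x).
- rewrite -!RintegralZl// -RintegralD//; [|exact: Z..].
  by apply: eq_Rintegral => x _; case: (f x).
Qed.

Lemma cintegral_conj f : cintegrable f ->
  cintegral (fun x => (f x)^*) = (cintegral f)^*.
Proof.
move=> [rf jf]; rewrite /cintegral.
rewrite [RHS]/(conjc _)/=; congr Complex.
- by apply: eq_Rintegral => x _; case: (f x).
- rewrite -mulN1r -RintegralZl//.
  by apply: eq_Rintegral => x _; case: (f x) => u v /=; rewrite mulN1r.
Qed.

Lemma cintegrable_conj f : cintegrable f -> cintegrable (fun x => (f x)^*).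
Proof.
move=> [rf jf]; split.
- by rewrite (_ : _ \o _ = EFin \o (Re \o f))//; apply/funext => x /=; case: (f x).
- rewrite (_ : _ \o _ = (fun x => (-1)%:E * (Im (f x))%:E)%E).
    exact: integrableZl.
  by apply/funext => x /=; case: (f x) => u v /=; rewrite -EFinM mulN1r.
Qed.

Lemma cintegrable_sum n (f : 'I_n -> T -> R[i]) :
  (forall j, cintegrable (f j)) -> cintegrable (fun x => \sum_j f j x).
Proof.
move=> fi.
have : forall s : seq 'I_n, cintegrable (fun x => \sum_(j <- s) f j x).
  elim=> [|j s IHs].
    by under eq_fun do rewrite big_nil; exact: cintegrable0.
  by under eq_fun do rewrite big_cons; exact: cintegrableD.
exact.
Qed.

End complex_integral.

Section L2.
Context d (T : measurableType d) (R : realType).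
Variable mu : {measure set T -> \bar R}.
Variable n : nat.

Definition square_integrable : {pred T -> 'rV[R[i]]_n} :=
  [pred f : T -> 'rV[R[i]]_n | `[< forall j,
     (fun x => Re (f x 0 j)) \in Lfun mu 2%:E /\
     (fun x => Im (f x 0 j)) \in Lfun mu 2%:E >]].

Lemma square_integrable_submod : submod_closed square_integrable.
Proof.
have le12 : (1 <= 2%:E :> \bar R)%E by rewrite lee_fin ler1n.
have [L0 LP] := Lfun_submod_closed mu le12.
have LD (a : R) (f g : T -> R) : f \in Lfun mu 2%:E -> g \in Lfun mu 2%:E ->
    (fun x => a * f x + g x) \in Lfun mu 2%:E.
  by move=> fL gL; exact: (LP a f g fL gL).
split.
  apply/asboolP => j; split.
    by rewrite (_ : (fun x => _) = 0)//; apply/funext => x; rewrite mxE.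
  by rewrite (_ : (fun x => _) = 0)//; apply/funext => x; rewrite mxE.
move=> [p q] f g /asboolP fL /asboolP gL; apply/asboolP => j.
have [fr fi] := fL j; have [gr gi] := gL j; split.
- rewrite (_ : (fun x => _) = (fun x => p * Re (f x 0 j) +
      (- q * Im (f x 0 j) + Re (g x 0 j)))); first exact/LD/LD.
  apply/funext => x; rewrite !mxE.
  by case: (f x 0 j) (g x 0 j) => a b [u v] /=; rewrite mulNr addrA.
- rewrite (_ : (fun x => _) = (fun x => p * Im (f x 0 j) +
      (q * Re (f x 0 j) + Im (g x 0 j)))); first exact/LD/LD.
  apply/funext => x; rewrite !mxE.
  by case: (f x 0 j) (g x 0 j) => a b [u v] /=; rewrite addrA.
Qed.

HB.instance Definition _ := GRing.isSubmodClosed.Build _ _ square_integrable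
  square_integrable_submod.

Record L2fun := L2Fun {
  L2fun_val :> T -> 'rV[R[i]]_n;
  L2fun_prop : L2fun_val \in square_integrable }.

HB.instance Definition _ := [isSub for L2fun_val].
HB.instance Definition _ := [Choice of L2fun by <:].
HB.instance Definition _ := [SubChoice_isSubLmodule of L2fun by <:].


Let Lfun2_mul (f g : T -> R) : f \in Lfun mu 2%:E -> g \in Lfun mu 2%:E ->
  mu.-integrable setT (fun x => (f x * g x)%:E).
Proof. by move=> fL gL; apply/Lfun1_integrable; exact: Lfun2_mul_Lfun1. Qed.

Definition hdot (f g : T -> 'rV[R[i]]_n) (x : T) : R[i] :=
  \sum_j f x 0 j * (g x 0 j)^*.

Lemma hdot_integrable (f g : L2fun) : cintegrable mu (hdot f g).
Proof.
apply: cintegrable_sum => j.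
have /asboolP /(_ j)[fr fi] := L2fun_prop f.
have /asboolP /(_ j)[gr gi] := L2fun_prop g.
split.
- rewrite (_ : _ \o _ = (fun x => (Re (f x 0 j) * Re (g x 0 j))%:E +
      (Im (f x 0 j) * Im (g x 0 j))%:E)%E).
    by apply: integrableD => //; exact: Lfun2_mul.
  apply/funext => x /=; case: (f x 0 j) (g x 0 j) => a b [u v] /=.
  by rewrite -EFinD mulrN opprK.
- rewrite (_ : _ \o _ = (fun x => (Im (f x 0 j) * Re (g x 0 j))%:E -
      (Re (f x 0 j) * Im (g x 0 j))%:E)%E).
    by apply: integrableB => //; exact: Lfun2_mul.
  apply/funext => x /=; case: (f x 0 j) (g x 0 j) => a b [u v] /=.
  by rewrite -EFinB mulrN addrC.
Qed.

Definition dotf (f g : T -> 'rV[R[i]]_n) : R[i] := cintegral mu (hdot f g).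

Lemma dotfDl (f g h : L2fun) : dotf (f + g) h = dotf f h + dotf g h.
Proof.
rewrite /dotf -cintegralD; [|exact: hdot_integrable..].
congr cintegral; apply/funext => x; rewrite /hdot -big_split/=.
by apply: eq_bigr => j _; rewrite -mulrDl; congr (_ * _); exact: mxE.
Qed.

Lemma dotfZl a (f g : L2fun) : dotf (a *: f) g = a * dotf f g.
Proof.
rewrite /dotf -cintegralZ; last exact: hdot_integrable.
congr cintegral; apply/funext => x; rewrite /hdot mulr_sumr.
by apply: eq_bigr => j _; rewrite mulrA; congr (_ * _); exact: mxE.
Qed.

Lemma dotfC (f g : L2fun) : dotf g f = (dotf f g)^*.
Proof.
rewrite /dotf -cintegral_conj; last exact: hdot_integrable.
congr cintegral; apply/funext => x; rewrite /hdot rmorph_sum/=.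
by apply: eq_bigr => j _; rewrite rmorphM/= conjCK mulrC.
Qed.

Lemma eq_dotf (f f' g g' : L2fun) :
  (\forall x \ae mu, f x = f' x) -> (\forall x \ae mu, g x = g' x) ->
  dotf f g = dotf f' g'.
Proof.
move=> ff' gg'.
have [rfg jfg] := hdot_integrable f g.
have [rfg' jfg'] := hdot_integrable f' g'.
have E : \forall x \ae mu, hdot f g x = hdot f' g' x.
  by apply: filterS2 ff' gg' => x; rewrite /hdot => -> ->.
rewrite /dotf /cintegral /Rintegral; congr Complex; congr fine.
- apply: ae_eq_integral => //; [exact: measurable_int rfg|exact: measurable_int rfg'|].
  by apply: filterS E => x /= ->.
- apply: ae_eq_integral => //; [exact: measurable_int jfg|exact: measurable_int jfg'|].
  by apply: filterS E => x /= ->.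
Qed.

Lemma hdot_ge0 f x : 0 <= hdot f f x.
Proof. by apply: sumr_ge0 => j _; rewrite -normCK exprn_ge0. Qed.

Lemma hdot_eq0 f x : hdot f f x = 0 -> f x = 0.
Proof.
move=> /eqP; rewrite psumr_eq0; last by move=> j _; rewrite -normCK exprn_ge0.
move=> /allP f0; apply/rowP => j; rewrite mxE.
have := f0 j; rewrite mem_index_enum => /(_ isT).
by rewrite -normCK sqrf_eq0 normr_eq0 => /eqP.
Qed.

Lemma dotf_ge0 (f : L2fun) : 0 <= dotf f f.
Proof.
rewrite lecE /=; apply/andP; split.
  rewrite (_ : Rintegral _ _ _ = 0)// /Rintegral integral0_eq// => x _.
  by have := hdot_ge0 f x; rewrite lecE /= => /andP[/eqP -> _].
apply: Rintegral_ge0 => x _.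
by have := hdot_ge0 f x; rewrite lecE /= => /andP[_].
Qed.

Lemma dotf_eq0 (f : L2fun) : dotf f f = 0 -> \forall x \ae mu, f x = 0.
Proof.
move=> /(congr1 (@complex.Re _)) /= f0.
have [rf _] := hdot_integrable f f.
have ge0 x : 0 <= Re (hdot f f x).
  by have := hdot_ge0 f x; rewrite lecE /= => /andP[_].
have : (\int[mu]_x `|(EFin \o (Re \o hdot f f)) x| = 0)%E.
  rewrite (_ : integral _ _ _ = (\int[mu]_x (Re (hdot f f x))%:E)%E).
    by rewrite -[LHS]fineK ?integrable_fin_num//; congr EFin.
  by apply: eq_integral => x _ /=; rewrite ger0_norm.
move/(ae_eq_integral_abs mu measurableT (measurable_int _ rf)).
apply: filterS => x /(_ I) /= [f0x]; apply: hdot_eq0.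
apply/eqP; rewrite eq_complex f0x eqxx /=.
by have := hdot_ge0 f x; rewrite lecE /= => /andP[].
Qed.

Lemma L2funBE (f g : L2fun) x : (f - g) x = f x - g x. Proof. by []. Qed.

Lemma L2funZE a (f : L2fun) x : (a *: f) x = a *: f x. Proof. by []. Qed.

Definition ae0 : {pred L2fun} := [pred f : L2fun | `[< \forall x \ae mu, f x = 0 >]].

Lemma ae0_zmod_closed : zmod_closed ae0.
Proof.
split; first by apply/asboolP; apply: aeW => x; exact.
move=> f g /asboolP f0 /asboolP g0; apply/asboolP.
apply: filterS2 f0 g0 => x f0 g0.
by rewrite L2funBE f0 g0 subr0.
Qed.

HB.instance Definition _ := GRing.isZmodClosed.Build _ ae0 ae0_zmod_closed.

Lemma ae0Z a (f : L2fun) : f \in ae0 -> a *: f \in ae0.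
Proof.
move=> /asboolP f0; apply/asboolP; apply: filterS f0 => x f0.
by rewrite L2funZE f0 scaler0.
Qed.

(* Classes, modulo equality mu-a.e., of the square-integrable functions from T *)
(* to C^n; the inner product is linear in its first argument.                  *)
Definition L2 := Quotient.quot ae0.
HB.instance Definition _ := GRing.Zmodule.on L2.
HB.instance Definition _ := EqQuotient.on L2.

Local Open Scope quotient_scope.

Lemma L2_eqP (f g : L2fun) :
  (\pi_L2 f = \pi_L2 g) <-> (\forall x \ae mu, f x = g x).
Proof.
have -> : (\pi_L2 f = \pi_L2 g) <-> (f - g) \in ae0.
  by rewrite Quotient.idealrBE; split => [->|/eqP].
split => [/asboolP h|h].
  apply: filterS h => x /eqP; rewrite L2funBE subr_eq0.
  by move/eqP.
apply/asboolP; apply: filterS h => x h.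
by rewrite L2funBE h subrr.
Qed.

Lemma ae_repr (f : L2fun) : \forall x \ae mu, repr (\pi_L2 f) x = f x.
Proof. by apply/L2_eqP; rewrite reprK. Qed.

Definition L2scale (a : R[i]) (u : L2) : L2 := \pi_L2 (a *: repr u).

Lemma pi_L2scale a f : L2scale a (\pi_L2 f) = \pi_L2 (a *: f).
Proof.
apply/L2_eqP; apply: filterS (ae_repr f) => x fx.
by rewrite !L2funZE fx.
Qed.

Lemma pi_L2D f g : \pi_L2 (f + g) = \pi_L2 f + \pi_L2 g.
Proof. by rewrite raddfD. Qed.

Lemma L2scaleA a b u : L2scale a (L2scale b u) = L2scale (a * b) u.
Proof. by rewrite -[u]reprK (pi_L2scale b) !pi_L2scale scalerA. Qed.

Lemma L2scale1 : left_id 1 L2scale.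
Proof. by move=> u; rewrite -[u]reprK pi_L2scale scale1r. Qed.

Lemma L2scaleDr : right_distributive L2scale +%R.
Proof.
by move=> a u v; rewrite -[u]reprK -[v]reprK -pi_L2D !pi_L2scale -pi_L2D scalerDr.
Qed.

Lemma L2scaleDl u : {morph L2scale^~ u : a b / a + b}.
Proof. by move=> a b; rewrite -[u]reprK !pi_L2scale -pi_L2D scalerDl. Qed.

HB.instance Definition _ := GRing.Zmodule_isLmodule.Build R[i] L2
  L2scaleA L2scale1 L2scaleDr L2scaleDl.

Definition L2dot (u v : L2) : R[i] := dotf (repr u) (repr v).

Lemma L2dotE f g : L2dot (\pi_L2 f) (\pi_L2 g) = dotf f g.
Proof. by apply: eq_dotf; exact: ae_repr. Qed.

Lemma L2dotC u v : L2dot u v = (L2dot v u)^*.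
Proof. exact: dotfC. Qed.

Lemma L2dot_linl v : GRing.linear_for *%R (L2dot^~ v).
Proof.
move=> a u w; rewrite -[u]reprK -[v]reprK -[w]reprK.
rewrite [a *: _]pi_L2scale -pi_L2D !L2dotE.
by rewrite dotfDl dotfZl.
Qed.

Lemma L2dot_linr u : GRing.linear_for (Num.conj \; *%R) (L2dot u).
Proof.
by move=> a v w; rewrite L2dotC L2dot_linl rmorphD rmorphM/= -!L2dotC.
Qed.

HB.instance Definition _ := bilinear_isBilinear.Build R[i] L2 L2 R[i]
  ( *%R ) (Num.conj \; *%R) L2dot (L2dot_linl, L2dot_linr).

Lemma L2dot_herm u v : L2dot u v = (-1) ^+ false * (L2dot v u)^*.
Proof. by rewrite mul1r -L2dotC. Qed.

HB.instance Definition _ := isHermitianSesquilinear.Build R[i] L2 false Num.conj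
  L2dot L2dot_herm.

Lemma L2dot_gt0 u : u != 0 -> 0 < L2dot u u.
Proof.
move=> u0; rewrite lt_def dotf_ge0 andbT; apply: contra u0 => /eqP /dotf_eq0 u0.
by rewrite -[u]reprK -(raddf0 (\pi_L2)); apply/eqP/L2_eqP.
Qed.

HB.instance Definition _ := isDotProduct.Build R[i] L2 L2dot L2dot_gt0.

HB.instance Definition _ := Lmodule_isNormed.Build R[i] L2
  (dot_normD L2dot) (dot_normZ L2dot) (dot_norm_eq0 (form := L2dot)).

Lemma L2_inner_norm (u : L2) : `|u| ^+ 2 = L2dot u u.
Proof. by rewrite sqrtCK. Qed.

HB.instance Definition _ := NormedModule_hasInner.Build R[i] L2 L2_inner_norm.

End L2.

(* An operator from H to K is represented by its graph, a subset of H * K; the *)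
(* inclusion, the closure and the equality of operators are those of graphs.   *)
Section operators.
Context {C : numClosedFieldType}.
Implicit Types H K : innerProductType C.

Definition op_dom H K (A : set (H * K)) : set H := fst @` A.

Definition op_ran H K (A : set (H * K)) : set K := snd @` A.

Definition op_ker H K (A : set (H * K)) : set H := [set x | A (x, 0)].

Definition orthogonal_compl H (S : set H) : set H :=
  [set x | forall y, S y -> inner x y = 0].

Definition adjoint H K (A : set (H * K)) : set (K * H) :=
  [set q | forall p, A p -> inner p.2 q.1 = inner p.1 q.2].

Definition reduced H K (A : set (H * K)) : set (H * K) :=
  [set p | A p /\ orthogonal_compl (op_ker A) p.1].

Definition graph_norm H K (p : H * K) : C :=
  sqrtC (`|p.1| ^+ 2 + `|p.2| ^+ 2).

(* The embedding into H of the domain of A with the graph norm is compact: the *)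
(* image of the unit ball has compact closure.                                 *)
Definition compact_domain_embedding H K (A : set (H * K)) : Prop :=
  precompact (fst @` [set p | A p /\ graph_norm p <= 1]).

Definition selfadjoint H (A : set (H * H)) : Prop :=
  dense (op_dom A) /\ adjoint A = A.

Definition op_shift H (A : set (H * H)) (l : C) : set (H * H) :=
  [set (p.1, p.2 - l *: p.1) | p in A].

Definition resolvent_set H (A : set (H * H)) : set C :=
  [set l | (forall y, exists! x, op_shift A l (x, y)) /\
           exists M : C, forall x y, op_shift A l (x, y) -> `|x| <= M * `|y|].

Definition spectrum H (A : set (H * H)) : set C := ~` resolvent_set A.

End operators.

Section space3.
Variable R : realType.
Local Notation mR := (measurableTypeR R).

(* The sigma-algebra of Lebesgue measure is carried by the alias mR of R, the  *)
(* topology and the norm by R itself.                                          *)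
Definition lebesgue3 : set (mR * mR * mR) -> \bar R :=
  ((@lebesgue_measure R \x @lebesgue_measure R) \x @lebesgue_measure R)%E.

HB.instance Definition _ := Measure.on lebesgue3.

Lemma open_measurable3 (A : set (R * R * R)) :
  open A -> measurable (A : set (mR * mR * mR)).
Proof.
move=> oA; pose c (q : rat * rat * rat) : R * R * R :=
  (ratr q.1.1, ratr q.1.2, ratr q.2).
pose B (q : rat * rat * rat * rat) : set (R * R * R) := ball (c q.1) (ratr q.2).
have mB q : measurable (B q : set (mR * mR * mR)).
  have -> : B q = ball (ratr q.1.1.1 : R) (ratr q.2) `*`
      ball (ratr q.1.1.2 : R) (ratr q.2) `*`
      ball (ratr q.1.2 : R) (ratr q.2) :> set (R * R * R).
    by apply/seteqP; split => x.
  by apply: measurableX; [apply: measurableX|]; apply: open_measurable; exact: ball_open.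
rewrite (_ : A = \bigcup_(q in [set q | B q `<=` A]) B q).
  rewrite bigcup_mkcond; apply: countable_bigcupT_measurable => // q.
  by case: ifPn.
apply/seteqP; split => [x Ax|x [q] BA]; last exact: BA.
have [e e0 xeA] : exists2 e : R, 0 < e & ball x e `<=` A.
  by have /nbhs_ballP[e] := oA _ Ax; exists e.
have [r /[!in_itv]/= /andP[r0 re]] := rat_in_itvoo (divr_gt0 e0 (ltr0n R 2)).
have near (t : R) : exists q : rat, ball (ratr q : R) (ratr r) t.
  have /rat_in_itvoo[q] : t - ratr r < t + ratr r by rewrite ltrD2l gtrN.
  rewrite in_itv/= => /andP[q1 q2]; exists q.
  by rewrite /ball/= ltr_distlC ltrBlDr -ltrBlDr; apply/andP; lra.
have [[[q1 xq1] [q2 xq2]] [q3 xq3]] := (near x.1.1, near x.1.2, near x.2).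
exists (q1, q2, q3, r); last by split; [split|].
move=> y Bqy; apply: xeA; apply: (@le_ball _ _ _ (ratr r + ratr r)).
  by rewrite [leRHS]splitr lerD// ltW.
by apply: ball_triangle Bqy; apply: ball_sym; split; [split|].
Qed.

Definition e3 (j : 'I_3) : R * R * R :=
  ((j == 0)%:R, (j == 1)%:R, (j == 2)%:R).

Definition partial (j : 'I_3) (g : R * R * R -> R) (x : R * R * R) : R :=
  'D_(e3 j) g x.

Definition smooth (g : R * R * R -> R) : Prop := forall s : seq 'I_3,
  continuous (foldr partial g s) /\
  forall x j, derivable (foldr partial g s) x (e3 j).

Definition cpartial (j : 'I_3) (g : R * R * R -> R[i]) (x : R * R * R) : R[i] :=
  Complex (partial j (Re \o g) x) (partial j (Im \o g) x).

(* C_c^oo(Omega), as functions on R^3 with compact support in Omega.           *)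
Definition test_function (Omega : set (R * R * R)) (g : R * R * R -> R[i]) : Prop :=
  let supp := closure [set x | g x != 0] in
  [/\ smooth (Re \o g), smooth (Im \o g), compact supp & supp `<=` Omega].

Definition test_field (Omega : set (R * R * R)) (Psi : R * R * R -> 'rV[R[i]]_3)
    : Prop :=
  forall j, test_function Omega (fun x => Psi x 0 j).

(* 'I_3 is Z/3Z, so that j + 1 and j + 2 are the two indices following j in    *)
(* cyclic order.                                                               *)
Definition curl_field (Psi : R * R * R -> 'rV[R[i]]_3) (x : R * R * R) :
    'rV[R[i]]_3 :=
  \row_j (cpartial (j + 1) (fun y => Psi y 0 (j + 2)) x
          - cpartial (j + 2) (fun y => Psi y 0 (j + 1)) x).

Section curl.
(* Elements of L_2(Omega) are represented by functions on the whole of R^3,    *)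
(* identified when they agree a.e. on Omega.                                   *)
Variables (Omega : set (R * R * R)) (oOmega : open Omega).

Definition lebesgue_on : set (mR * mR * mR) -> \bar R :=
  mrestr lebesgue3 (open_measurable3 oOmega).

HB.instance Definition _ := Measure.on lebesgue_on.

Definition L2Omega : innerProductType R[i] := L2 lebesgue_on 3.

Local Open Scope quotient_scope.

Definition curl_c : set (L2Omega * L2Omega) :=
  [set p | exists Psi Phi : L2fun lebesgue_on 3,
    [/\ test_field Omega Psi, Phi = curl_field Psi :> (_ -> _)
      & p = (\pi_(L2 lebesgue_on 3) Psi, \pi_(L2 lebesgue_on 3) Phi)]].

Definition curl_0 : set (L2Omega * L2Omega) := closure curl_c.

Definition curl : set (L2Omega * L2Omega) := adjoint curl_0.

Definition curl_sharp : set (L2Omega * L2Omega) :=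
  [set p | curl p /\ closure (op_ran curl_0) p.2].

End curl.
End space3.

Arguments lebesgue_on {R Omega} oOmega.
Arguments L2Omega {R Omega} oOmega.
Arguments curl_c {R Omega} oOmega.
Arguments curl_0 {R Omega} oOmega.
Arguments curl {R Omega} oOmega.
Arguments curl_sharp {R Omega} oOmega.

(* Main.v *)
From HB Require Import structures.
Require Import Defs.
From mathcomp Require Import all_boot all_order all_algebra complex.
From mathcomp Require Import sesquilinear generic_quotient ring lra.
From mathcomp Require Import all_classical all_reals all_analysis measurable_realfun.
Import Order.TTheory GRing.Theory Num.Theory.
Import numFieldNormedType.Exports.
Set Implicit Arguments.
Unset Strict Implicit.
Unset Printing Implicit Defensive.
Local Open Scope classical_set_scope.
Local Open Scope ring_scope.
Local Notation Re := (@complex.Re _).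
Local Notation Im := (@complex.Im _).

(** The operator [curl^#] is the restriction of the adjoint of [curl_c] to
    vectors whose image lies in the closure of [ran curl_c].  Since [curl_c] is
    symmetric and maps its domain into itself, everything follows by abstract
    Hilbert space arguments once the pairings [<Psi, curl Phi>], for test fields
    with [|curl Psi| <= 1] and [|curl Phi| <= 1], are bounded for every [e > 0]
    by [e + \sum_k |<curl Psi, k>|] with finitely many vectors [k]: on
    [ker(curl^#)^\bot] the norm of [x] is then controlled by [e |curl x|] and
    finitely many functionals, an Ehrling-type inequality that gives compactness.

    To bound the pairing, translate [Psi]: put
    [T v = \sum_i \int Psi_i (x + v) (curl Phi)_i (x) dx].  A gradient is
    orthogonal to a curl, so in the derivative [d_j T] the field [d_j Psi] can be
    replaced by [d_j Psi - grad Psi_j], whose components are components of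
    [curl Psi] up to sign.  Hence [T] is Lipschitz with a uniform constant,
    [T 0] is close to an average of [T] over a small ball, and moving that ball
    along an axis until the supports are disjoint expresses the average through
    integrals of [curl Psi] against translates of one fixed kernel; a finite net
    of translates suffices, because these integrals are Lipschitz in the
    translation. *)

(** * Hilbert spaces *)

(** The domain is an arbitrary bounded open set, so nothing may rest on its boundary. What remains
    available is that a test field extended by zero is a smooth field on the whole space, where
    translations act: the estimate is proved there, and only for test fields.

    A test field is not controlled by its curl, since gradients have curl zero. If [m] is the
    projection of [Psi] to the closure of [ran curl_c], however, [|m|^2 = <Psi, m>] is a limit of
    pairings [<Psi, curl Phi>]. A bound on the pairings therefore bounds exactly the part of [Psi]
    that is orthogonal to the kernel, and makes the inverse of the reduced operator bounded and
    everywhere defined on that closure.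

    Averaging is what creates compactness. Fubini moves the kernel from the pairing to [curl Psi],
    and the averages of a bounded set of L_2 fields with bounded support against one Lipschitz
    kernel are Lipschitz with a common constant. The price is an error proportional to the size of
    the ball, and this error is the [e] of the estimate. *)

Section complex_modulus.
Variable R : realType.
Implicit Types z : R[i].

(** Modulus and norm over [R[i]] take values in [R[i]]; [cabs], and [hnm] for vectors, give their
    real values, so that estimates live in the ordered field [R]. *)
Definition cabs z : R := Re `|z|.

Lemma cabsE z : `|z| = (cabs z)%:C%C.
Proof. by rewrite /cabs RRe_real // normr_real. Qed.

Lemma cabs_ge0 z : 0 <= cabs z.
Proof. by rewrite -ler0c -cabsE. Qed.

Lemma cabsM z w : cabs (z * w) = cabs z * cabs w.
Proof. by apply: complexI; rewrite rmorphM /= -!cabsE normrM. Qed.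

Lemma cabsD z w : cabs (z + w) <= cabs z + cabs w.
Proof. by rewrite -lecR rmorphD /= -!cabsE ler_normD. Qed.

Lemma cabsN z : cabs (- z) = cabs z.
Proof. by rewrite /cabs normrN. Qed.

Lemma cabsB z w : cabs (z - w) <= cabs z + cabs w.
Proof. by rewrite -(cabsN w) cabsD. Qed.

Lemma cabs0 : cabs 0 = 0.
Proof. by rewrite /cabs normr0. Qed.

Lemma cabs_eq0 z : cabs z = 0 -> z = 0.
Proof. by move=> z0; apply/normr0_eq0; rewrite cabsE z0. Qed.

Lemma cabs_conj z : cabs z^* = cabs z.
Proof. by rewrite /cabs norm_conjC. Qed.

Lemma cabsR (r : R) : cabs r%:C%C = `|r|.
Proof. by rewrite /cabs normc_def /= expr0n addr0 sqrtr_sqr. Qed.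

Lemma cabs_sqr z : cabs z ^+ 2 = Re z ^+ 2 + Im z ^+ 2.
Proof. by rewrite /cabs normc_def /= sqr_sqrtr // addr_ge0 // sqr_ge0. Qed.

Lemma ge_Re_cabs z : `|Re z| <= cabs z.
Proof. by rewrite -lecR -cabsE normc_ge_Re. Qed.

Lemma ge_Im_cabs z : `|Im z| <= cabs z.
Proof.
rewrite -(ler_pXn2r (n := 2)) ?nnegrE ?cabs_ge0 //.
by rewrite cabs_sqr real_normK ?num_real // lerDr sqr_ge0.
Qed.

Lemma cabs_le_ReIm z : cabs z <= `|Re z| + `|Im z|.
Proof.
rewrite -(ler_pXn2r (n := 2)) ?nnegrE ?cabs_ge0 ?addr_ge0 //.
rewrite cabs_sqr sqrrD !real_normK ?num_real // addrAC lerDl.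
by rewrite mulrn_wge0 ?mulr_ge0.
Qed.

End complex_modulus.

Section inner_product_space.
Variables (R : realType) (H : innerProductType R[i]).
Implicit Types (x y z : H) (a : R[i]) (S : set H).

Definition hnm x : R := Re `|x|.

Lemma hnmE x : `|x| = (hnm x)%:C%C.
Proof. by rewrite /hnm RRe_real // normr_real. Qed.

Lemma hnm_ge0 x : 0 <= hnm x.
Proof. by rewrite -ler0c -hnmE. Qed.

Lemma hnmD x y : hnm (x + y) <= hnm x + hnm y.
Proof. by rewrite -lecR rmorphD /= -!hnmE ler_normD. Qed.

Lemma hnmN x : hnm (- x) = hnm x.
Proof. by rewrite /hnm normrN. Qed.

Lemma hnmB x y : hnm (x - y) <= hnm x + hnm y.
Proof. by rewrite -(hnmN y) hnmD. Qed.

Lemma hnm_sub x y z : hnm (x - z) <= hnm (x - y) + hnm (y - z).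
Proof. by apply: le_trans (hnmD _ _); rewrite addrA subrK. Qed.

Lemma hnmC x y : hnm (x - y) = hnm (y - x).
Proof. by rewrite -hnmN opprB. Qed.

Lemma hnm0 : hnm 0 = 0.
Proof. by rewrite /hnm normr0. Qed.

Lemma hnm_eq0 x : hnm x = 0 -> x = 0.
Proof. by move=> x0; apply/normr0_eq0; rewrite hnmE x0. Qed.

Lemma hnmZ a x : hnm (a *: x) = cabs a * hnm x.
Proof. by apply: complexI; rewrite rmorphM /= -!hnmE -cabsE normrZ. Qed.

Lemma innerDl x y z : inner (x + y) z = inner x z + inner y z.
Proof. exact: linearDl. Qed.

Lemma innerDr x y z : inner x (y + z) = inner x y + inner x z.
Proof. exact: linearDr. Qed.

Lemma innerBl x y z : inner (x - y) z = inner x z - inner y z.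
Proof. exact: linearBl. Qed.

Lemma innerBr x y z : inner x (y - z) = inner x y - inner x z.
Proof. exact: linearBr. Qed.

Lemma innerZl a x y : inner (a *: x) y = a * inner x y.
Proof. exact: linearZl_LR. Qed.

Lemma innerZr a x y : inner x (a *: y) = a^* * inner x y.
Proof. exact: linearZr_LR. Qed.

Lemma innerNr x y : inner x (- y) = - inner x y.
Proof. exact: linearNr. Qed.

Lemma inner0l x : inner 0 x = 0 :> R[i].
Proof. exact: linear0l. Qed.

Lemma inner0r x : inner x 0 = 0 :> R[i].
Proof. exact: linear0r. Qed.

Lemma innerC x y : inner x y = (inner y x)^* :> R[i].
Proof. by rewrite hermC expr0 mul1r. Qed.

Lemma inner_diag x : inner x x = (hnm x ^+ 2)%:C%C.
Proof. by rewrite -inner_norm hnmE rmorphXn. Qed.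

Lemma hnm_sqrD x y :
  hnm (x + y) ^+ 2 = hnm x ^+ 2 + hnm y ^+ 2 + 2 * Re (inner x y).
Proof.
apply: complexI; rewrite -inner_diag innerDl !innerDr (innerC y x).
rewrite !inner_diag [RHS]rmorphD [in RHS]rmorphD /=.
have -> : (2 * Re (inner x y))%:C%C = inner x y + (inner x y)^*.
  by rewrite addcJ rmorphM /= rmorph_nat.
ring.
Qed.

(** The triangle inequality belongs to the norm structure. Squared for [x + c *: y] with
    [c = inner x y], it bounds the cross term [2 |c|^2] by [2 |c| |x| |y|]. *)
Lemma cauchy_schwarz x y : cabs (inner x y) <= hnm x * hnm y.
Proof.
set c := inner x y.
have [/cabs_eq0 ->|c0] := eqVneq (cabs c) 0.
  by rewrite cabs0 mulr_ge0 ?hnm_ge0.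
have cp : 0 < cabs c by rewrite lt_def c0 cabs_ge0.
rewrite -(ler_pM2l cp) -(ler_pM2l (ltr0n R 2)).
have := hnm_sqrD x (c *: y).
have : hnm (x + c *: y) ^+ 2 <= (hnm x + hnm (c *: y)) ^+ 2.
  by rewrite ler_pXn2r ?nnegrE ?addr_ge0 ?hnm_ge0 // hnmD.
have -> : Re (inner x (c *: y)) = cabs c ^+ 2.
  rewrite innerZr -/c mulrC -normCK cabsE.
  by rewrite -(rmorphXn (real_complex R)).
by rewrite sqrrD hnmZ => h h'; move: h; rewrite h'; nra.
Qed.

Lemma hnm_parallelogram x y :
  hnm (x + y) ^+ 2 + hnm (x - y) ^+ 2 = 2 * (hnm x ^+ 2 + hnm y ^+ 2).
Proof.
rewrite !hnm_sqrD hnmN.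
have -> : Re (inner x (- y)) = - Re (inner x y).
  by rewrite innerNr raddfN.
by ring.
Qed.

Lemma hnm_pythagoras x y :
  inner x y = 0 -> hnm (x + y) ^+ 2 = hnm x ^+ 2 + hnm y ^+ 2.
Proof. by move=> xy; rewrite hnm_sqrD xy mulr0 addr0. Qed.

Lemma inner_eq0P x : inner x x = 0 -> x = 0.
Proof.
rewrite inner_diag => /complexI /eqP; rewrite sqrf_eq0 => /eqP.
exact: hnm_eq0.
Qed.

End inner_product_space.

Section Hilbert_space.
Variables (R : realType) (H : innerProductType R[i]).
Implicit Types (x y z : H) (a : R[i]) (S M : set H) (u : nat -> H).

Definition hcvg u x := forall e : R, 0 < e ->
  exists N, forall n, (N <= n)%N -> hnm (u n - x) < e.

Definition hcauchy u := forall e : R, 0 < e ->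
  exists N, forall m n, (N <= m)%N -> (N <= n)%N -> hnm (u m - u n) < e.

(** Completeness is not part of [innerProductType]; it is assumed where it is used and proved for
    [L2] in [L2_complete]. *)
Definition hcomplete := forall u, hcauchy u -> exists x, hcvg u x.

Definition subspace S := S 0 /\ forall a x y, S x -> S y -> S (a *: x + y).

Lemma subspaceD S x y : subspace S -> S x -> S y -> S (x + y).
Proof. by move=> [_ SP] Sx Sy; rewrite -[x]scale1r; exact: SP. Qed.

Lemma subspaceZ S a x : subspace S -> S x -> S (a *: x).
Proof. by move=> [S0 SP] Sx; rewrite -[X in S X]addr0; exact: SP. Qed.

Lemma subspaceB S x y : subspace S -> S x -> S y -> S (x - y).
Proof.
by move=> sS Sx Sy; apply: subspaceD => //; rewrite -scaleN1r; exact: subspaceZ.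
Qed.

Lemma ball_hnm x y (e : R[i]) : 0 < e -> ball x e y <-> hnm (x - y) < Re e.
Proof.
move=> e0; rewrite -ball_normE /ball_ /= hnmE.
have -> : e = (Re e)%:C%C by rewrite RRe_real // gtr0_real.
by rewrite ltcR.
Qed.

Lemma nbhs_hnm x (A : set H) :
  nbhs x A <-> exists2 e : R, 0 < e & forall y, hnm (x - y) < e -> A y.
Proof.
split=> [/nbhs_ballP[e e0 eA]|[e e0 eA]].
  have e0' : 0 < e := e0.
  exists (Re e) => [|y xy]; last by apply: eA; apply/ball_hnm.
  by rewrite -ltcR RRe_real // gtr0_real.
have e0' : 0 < e%:C%C by rewrite ltcR.
apply/nbhs_ballP; exists e%:C%C => // y /(ball_hnm _ _ e0').
exact: eA.
Qed.

Lemma closure_hnm S x :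
  closure S x <-> forall e : R, 0 < e -> exists2 y, S y & hnm (x - y) < e.
Proof.
split=> [cS e e0|Sx B /nbhs_hnm[e e0 eB]].
  have [|y [Sy ye]] := cS [set y | hnm (x - y) < e]; last by exists y.
  by apply/nbhs_hnm; exists e.
by have [y Sy xy] := Sx e e0; exists y; split => //; exact: eB.
Qed.

Lemma closure_subspace S : subspace S -> subspace (closure S).
Proof.
move=> sS; split; first by apply: subset_closure; case: sS.
move=> a x y /closure_hnm Sx /closure_hnm Sy; apply/closure_hnm => e e0.
have c0 : 0 < cabs a + 1 by rewrite ltr_wpDl // cabs_ge0.
have [x' Sx' xx'] := Sx (e / (2 * (cabs a + 1))) (divr_gt0 e0 (mulr_gt0 (ltr0n R 2) c0)).
have [y' Sy' yy'] := Sy (e / 2) (divr_gt0 e0 (ltr0n R 2)).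
exists (a *: x' + y'); first by case: sS => _; exact.
rewrite opprD addrACA -scalerBr.
apply: le_lt_trans (hnmD _ _) _; rewrite hnmZ [e]splitr ler_ltD //.
apply: (@le_trans _ _ ((cabs a + 1) * (e / (2 * (cabs a + 1))))).
  by rewrite ler_pM ?cabs_ge0 ?hnm_ge0 ?ltW // ltrDl.
by rewrite le_eqVlt; apply/orP; left; apply/eqP; field; rewrite lt0r_neq0.
Qed.

Lemma orthogonal_compl_subspace S : subspace (orthogonal_compl S).
Proof.
split=> [y _|a x y Sx Sy z Sz]; first exact: inner0l.
by rewrite innerDl innerZl Sx // Sy // mulr0 addr0.
Qed.

Lemma orthogonal_compl_closure S x :
  orthogonal_compl S x -> orthogonal_compl (closure S) x.
Proof.
move=> Sx y /closure_hnm Sy; apply: cabs_eq0; apply/eqP.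
rewrite eq_le cabs_ge0 andbT leNgt; apply/negP => c0.
have n0 : 0 < hnm x + 1 by rewrite ltr_wpDl // hnm_ge0.
have [z Sz yz] := Sy (cabs (inner x y) / (hnm x + 1)) (divr_gt0 c0 n0).
have : inner x y = inner x (y - z) by rewrite innerBr (Sx z Sz) subr0.
move/(congr1 (@cabs R)); apply/eqP; rewrite gt_eqF //.
apply: (le_lt_trans (cauchy_schwarz _ _)).
apply: (@le_lt_trans _ _ ((hnm x + 1) * hnm (y - z))).
  by rewrite ler_wpM2r ?hnm_ge0 // lerDl.
by rewrite mulrC -ltr_pdivlMr.
Qed.

(** * Orthogonal projection onto a closed subspace *)

Section projection.
Hypothesis cH : hcomplete.

Lemma nearest_point M x : subspace M -> closure M `<=` M ->
  exists2 m, M m & forall y, M y -> hnm (x - m) <= hnm (x - y).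
Proof.
move=> sM cM; pose D := [set hnm (x - m) | m in M]; pose d := inf D.
have D0 : has_inf D.
  split; first by exists (hnm (x - 0)), 0 => //; case: sM.
  by exists 0 => _ [m _ <-]; exact: hnm_ge0.
have dM m : M m -> d <= hnm (x - m).
  by move=> Mm; apply: ge_inf; [case: D0|exists m].
have d0 : 0 <= d.
  by apply: lb_le_inf; [case: D0|move=> _ [m _ <-]; exact: hnm_ge0].
have /choice[u uP] : forall n, exists m, M m /\ hnm (x - m) < d + n.+1%:R^-1.
  move=> n; have n0 : 0 < n.+1%:R^-1 :> R by rewrite invr_gt0 ltr0n.
  have [_ [m Mm <-] mn] := inf_adherent n0 D0.
  by exists m.
(* The midpoint of [u m] and [u n] lies in [M], so the parallelogram identity bounds [|u m - u n|^2]
   by [4 (d + t)^2 - 4 d^2 = 8 d t + 4 t^2], and [t <= 1]. *)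
have step (m n N : nat) : (N <= m)%N -> (N <= n)%N ->
    hnm (u m - u n) ^+ 2 <= (8 * d + 4) * N.+1%:R^-1.
  move=> Nm Nn; set t := N.+1%:R^-1.
  have t0 : 0 < t by rewrite invr_gt0 ltr0n.
  have t1 : t <= 1 by rewrite invf_le1 ?ltr0n // ler1n.
  have B k : (N <= k)%N -> hnm (x - u k) <= d + t.
    move=> Nk; apply: le_trans (ltW (uP k).2) _.
    by rewrite lerD2l lef_pV2 ?posrE ?ltr0n // ler_nat.
  have := hnm_parallelogram (x - u m) (x - u n).
  have -> : x - u m + (x - u n) = 2 *: (x - 2^-1 *: (u m + u n)).
    rewrite scalerBr scalerA mulfV ?pnatr_eq0 // scale1r.
    by rewrite scaler_nat opprD mulr2n addrACA.
  have -> : x - u m - (x - u n) = - (u m - u n).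
    by rewrite !opprB addrC addrA subrK.
  rewrite hnmN hnmZ (_ : cabs 2 = 2); last first.
    by rewrite -(rmorph_nat (real_complex R)) cabsR normr_nat.
  have := dM _ (subspaceZ 2^-1 sM (subspaceD sM (uP m).1 (uP n).1)).
  move: (B m Nm) (B n Nn) (hnm_ge0 (x - u m)) (hnm_ge0 (x - u n)).
  move: (hnm (x - u m)) (hnm (x - u n)) (hnm (x - _ *: _)) (hnm (u m - u n)).
  move=> A1 A2 A3 A4 A1d A2d A10 A20 dA3 E.
  have -> : A4 ^+ 2 = 2 * (A1 ^+ 2 + A2 ^+ 2) - (2 * A3) ^+ 2 by rewrite -E; ring.
  have : d ^+ 2 <= A3 ^+ 2 by rewrite ler_pXn2r ?nnegrE // (le_trans d0).
  have : A1 ^+ 2 <= (d + t) ^+ 2 by rewrite ler_pXn2r ?nnegrE // addr_ge0 // ltW.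
  have : A2 ^+ 2 <= (d + t) ^+ 2 by rewrite ler_pXn2r ?nnegrE // addr_ge0 // ltW.
  have : t ^+ 2 <= t by rewrite expr2 ger_pMl.
  by nra.
have [|m um] := cH (u := u).
  move=> e e0.
  have K0 : 0 < 8 * d + 4 by rewrite ltr_wpDl // mulr_ge0.
  have [N _ NP] := near_infty_natSinv_lt (PosNum (divr_gt0 (exprn_gt0 2 e0) K0)).
  exists N => m n Nm Nn; rewrite -(ltr_pXn2r (n := 2)) ?nnegrE ?hnm_ge0 ?ltW //.
  apply: le_lt_trans (step _ _ _ Nm Nn) _.
  by rewrite mulrC -ltr_pdivlMr //; exact: (NP N (leqnn N)).
exists m => [|y My].
  apply: cM; apply/closure_hnm => e e0; have [N NP] := um e e0.
  by exists (u N); [exact: (uP N).1|rewrite hnmC NP].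
apply: le_trans (dM _ My); apply/ler_addgt0Pr => e e0.
have e20 : 0 < e / 2 by rewrite divr_gt0.
have [N1 N1P] := um _ e20.
have [N2 _ N2P] := near_infty_natSinv_lt (PosNum e20).
pose n := maxn N1 N2.
apply: le_trans (hnm_sub _ (u n) _) _; rewrite [e]splitr addrA lerD //.
  apply: ltW; apply: lt_trans (uP n).2 _; rewrite ltrD2l.
  by apply: N2P; rewrite /= leq_maxr.
by apply: ltW; apply: N1P; rewrite leq_maxl.
Qed.

Lemma orthogonal_projection M x : subspace M -> closure M `<=` M ->
  exists2 m, M m & orthogonal_compl M (x - m).
Proof.
move=> sM cM; have [m Mm mP] := nearest_point x sM cM.
exists m => // y My; set c := inner (x - m) y.
apply: cabs_eq0; apply/eqP; rewrite eq_le cabs_ge0 andbT leNgt; apply/negP => c0.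
(* Replacing [m] by [m + t c y] changes the squared distance to [x] by [t |c|^2 (t |y|^2 - 2)],
   which is negative because [t |y|^2 < 1]. *)
pose t : R := (hnm y ^+ 2 + 1)^-1.
have n0 : 0 < hnm y ^+ 2 + 1 by rewrite ltr_wpDl // sqr_ge0.
have t0 : 0 < t by rewrite invr_gt0.
pose a : R[i] := - (t%:C%C * c).
have : hnm (x - m) ^+ 2 <= hnm (x - m + a *: y) ^+ 2.
  rewrite ler_pXn2r ?nnegrE ?hnm_ge0 //.
  have -> : x - m + a *: y = x - (m - a *: y) by rewrite opprB addrA addrAC.
  by apply: mP; apply: subspaceB => //; exact: subspaceZ.
rewrite [X in _ <= X]hnm_sqrD hnmZ cabsN cabsM cabsR (ger0_norm (ltW t0)).
rewrite innerZr -/c.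
have -> : Re (a^* * c) = - (t * cabs c ^+ 2).
  rewrite /a rmorphN rmorphM mulNr -mulrA [c^* * c]mulrC -normCK cabsE /=.
  by ring.
have : t * (hnm y ^+ 2 + 1) = 1 by rewrite mulVf // lt0r_neq0.
have : 0 < t * cabs c ^+ 2 by rewrite mulr_gt0 // exprn_gt0.
move: (hnm (x - m)) (hnm y) (cabs c) => A B c' h1 h2 h3.
have : t * c' ^+ 2 * (t * B ^+ 2) < t * c' ^+ 2 * 1.
  rewrite ltr_pM2l //; rewrite -h2 mulrDr mulr1 ltrDl //.
have -> : t * c' ^+ 2 * (t * B ^+ 2) = (t * c' * B) ^+ 2 by ring.
by move: h3 h1; move: (_ ^+ 2) (_ ^+ 2) (t * _) => p q r; lra.
Qed.

Lemma orthogonal_compl2 M x : subspace M -> closure M `<=` M ->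
  orthogonal_compl (orthogonal_compl M) x -> M x.
Proof.
move=> sM cM ox; have [m Mm om] := orthogonal_projection x sM cM.
suff /inner_eq0P/eqP : inner (x - m) (x - m) = 0 by rewrite subr_eq0 => /eqP ->.
by rewrite innerBl (ox _ om) innerC (om _ Mm) conjC0 subr0.
Qed.

Lemma dense_orthogonal S : subspace S ->
  (forall x, orthogonal_compl S x -> x = 0) -> dense S.
Proof.
move=> sS oS O [x Ox] oO.
suff /closure_hnm cx : closure S x.
  have /nbhs_hnm[e e0 eO] : nbhs x O by exact: open_nbhs_nbhs.
  by have [y Sy xy] := cx e e0; exists y; split => //; exact: eO.
have [|m Sm om] := orthogonal_projection x (closure_subspace sS).
  by rewrite -(closure_id _).1 //; exact: closed_closure.
have /oS/eqP : orthogonal_compl S (x - m).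
  by move=> y Sy; apply: om; exact: subset_closure.
by rewrite subr_eq0 => /eqP ->.
Qed.

End projection.
End Hilbert_space.

(** The image filter lives on a compact segment and has a cluster point there. An ultrafilter
    contains either the preimage of a small ball around that point or its complement, and clustering
    excludes the complement. *)
Lemma ultra_bounded_oscillation (R : realType) (T : Type) (F : set_system T)
    (f : T -> R) (c e : R) : UltraFilter F -> F [set z | `|f z| <= c] -> 0 < e ->
  exists2 A, F A & forall z w, A z -> A w -> `|f z - f w| < e.
Proof.
move=> UF Fc e0.
have Fseg : (f @ F) `[- c, c]%classic.
  suff: F (f @^-1` `[- c, c]%classic) by [].
  by apply: filterS Fc => z; rewrite /= in_itv /= ler_norml.
have [p [_ cp]] := segment_compact (fmap_proper_filter f _) Fseg.
have [FA|FA] := in_ultra_setVsetC (f @^-1` ball p (e / 2)) UF.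
  exists (f @^-1` ball p (e / 2)) => // z w pz pw.
  by have : ball (f z) e (f w) := ball_splitr pz pw; rewrite -ball_normE.
have FA' : (f @ F) (~` ball p (e / 2)) by [].
by have [t [pt bt]] := cp _ _ FA' (nbhsx_ballx p (e / 2) (divr_gt0 e0 (ltr0n R 2))).
Qed.

(** * Relative compactness through ultrafilters *)

Section relatively_compact.
Variables (R : realType) (H : innerProductType R[i]).
Hypothesis cH : @hcomplete R H.

(** The filter contains finite intersections of sets [A k] of diameter below [1 / (k + 1)]. Points
    chosen in these intersections form a Cauchy sequence, and its limit attracts the filter. *)
Lemma ultra_cvg (F : set_system H) : UltraFilter F ->
  (forall e : R, 0 < e -> exists2 A, F A & forall z w, A z -> A w -> hnm (z - w) < e) ->
  exists x : H, nbhs x `<=` F.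
Proof.
move=> UF osc.
have /choice[A AP] : forall n, exists A, F A /\
    forall z w, A z -> A w -> hnm (z - w) < n.+1%:R^-1.
  move=> n; have [|A FA oA] := osc n.+1%:R^-1; first by rewrite invr_gt0 ltr0n.
  by exists A.
have FA n : F [set z | forall k, (k <= n)%N -> A k z].
  elim: n => [|n IHn].
    by apply: filterS (AP 0).1 => z Az [].
  apply: filterS (filterI IHn (AP n.+1).1) => z [Az An] k.
  by rewrite leq_eqVlt => /predU1P[->//|]; exact: Az.
have /choice[z zP] : forall n, exists z, forall k, (k <= n)%N -> A k z.
  by move=> n; have [z zA] := filter_ex (FA n); exists z.
have small (e : R) : 0 < e -> exists N, N.+1%:R^-1 < e.
  move=> e0; have [N _ NP] := near_infty_natSinv_lt (PosNum e0).
  by exists N; exact: (NP N (leqnn N)).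
have [|x zx] := cH (u := z).
  move=> e e0; have [N Ne] := small e e0.
  exists N => m n Nm Nn; apply: lt_trans Ne.
  by apply: (AP N).2; exact: zP.
exists x => U /nbhs_hnm[e e0 eU].
have e20 : 0 < e / 2 by rewrite divr_gt0.
have [N Ne] := small _ e20.
have [N' N'P] := zx _ e20.
apply: filterS (AP N).1 => w Aw; apply: eU; pose n := maxn N N'.
apply: le_lt_trans (hnm_sub _ (z n) _) _; rewrite [e]splitr ltrD //.
  by rewrite hnmC N'P // leq_maxr.
by apply: lt_trans Ne; apply: (AP N).2 => //; apply: zP; rewrite leq_maxl.
Qed.

(* An Ehrling-type inequality against finitely many functionals makes every    *)
(* ultrafilter on the image of a ball a Cauchy filter.                         *)
Lemma precompact_bounded_image (B : set (H * H)) (c : R) :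
  (forall p q, B p -> B q -> B (p.1 - q.1, p.2 - q.2)) ->
  (forall e : R, 0 < e -> exists ks : seq H, forall p, B p ->
     hnm p.1 <= e * hnm p.2 + \sum_(k <- ks) cabs (inner p.2 k)) ->
  precompact (fst @` [set p | B p /\ hnm p.2 <= c]).
Proof.
move=> BB est; rewrite precompactE compact_ultra => F UF Fc.
have [|x Fx] := ultra_cvg UF; last first.
  exists x; split => //.
  apply: closed_closure => U xU.
  by have [z [cz Uz]] := filter_ex (filterI Fc (Fx _ xU)); exists z.
move=> e e0.
have e60 : 0 < e / 6 by rewrite divr_gt0.
(* [c] may be nonpositive. With the positive upper bound [c1], the factor [e / 6 / (2 * c1)] keeps
   the norm term of the estimate below [e / 6] on differences of two admissible vectors. *)
pose c1 := Num.max c 0 + 1.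
have cc1 : c <= c1 by rewrite (@le_trans _ _ (Num.max c 0)) // ?le_max ?lexx // lerDl.
have c10 : 0 < c1 by rewrite ltr_wpDl // le_max lexx orbT.
have /choice[P PP] : forall z, exists p, closure (fst @` [set p | B p /\ hnm p.2 <= c]) z ->
    [/\ B p, hnm p.2 <= c & hnm (z - p.1) < e / 6].
  move=> z; case: (pselect (closure (fst @` [set p | B p /\ hnm p.2 <= c]) z)) => [|nz].
    by move=> /closure_hnm/(_ _ e60)[_ [p [Bp pc] <-] zp]; exists p.
  by exists (0, 0).
have [ks ksP] := est _ (divr_gt0 e60 (mulr_gt0 (ltr0n R 2) c10)).
(* Each functional is bounded on the chosen pairs, so its real and imaginary parts oscillate little
   on a set of the filter; finitely many such sets are intersected. *)
have osc (s : seq H) (d : R) : 0 < d -> exists2 A, F A &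
    forall z w, A z -> A w -> \sum_(k <- s) cabs (inner ((P z).2 - (P w).2) k) < d.
  elim: s d => [|k s IHs] d d0.
    by exists setT => [|z w _ _]; [exact: filterT|rewrite big_nil].
  have d30 : 0 < d / 3 by rewrite divr_gt0.
  have [A FA AP] := IHs _ d30.
  have bnd z : closure (fst @` [set p | B p /\ hnm p.2 <= c]) z ->
      cabs (inner (P z).2 k) <= c * hnm k.
    move=> /PP[_ pc _]; apply: le_trans (cauchy_schwarz _ _) _.
    by rewrite ler_wpM2r // hnm_ge0.
  have [A1 FA1 A1P] := @ultra_bounded_oscillation R _ F
    (fun z => Re (inner (P z).2 k)) (c * hnm k) (d / 3) UF
    (filterS (fun z cz => le_trans (ge_Re_cabs _) (bnd z cz)) Fc) d30.
  have [A2 FA2 A2P] := @ultra_bounded_oscillation R _ F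
    (fun z => Im (inner (P z).2 k)) (c * hnm k) (d / 3) UF
    (filterS (fun z cz => le_trans (ge_Im_cabs _) (bnd z cz)) Fc) d30.
  exists (A `&` (A1 `&` A2)); first by apply: filterI => //; exact: filterI.
  move=> z w [Az [A1z A2z]] [Aw [A1w A2w]]; rewrite big_cons.
  apply: le_lt_trans (lerD (cabs_le_ReIm _) (lexx _)) _.
  rewrite innerBl !raddfB /=.
  by move: (A1P _ _ A1z A1w) (A2P _ _ A2z A2w) (AP _ _ Az Aw); lra.
have [A FA AP] := osc ks _ e60.
exists (A `&` closure (fst @` [set p | B p /\ hnm p.2 <= c])); first exact: filterI.
move=> z w [Az cz] [Aw cw].
have [Bz zc zP] := PP _ cz; have [Bw wc wP] := PP _ cw.
apply: le_lt_trans (hnm_sub _ (P z).1 _) _.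
apply: le_lt_trans (lerD (lexx _) (hnm_sub _ (P w).1 _)) _.
rewrite hnmC in wP.
have := ksP _ (BB _ _ Bz Bw) => /=.
have : e / 6 / (2 * c1) * hnm ((P z).2 - (P w).2) <= e / 6.
  rewrite -[leRHS]mulr1 -mulrA ler_pM2l // ler_pdivrMl ?mulr_gt0 // mulr1.
  apply: le_trans (hnmB _ _) _; rewrite mulr_natl mulr2n.
  by rewrite lerD // (le_trans _ cc1).
by move: (AP _ _ Az Aw); lra.
Qed.

End relatively_compact.

(** * Restrictions of the adjoint of a symmetric operator *)

Section operator_estimate.
Variables (R : realType) (H : innerProductType R[i]).
Hypothesis cH : @hcomplete R H.
Variable C : set (H * H).
Hypothesis C0 : C (0, 0).
Hypothesis CP : forall a p q, C p -> C q -> C (a *: p.1 + q.1, a *: p.2 + q.2).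
Hypothesis Csym : forall p q, C p -> C q -> inner p.2 q.1 = inner p.1 q.2.
Hypothesis Cran : op_ran C `<=` op_dom C.
Hypothesis Cest : forall e : R, 0 < e -> exists ks : seq H, forall p q, C p -> C q ->
  hnm p.2 <= 1 -> hnm q.2 <= 1 ->
  cabs (inner p.1 q.2) <= e + \sum_(k <- ks) cabs (inner p.2 k).

Local Notation M := (closure (op_ran C)).
Local Notation N := (orthogonal_compl (op_ran C)).

Lemma op_ran_subspace : subspace (op_ran C).
Proof.
split; first by exists (0, 0).
by move=> a _ _ [p Cp <-] [q Cq <-]; exists (a *: p.1 + q.1, a *: p.2 + q.2) => //; exact: CP.
Qed.

Let sM : subspace M. Proof. exact: closure_subspace op_ran_subspace. Qed.

Let cM : closure M `<=` M.
Proof. by rewrite -(closure_id _).1 //; exact: closed_closure. Qed.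

Let CB p q : C p -> C q -> C (p.1 - q.1, p.2 - q.2).
Proof. by move=> Cp Cq; have := CP (-1) Cq Cp; rewrite !scaleN1r ![- _ + _]addrC. Qed.

Let CZ a p : C p -> C (a *: p.1, a *: p.2).
Proof. by move=> Cp; have := CP a Cp C0; rewrite !addr0. Qed.

Lemma orth_closure_eq0 x : M x -> N x -> x = 0.
Proof.
by move=> Mx /orthogonal_compl_closure/(_ _ Mx) /inner_eq0P.
Qed.

(** To be read for the inverse map, from [p.2] to [p.1]: up to a small multiple of the norm,
    finitely many functionals of the argument control the value. *)
Definition ehrling (e : R) (ks : seq H) (p : H * H) :=
  hnm p.1 <= e * hnm p.2 + \sum_(k <- ks) cabs (inner p.2 k).

(** The bound on unit balls is homogeneous in both arguments and extends to the closure of the range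
    by density. Normalisation breaks down for [p.2 = 0], where symmetry gives
    [inner p.1 q.2 = inner p.2 q.1 = 0]. *)
Lemma pairing_estimate (e : R) (ks : seq H) : 0 <= e ->
  (forall p q, C p -> C q -> hnm p.2 <= 1 -> hnm q.2 <= 1 ->
    cabs (inner p.1 q.2) <= e + \sum_(k <- ks) cabs (inner p.2 k)) ->
  forall p y, C p -> M y ->
    cabs (inner p.1 y) <= hnm y * (e * hnm p.2 + \sum_(k <- ks) cabs (inner p.2 k)).
Proof.
move=> e0 est p y Cp My.
set K := _ + _.
have K0 : 0 <= K by rewrite addr_ge0 ?mulr_ge0 ?hnm_ge0 // sumr_ge0 // => *; exact: cabs_ge0.
have ranE q : C q -> cabs (inner p.1 q.2) <= hnm q.2 * K.
  move=> Cq.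
  have [/hnm_eq0 q20|q20] := eqVneq (hnm q.2) 0.
    by rewrite q20 inner0r cabs0 mulr_ge0 ?hnm_ge0.
  have [/hnm_eq0 p20|p20] := eqVneq (hnm p.2) 0.
    by rewrite -Csym // p20 inner0l cabs0 mulr_ge0 ?hnm_ge0.
  have p2p : 0 < hnm p.2 by rewrite lt_def p20 hnm_ge0.
  have q2p : 0 < hnm q.2 by rewrite lt_def q20 hnm_ge0.
  have n1 x : 0 < hnm x -> hnm ((hnm x)^-1%:C%C *: x) = 1.
    by move=> x0; rewrite hnmZ cabsR ger0_norm ?invr_ge0 ?hnm_ge0 // mulVf // lt0r_neq0.
  have := est _ _ (CZ (hnm p.2)^-1%:C%C Cp) (CZ (hnm q.2)^-1%:C%C Cq).
  rewrite /= !n1 // => /(_ (lexx _) (lexx _)).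
  rewrite innerZl innerZr !cabsM cabs_conj !cabsR !ger0_norm ?invr_ge0 ?hnm_ge0 //.
  under eq_bigr do rewrite innerZl cabsM cabsR ger0_norm ?invr_ge0 ?hnm_ge0 //.
  rewrite -mulr_sumr ler_pdivrMl // mulrDr mulrA mulfV // mul1r ler_pdivrMl // => h.
  by apply: le_trans h _; rewrite /K [hnm p.2 * e]mulrC.
apply/ler_addgt0Pr => d d0.
have c0 : 0 < hnm p.1 + K + 1 by rewrite ltr_wpDl // addr_ge0 // hnm_ge0.
move/closure_hnm : My => /(_ _ (divr_gt0 d0 c0))[_ [q Cq <-]].
rewrite ltr_pdivlMr // => yq.
have -> : inner p.1 y = inner p.1 q.2 + inner p.1 (y - q.2).
  by rewrite -innerDr addrC subrK.
apply: le_trans (cabsD _ _) _; apply: le_trans (lerD (ranE _ Cq) (cauchy_schwarz _ _)) _.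
have : hnm q.2 <= hnm y + hnm (y - q.2).
  by rewrite -[in X in X <= _](subrK y q.2) addrC hnmC hnmD.
move=> /(ler_wpM2r K0).
move: (hnm_ge0 (y - q.2)) yq; move: (hnm (y - q.2)) (hnm p.1) (hnm y) (hnm q.2).
by move=> a b c f *; nra.
Qed.

(** With the closure of the range as ambient space, this turns out to be the graph, second component
    first, of the inverse of the reduced operator: single valued, everywhere defined, bounded and
    symmetric. *)
Definition inv_graph : set (H * H) := [set p | adjoint C p /\ M p.1 /\ M p.2].
Local Notation B := inv_graph.

(** Projecting [p.1] removes a vector orthogonal to the range, which the adjoint relation does not
    see. As [|m|^2 = inner p.1 m], the pairing estimate becomes a bound on [m]. The vector [m] does
    not depend on [e] and [ks], so one [m] carries all estimates at once. *)
Lemma proj_inv_graph p : C p -> exists m, [/\ N (p.1 - m), B (m, p.2) &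
  forall (e : R) ks, 0 <= e -> (forall p q, C p -> C q -> hnm p.2 <= 1 -> hnm q.2 <= 1 ->
    cabs (inner p.1 q.2) <= e + \sum_(k <- ks) cabs (inner p.2 k)) ->
    ehrling e ks (m, p.2)].
Proof.
move=> Cp; have [m Mm om] := orthogonal_projection cH p.1 sM cM.
have Nm : N (p.1 - m) by move=> y ry; apply: om; exact: subset_closure.
exists m; split => //.
  split=> [q Cq /=|]; last by split => //; apply: subset_closure; exists p.
  rewrite -(Csym Cq Cp); apply/eqP; rewrite eq_sym -subr_eq0 -innerBr innerC.
  by rewrite Nm ?conjC0 //; exists q.
move=> e ks e0 est; rewrite /ehrling /=.
have [->|m0] := eqVneq m 0.
  by rewrite hnm0 addr_ge0 ?mulr_ge0 ?hnm_ge0 // sumr_ge0 // => *; exact: cabs_ge0.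
have mp : 0 < hnm m.
  by rewrite lt_def hnm_ge0 andbT; apply: contra m0 => /eqP/hnm_eq0 ->.
rewrite -(ler_pM2l mp); apply: le_trans (pairing_estimate e0 est Cp Mm).
rewrite -expr2 -[X in X <= _]ger0_norm ?sqr_ge0 // -cabsR -inner_diag.
have -> // : inner m m = inner p.1 m.
apply/eqP; rewrite eq_sym -subr_eq0 -innerBl; apply/eqP; exact: om.
Qed.

Lemma inv_graphB p q : B p -> B q -> B (p.1 - q.1, p.2 - q.2).
Proof.
move=> [Ap [M1 M2]] [Aq [M3 M4]]; split; last by split; exact: (subspaceB sM).
by move=> r Cr /=; rewrite !innerBr Ap // Aq.
Qed.

Lemma inv_graph_fun x x' y : B (x, y) -> B (x', y) -> x = x'.
Proof.
move=> Bx Bx'; have /= [Ax [Mx _]] := inv_graphB Bx Bx'.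
apply/eqP; rewrite -subr_eq0; apply/eqP; apply: orth_closure_eq0 => // _ [p Cp <-].
by rewrite innerC (Ax p Cp) /= subrr inner0r conjC0.
Qed.

(** [y] is a limit of elements of the range, and the projected preimages of these are Cauchy by the
    estimate with [e = 1]. Both the adjoint relation and the Ehrling inequality pass to the
    limit. *)
Lemma inv_graph_total y : M y -> exists x, B (x, y) /\
  forall (e : R) ks, 0 <= e -> (forall p q, C p -> C q -> hnm p.2 <= 1 -> hnm q.2 <= 1 ->
    cabs (inner p.1 q.2) <= e + \sum_(k <- ks) cabs (inner p.2 k)) ->
    ehrling e ks (x, y).
Proof.
move=> My.
have /choice[p pP] : forall n : nat, exists p, C p /\ hnm (y - p.2) < n.+1%:R^-1.
  move=> n; move/closure_hnm : My => /(_ n.+1%:R^-1)[|_ [p Cp <-] yp].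
    by rewrite invr_gt0 ltr0n.
  by exists p.
have /choice[m mP] : forall n : nat, exists m, [/\ N ((p n).1 - m), B (m, (p n).2) &
  forall (e : R) ks, 0 <= e -> (forall p q, C p -> C q -> hnm p.2 <= 1 -> hnm q.2 <= 1 ->
    cabs (inner p.1 q.2) <= e + \sum_(k <- ks) cabs (inner p.2 k)) ->
    ehrling e ks (m, (p n).2)].
  by move=> n; have [Cp _] := pP n; exact: proj_inv_graph.
have [ks0 ks0P] := Cest ltr01.
pose K := 1 + \sum_(k <- ks0) hnm k.
have K0 : 0 < K by rewrite ltr_pwDl // sumr_ge0 // => *; exact: hnm_ge0.
(* The projection of a difference is the difference of the projections, by uniqueness of the
   preimage; Cauchy-Schwarz on the functionals then gives the Lipschitz constant [K]. *)
have lip i j : hnm (m i - m j) <= hnm ((p i).2 - (p j).2) * K.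
  have [r [_ Br rP]] := proj_inv_graph (CB (pP i).1 (pP j).1).
  have -> : m i - m j = r.
    apply: inv_graph_fun Br => /=; have [_ Bi _] := mP i; have [_ Bj _] := mP j.
    exact: inv_graphB Bi Bj.
  apply: le_trans (rP _ _ ler01 ks0P) _; rewrite /= mul1r mulrDr mulr1 lerD2l.
  by rewrite mulr_sumr; apply: ler_sum => k _; exact: cauchy_schwarz.
have small (e : R) : 0 < e -> exists N, forall n, (N <= n)%N -> hnm (y - (p n).2) < e.
  move=> e0; have [k _ kP] := near_infty_natSinv_lt (PosNum e0).
  by exists k => n kn; apply: lt_trans (pP n).2 _; exact: kP.
have [|x mx] := cH (u := m).
  move=> e e0; have [k kP] := small (e / (2 * K)) (divr_gt0 e0 (mulr_gt0 (ltr0n R 2) K0)).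
  exists k => i j ki kj; apply: le_lt_trans (lip i j) _; rewrite -ltr_pdivlMr //.
  apply: le_lt_trans (hnm_sub _ y _) _; rewrite hnmC.
  apply: lt_le_trans (ltrD (kP _ ki) (kP _ kj)) _.
  by rewrite le_eqVlt; apply/orP; left; apply/eqP; field; rewrite lt0r_neq0.
have appr (e : R) : 0 < e -> exists n, hnm (y - (p n).2) < e /\ hnm (x - m n) < e.
  move=> e0; have [k1 k1P] := small _ e0; have [k2 k2P] := mx _ e0.
  exists (maxn k1 k2); split; first by rewrite k1P // leq_maxl.
  by rewrite hnmC k2P // leq_maxr.
exists x; split.
  split=> [q Cq /=|].
    apply/eqP; rewrite -subr_eq0; apply/eqP/cabs_eq0/eqP.
    rewrite eq_le cabs_ge0 andbT; apply/ler_addgt0Pr => e e0; rewrite add0r.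
    have c0 : 0 < hnm q.2 + hnm q.1 + 1 by rewrite ltr_wpDl // addr_ge0 // hnm_ge0.
    have [n [n1 n2]] := appr _ (divr_gt0 e0 c0).
    have [_ [An _] _] := mP n.
    have -> : inner q.2 x - inner q.1 y =
        inner q.2 (x - m n) - inner q.1 (y - (p n).2).
      by rewrite !innerBr (An q Cq) /=; ring.
    apply: le_trans (cabsB _ _) _.
    apply: le_trans (lerD (cauchy_schwarz _ _) (cauchy_schwarz _ _)) _.
    move: n1 n2; rewrite !ltr_pdivlMr //; move: (hnm_ge0 q.2) (hnm_ge0 q.1).
    by move: (hnm_ge0 (x - m n)) (hnm_ge0 (y - (p n).2)); nra.
  split => //=; apply: cM; apply/closure_hnm => e e0.
  have [n [_ xn]] := appr e e0; exists (m n) => //.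
  by have [_ [_ []]] := mP n.
move=> e ks e0 est; rewrite /ehrling /=; apply/ler_addgt0Pr => d d0.
(* [L] collects the Lipschitz constants of the two sides in [x] and [y], so displacements below
   [d / 2 / L] cost less than [d]. *)
pose L := 1 + e + \sum_(k <- ks) hnm k.
have L0 : 0 < L by rewrite ltr_wpDr ?ltr_wpDr // sumr_ge0 // => *; exact: hnm_ge0.
have [n [n1 n2]] := appr _ (divr_gt0 (divr_gt0 d0 (ltr0n R 2)) L0).
have [_ _ /(_ e ks e0 est)] := mP n; rewrite /ehrling /= => mn.
have xm : hnm x <= hnm (m n) + hnm (x - m n).
  by rewrite -[in X in X <= _](subrK (m n) x) addrC hnmD.
have yp : hnm (p n).2 <= hnm y + hnm (y - (p n).2).
  by rewrite -[in X in X <= _](subrK y (p n).2) addrC hnmC hnmD.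
have sp : \sum_(k <- ks) cabs (inner (p n).2 k) <=
    \sum_(k <- ks) cabs (inner y k) + hnm (y - (p n).2) * \sum_(k <- ks) hnm k.
  rewrite mulr_sumr -big_split /=; apply: ler_sum => k _.
  have -> : inner (p n).2 k = inner y k - inner (y - (p n).2) k by rewrite innerBl; ring.
  by apply: le_trans (cabsB _ _) _; rewrite lerD2l cauchy_schwarz.
have s0 : 0 <= \sum_(k <- ks) hnm k by rewrite sumr_ge0 // => *; exact: hnm_ge0.
move: n1 n2; rewrite !ltr_pdivlMr // /L => n1 n2.
move: (hnm_ge0 (x - m n)) (hnm_ge0 (y - (p n).2)) (ler_wpM2l e0 yp) => h1 h2 h3.
have h4 : 0 <= hnm (x - m n) * (e + \sum_(k <- ks) hnm k) by rewrite mulr_ge0 // addr_ge0.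
move: n1 n2 h1 h2 h3 h4 s0 sp xm mn; move: (hnm (y - _)) (hnm (x - _)) => a b.
move: (hnm x) (hnm y) (hnm (m n)) (hnm (p n).2) (\sum_(k <- ks) hnm k).
move: (\sum_(k <- ks) cabs (inner (p n).2 k)) (\sum_(k <- ks) cabs (inner y k)).
by move=> ? ? ? ? ? ? ? *; nra.
Qed.

Lemma inv_graph_ehrling (e : R) : 0 < e -> exists ks, forall p, B p -> ehrling e ks p.
Proof.
move=> e0; have [ks ksP] := Cest e0; exists ks => -[x y] Bp.
have [x' [Bx']] := inv_graph_total Bp.2.2.
by rewrite (inv_graph_fun Bp Bx'); apply => //; exact: ltW.
Qed.

Lemma inv_graph_bounded : exists2 K : R, 0 < K & forall p, B p -> hnm p.1 <= K * hnm p.2.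
Proof.
have [ks ksP] := inv_graph_ehrling ltr01.
exists (1 + \sum_(k <- ks) hnm k) => [|p /ksP Bp].
  by rewrite ltr_pwDl // sumr_ge0 // => *; exact: hnm_ge0.
apply: le_trans Bp _; rewrite mulrDl lerD2l mulr_suml.
by apply: ler_sum => k _; rewrite mulrC cauchy_schwarz.
Qed.

(** For [r] in [C] the adjoint relation gives [inner r.2 q.1 = inner r.1 q.2], and [q.2] does not
    see the part of [r.1] orthogonal to the range. Boundedness of the inverse extends the identity
    from such pairs to all of the graph. *)
Lemma inv_graph_sym p q : B p -> B q -> inner p.2 q.1 = inner p.1 q.2.
Proof.
move=> Bp [Aq [Mq1 Mq2]]; have [K K0 KP] := inv_graph_bounded.
apply/eqP; rewrite -subr_eq0; apply/eqP/cabs_eq0/eqP.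
rewrite eq_le cabs_ge0 andbT; apply/ler_addgt0Pr => e e0; rewrite add0r.
have c0 : 0 < hnm q.1 + K * hnm q.2 + 1.
  by rewrite ltr_wpDl // addr_ge0 ?hnm_ge0 // mulr_ge0 ?hnm_ge0 // ltW.
move/closure_hnm : (Bp.2.2) => /(_ _ (divr_gt0 e0 c0))[_ [r Cr <-]].
rewrite ltr_pdivlMr // => pr.
have [m [Nm Bm _]] := proj_inv_graph Cr.
have E : inner r.2 q.1 = inner m q.2.
  rewrite (Aq r Cr); apply/eqP; rewrite -subr_eq0 -innerBl; apply/eqP.
  exact: orthogonal_compl_closure Mq2.
have -> : inner p.2 q.1 - inner p.1 q.2 =
    inner (p.2 - r.2) q.1 - inner (p.1 - m) q.2 by rewrite !innerBl E; ring.
apply: le_trans (cabsB _ _) _.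
apply: le_trans (lerD (cauchy_schwarz _ _) (cauchy_schwarz _ _)) _.
have /= := KP _ (inv_graphB Bp Bm); move=> /(ler_wpM2r (hnm_ge0 q.2)).
by move: pr; move: (hnm_ge0 (p.2 - r.2)) (hnm_ge0 q.1) (hnm_ge0 q.2) K0; nra.
Qed.

(** The adjoint relation makes [y] orthogonal to the domain of [C]. The domain contains the range,
    in whose closure [y] lies. *)
Lemma inv_graph_inj y : B (0, y) -> y = 0.
Proof.
move=> [Ay [_ /= My]]; apply: orth_closure_eq0 => // z /Cran[p Cp <-].
by rewrite innerC -(Ay p Cp) /= inner0r conjC0.
Qed.

(** For [C = curl_c] this is [curl_sharp], since passing to [curl_0] changes neither the adjoint nor
    the closure of the range. *)
Definition sharp : set (H * H) := [set p | adjoint C p /\ M p.2].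

(** Together with [inv_graph_sharp], this splits the operator: an invertible part on the closure of
    the range, and zero on the orthogonal complement. *)
Lemma sharpP x y : sharp (x, y) -> exists x', B (x', y) /\ N (x - x').
Proof.
move=> [Axy /= My]; have [x' [Bx' _]] := inv_graph_total My.
exists x'; split => // _ [p Cp <-]; have [Ax' _] := Bx'.
by rewrite innerC innerBr (Axy p Cp) (Ax' p Cp) subrr conjC0.
Qed.

Lemma inv_graph_sharp x y n : B (x, y) -> N n -> sharp (x + n, y).
Proof.
move=> [Ax [_ My]] Nn; split => // p Cp /=.
have -> : inner p.2 (x + n) = inner p.2 x + inner p.2 n by rewrite innerDr.
by rewrite (Ax p Cp) [inner p.2 n]innerC Nn ?conjC0 ?addr0 //; exists p.
Qed.

Lemma sharp_ker : op_ker sharp = N.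
Proof.
apply/seteqP; split => x.
  move=> [Ax _] _ [p Cp <-].
  by rewrite innerC (Ax p Cp) /= inner0r conjC0.
move=> Nx; rewrite /op_ker /= -[x]add0r; apply: inv_graph_sharp => //.
split; last by split; case: sM.
by move=> p _ /=; rewrite !inner0r.
Qed.

Lemma orthogonal_compl_ker x : orthogonal_compl N x -> M x.
Proof.
move=> ox; apply: (orthogonal_compl2 cH sM cM) => y My.
by apply: ox => z Sz; apply: My; exact: subset_closure.
Qed.

Lemma reduced_sharp : reduced sharp `<=` B.
Proof.
move=> p [[Ap Mp2]]; rewrite sharp_ker => /orthogonal_compl_ker Mp1.
by split.
Qed.

Lemma sharp_compact : compact_domain_embedding (reduced sharp).
Proof.
apply: precompact_subset (precompact_bounded_image cH 1 inv_graphB inv_graph_ehrling).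
move=> _ [p [/reduced_sharp Bp pn] <-]; exists p => //; split => //.
rewrite -lecR -hnmE; apply: le_trans pn; rewrite /graph_norm.
rewrite -[leLHS]sqrCK // ler_sqrtC ?nnegrE ?exprn_ge0 ?addr_ge0 ?exprn_ge0 //.
by rewrite lerDr exprn_ge0.
Qed.

Lemma sharp_subspace a p q : sharp p -> sharp q -> sharp (a *: p.1 + q.1, a *: p.2 + q.2).
Proof.
move=> [Ap Mp] [Aq Mq]; split; last by case: sM => _; apply.
by move=> r Cr /=; rewrite !innerDr !innerZr Ap // Aq.
Qed.

Lemma sharp_sym p q : sharp p -> sharp q -> inner p.2 q.1 = inner p.1 q.2.
Proof.
case: p q => [x y] [z w] Sp Sq.
have [x' [Bx' Nx]] := sharpP Sp; have [z' [Bz' Nz]] := sharpP Sq.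
have MN (n m : H) : N n -> M m -> inner m n = 0.
  by move=> Nn Mm; rewrite innerC (orthogonal_compl_closure Nn Mm) conjC0.
rewrite /= -[z](subrK z') -[x](subrK x') innerDr innerDl.
rewrite (MN _ _ Nz Sp.2) [inner (x - x') _]innerC (MN _ _ Nx Sq.2) conjC0 !add0r.
exact: inv_graph_sym Bx' Bz'.
Qed.

(** For [(a, b)] in the adjoint, [b] is orthogonal to the kernel, hence in the closure of the range,
    where the inverse supplies a preimage [x]. Symmetry of the inverse makes [a - x] orthogonal to
    the range, so that [a] differs from [x] by an element of the kernel. *)
Lemma sharp_adjoint : adjoint sharp = sharp.
Proof.
apply/seteqP; split => [[a b] Aab|p Sp q Sq]; last exact: sharp_sym.
have Mb : M b.
  apply: orthogonal_compl_ker => n Nn.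
  have : op_ker sharp n by rewrite sharp_ker.
  by move=> /Aab /=; rewrite inner0l [inner b n]innerC => <-; rewrite conjC0.
have [x [Bx _]] := inv_graph_total Mb.
rewrite -[a](subrK x) addrC; apply: inv_graph_sharp => // y Sy.
have My : M y by exact: subset_closure.
have [z [Bz _]] := inv_graph_total My.
have := Aab _ (inv_graph_sharp Bz (proj1 (orthogonal_compl_subspace _))).
rewrite /= addr0 => E; rewrite innerC innerBr E.
by rewrite -(inv_graph_sym Bz Bx) subrr conjC0.
Qed.

(** A vector [x] orthogonal to the domain is orthogonal to the kernel, so the inverse is defined at
    [x], with value [w]. By symmetry of the inverse [w] is orthogonal to the range, hence zero, and
    then [x = 0] by [inv_graph_inj]. *)
Lemma sharp_dense : dense (op_dom sharp).
Proof.
have s0 : sharp (0, 0).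
  by split; [move=> p _ /=; rewrite !inner0r|case: sM].
apply: (dense_orthogonal cH).
  split; first by exists (0, 0).
  move=> a _ _ [p Sp <-] [q Sq <-].
  by exists (a *: p.1 + q.1, a *: p.2 + q.2) => //; exact: sharp_subspace.
move=> x ox.
have Mx : M x.
  apply: orthogonal_compl_ker => n Nn; apply: ox.
  by exists (n, 0) => //; have : op_ker sharp n by rewrite sharp_ker.
have [w [Bw _]] := inv_graph_total Mx.
suff w0 : w = 0 by move: Bw; rewrite w0 => /inv_graph_inj.
apply: orth_closure_eq0; first by case: Bw => _ [].
move=> y Sy; have [z [Bz _]] := inv_graph_total (subset_closure Sy).
have := inv_graph_sym Bz Bw => /= zw.
rewrite innerC zw innerC ox ?conjC0 //.
exists (z, y) => //; rewrite -[z]addr0.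
by apply: inv_graph_sharp => //; case: (orthogonal_compl_subspace (op_ran C)).
Qed.

(** Otherwise there are unit vectors with [p.2 - l p.1] tending to 0. Their components in the kernel
    tend to 0 because [l != 0], and their components [u n] in the closure of the range stay in a
    relatively compact set. A cluster point [v] satisfies the eigenvalue equation, hence vanishes,
    against [|p.1| = 1]. *)
Lemma sharp_bounded_below (l : R[i]) : l != 0 -> (forall x, sharp (x, l *: x) -> x = 0) ->
  exists2 c : R, 0 < c & forall p, sharp p -> c * hnm p.1 <= hnm (p.2 - l *: p.1).
Proof.
move=> l0 noeig; apply: contrapT => nb.
have cl0 : 0 < cabs l by rewrite lt_def cabs_ge0 andbT; apply: contra l0 => /eqP/cabs_eq0 ->.
have /choice[p pP] : forall n : nat, exists p,
    [/\ sharp p, hnm p.1 = 1 & hnm (p.2 - l *: p.1) < n.+1%:R^-1].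
  move=> n; apply: contrapT => np; apply: nb; exists n.+1%:R^-1 => [|p Sp].
    by rewrite invr_gt0 ltr0n.
  rewrite leNgt; apply/negP => lt; apply: np.
  have p0 : 0 < hnm p.1.
    rewrite lt_def hnm_ge0 andbT; apply/eqP => p10; move: lt.
    by rewrite p10 mulr0 ltNge hnm_ge0.
  pose t := (hnm p.1)^-1%:C%C.
  have ct : cabs t = (hnm p.1)^-1 by rewrite cabsR ger0_norm // invr_ge0 hnm_ge0.
  exists (t *: p.1, t *: p.2); split => /=.
  - have /= := sharp_subspace t Sp (_ : sharp (0, 0)); rewrite !addr0; apply.
    by split; [move=> q _ /=; rewrite !inner0r|case: sM].
  - by rewrite hnmZ ct mulVf // lt0r_neq0.
  - by rewrite scalerA mulrC -scalerA -scalerBr hnmZ ct mulrC ltr_pdivrMr.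
have /choice[u uP] : forall n, exists u, B (u, (p n).2) /\ N ((p n).1 - u).
  by move=> n; have [] := pP n; case: (p n) => x y /= /sharpP[u]; exists u.
(* [p.2 - l u] lies in the closure of the range and [l (p.1 - u)] is orthogonal to it. *)
have orth n : hnm ((p n).2 - l *: (p n).1) ^+ 2 =
    hnm ((p n).2 - l *: u n) ^+ 2 + (cabs l * hnm ((p n).1 - u n)) ^+ 2.
  rewrite -hnmZ -(hnmN (l *: _)) -hnm_pythagoras.
    by rewrite scalerBr opprB addrA subrK.
  have [[_ [Mu Mp]] Nn] := uP n.
  rewrite innerNr innerZr innerC (orthogonal_compl_closure Nn).
    by rewrite conjC0 mulr0 oppr0.
  by apply: (subspaceB sM) => //; exact: (subspaceZ l sM).
have lt2 (a b c : R) : 0 <= a -> 0 <= b -> a ^+ 2 = b ^+ 2 + c ^+ 2 -> b <= a.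
  by move=> a0 b0 E; rewrite -(ler_pXn2r (n := 2)) // E lerDl sqr_ge0.
have o1 n : hnm ((p n).2 - l *: u n) < n.+1%:R^-1.
  have [_ _] := pP n; apply: le_lt_trans; apply: lt2 (orth n); exact: hnm_ge0.
have o2 n : cabs l * hnm ((p n).1 - u n) < n.+1%:R^-1.
  have [_ _] := pP n; apply: le_lt_trans.
  apply: lt2 (etrans (orth n) (addrC _ _)); first exact: hnm_ge0.
  by rewrite mulr_ge0 ?cabs_ge0 ?hnm_ge0.
have := precompact_bounded_image cH (1 + cabs l) inv_graphB inv_graph_ehrling.
set T := fst @` _; rewrite precompactE => cT.
have uT n : T (u n).
  exists (u n, (p n).2) => //; split; first exact: (uP n).1.
  have [_ p1 pn] := pP n.
  rewrite /= -[(p n).2](subrK (l *: (p n).1)); apply: le_trans (hnmD _ _) _.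
  rewrite hnmZ p1 mulr1 lerD2r (le_trans (ltW pn)) // invf_le1 ?ltr0n //.
  by rewrite ler1n.
have [|v [_ vP]] := cT (u @ \oo) _.
  by exists 0 => // n _; apply: subset_closure; exact: uT.
(* Only a cluster point is known, so indices near [v] are picked one at a time, each late enough for
   [n.+1%:R^-1 < e]. *)
have appr (e : R) : 0 < e -> exists n, hnm (v - u n) < e /\ n.+1%:R^-1 < e.
  move=> e0; have [k _ kP] := near_infty_natSinv_lt (PosNum e0).
  have Fk : (u @ \oo) (u @` [set n | (k <= n)%N]).
    by exists k => // n kn /=; exists n.
  have nv : nbhs v [set y | hnm (v - y) < e] by apply/nbhs_hnm; exists e.
  have [_ [[n kn <-] vn]] := vP _ _ Fk nv.
  by exists n; split => //; exact: (kP n kn).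
have Sv : sharp (v, l *: v).
  rewrite -sharp_adjoint => q Sq /=.
  apply/eqP; rewrite -subr_eq0; apply/eqP/cabs_eq0/eqP.
  rewrite eq_le cabs_ge0 andbT; apply/ler_addgt0Pr => e e0; rewrite add0r.
  pose K := hnm q.2 + hnm q.1 * (1 + cabs l) + 1.
  have K0 : 0 < K.
    by rewrite ltr_wpDl // addr_ge0 ?hnm_ge0 // mulr_ge0 ?hnm_ge0 // addr_ge0 // cabs_ge0.
  have [n [n1 n2]] := appr _ (divr_gt0 (divr_gt0 e0 (ltr0n R 2)) K0).
  have Sn : sharp (u n, (p n).2).
    by have [[Au [_ Mp]] _] := uP n.
  have E := sharp_sym Sq Sn; rewrite /= in E.
  have -> : inner q.2 v - inner q.1 (l *: v) = inner q.2 (v - u n) +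
      inner q.1 ((p n).2 - l *: u n) - inner q.1 (l *: (v - u n)).
    by rewrite scalerBr !innerBr E; ring.
  apply: le_trans (cabsB _ _) _; apply: le_trans (lerD (cabsD _ _) (lexx _)) _.
  apply: le_trans (lerD (lerD (cauchy_schwarz _ _) (cauchy_schwarz _ _)) (cauchy_schwarz _ _)) _.
  have o1n := lt_trans (o1 n) n2.
  rewrite hnmZ; move: n1 o1n; rewrite !ltr_pdivlMr // /K.
  move: (hnm_ge0 (v - u n)) (hnm_ge0 ((p n).2 - l *: u n)) (hnm_ge0 q.2) (hnm_ge0 q.1) (cabs_ge0 l).
  move: (hnm (v - u n)) (hnm ((p n).2 - l *: u n)) (hnm q.2) (hnm q.1) (cabs l).
  move=> a b c d f a0 b0 c0 d0 f0 h1 h2.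
  have : 0 <= a * d by rewrite mulr_ge0.
  have : 0 <= b * c by rewrite mulr_ge0.
  have : 0 <= b * (d * f) by rewrite !mulr_ge0.
  by nra.
have v0 : v = 0 by exact: noeig.
(* The two bounds make [|v - u n|] and [|p.1 - u n|] each less than 1/2, the second after division
   by [|l|]; with [v = 0] this contradicts [|p.1| = 1]. *)
have e0 : 0 < Num.min (1 / 2) (cabs l / 2).
  by rewrite lt_min !divr_gt0.
have [n [n1 n2]] := appr _ e0.
have [_ p1 _] := pP n.
have : hnm (p n).1 <= hnm ((p n).1 - u n) + hnm (v - u n).
  rewrite -[X in hnm X <= _](subrK (u n)); apply: le_trans (hnmD _ _) _.
  by rewrite lerD2l v0 sub0r hnmN.
move: n1 n2 (o2 n); rewrite !lt_min p1 => /andP[n1 _] /andP[_ n2] o2n.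
have := lt_trans o2n n2; rewrite mulrC -ltr_pdivlMr // mulrAC mulfV ?lt0r_neq0 //.
by move: n1; lra.
Qed.

End operator_estimate.

(** * Resolvent and spectrum of a selfadjoint operator *)

Section resolvent.
Variables (R : realType) (H : innerProductType R[i]).
Hypothesis cH : @hcomplete R H.
Variable S : set (H * H).
Hypothesis S0 : S (0, 0).
Hypothesis SP : forall a p q, S p -> S q -> S (a *: p.1 + q.1, a *: p.2 + q.2).
Hypothesis Sadj : adjoint S = S.

Let SB p q : S p -> S q -> S (p.1 - q.1, p.2 - q.2).
Proof. by move=> Cp Cq; have := SP (-1) Cq Cp; rewrite !scaleN1r ![- _ + _]addrC. Qed.

Lemma selfadjoint_sym p q : S p -> S q -> inner p.2 q.1 = inner p.1 q.2.
Proof. by move=> Sp; rewrite -{1}Sadj; exact. Qed.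

Lemma selfadjoint_closed x y :
  (forall e : R, 0 < e -> exists p, [/\ S p, hnm (x - p.1) < e & hnm (y - p.2) < e]) ->
  S (x, y).
Proof.
move=> appr; rewrite -Sadj => q Sq /=.
apply/eqP; rewrite -subr_eq0; apply/eqP/cabs_eq0/eqP.
rewrite eq_le cabs_ge0 andbT; apply/ler_addgt0Pr => e e0; rewrite add0r.
have K0 : 0 < hnm q.1 + hnm q.2 + 1 by rewrite ltr_wpDl // addr_ge0 ?hnm_ge0.
have [p [Sp p1 p2]] := appr _ (divr_gt0 e0 K0).
have -> : inner q.2 x - inner q.1 y = inner q.2 (x - p.1) - inner q.1 (y - p.2).
  by rewrite !innerBr (selfadjoint_sym Sq Sp); ring.
apply: le_trans (cabsB _ _) _; apply: le_trans (lerD (cauchy_schwarz _ _) (cauchy_schwarz _ _)) _.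
move: p1 p2; rewrite !ltr_pdivlMr //.
have := mulr_ge0 (hnm_ge0 q.1) (hnm_ge0 (x - p.1)).
have := mulr_ge0 (hnm_ge0 q.2) (hnm_ge0 (y - p.2)).
by move: (hnm_ge0 (x - p.1)) (hnm_ge0 (y - p.2)); nra.
Qed.

(** The lower bound makes [S - l] injective with closed range, [S] being closed as an adjoint. A
    vector orthogonal to the range lies in the kernel of [S - l^*], which is trivial, so the range
    is everything and [c^-1] bounds the inverse. *)
Lemma selfadjoint_resolvent (l : R[i]) (c : R) : 0 < c ->
  (forall p, S p -> c * hnm p.1 <= hnm (p.2 - l *: p.1)) ->
  (forall x, S (x, l^* *: x) -> x = 0) -> resolvent_set S l.
Proof.
move=> c0 bb noeig.
have shiftP x y : op_shift S l (x, y) <-> S (x, y + l *: x).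
  split=> [[p Sp [<- <-]]|Sp]; first by rewrite subrK; case: p Sp.
  by exists (x, y + l *: x) => //=; rewrite addrK.
have bound x y : op_shift S l (x, y) -> c * hnm x <= hnm y.
  by move/shiftP/bb => /=; rewrite addrK.
pose Rg := [set y | exists x, op_shift S l (x, y)].
have sRg : subspace Rg.
  split; first by exists 0; apply/shiftP; rewrite scaler0 addr0.
  move=> a y y' [x /shiftP Sx] [x' /shiftP Sx']; exists (a *: x + x').
  apply/shiftP; have := SP a Sx Sx' => /=; congr S; congr pair.
  by rewrite !scalerDr !scalerA [l * a]mulrC addrACA.
have cRg : closure Rg `<=` Rg.
  move=> y /closure_hnm cy.
  have /choice[p pP] : forall n : nat, exists p : H * H, op_shift S l p /\
      hnm (y - p.2) < n.+1%:R^-1.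
    move=> n; have [|y' [x' Sx'] yy'] := cy n.+1%:R^-1; first by rewrite invr_gt0 ltr0n.
    by exists (x', y').
  have small (e : R) : 0 < e -> exists k, forall n, (k <= n)%N -> hnm (y - (p n).2) < e.
    move=> e0; have [k _ kP] := near_infty_natSinv_lt (PosNum e0).
    by exists k => n kn; apply: lt_trans (pP n).2 _; exact: kP.
  have [|x px] := cH (u := fun n => (p n).1).
    move=> e e0; have [k kP] := small (c * e / 2) (divr_gt0 (mulr_gt0 c0 e0) (ltr0n R 2)).
    exists k => i j ki kj; rewrite -(ltr_pM2l c0).
    have Sij : op_shift S l ((p i).1 - (p j).1, (p i).2 - (p j).2).
      have [+ _] := pP i; have [+ _] := pP j.
      case: (p i) (p j) => a b [a' b'] /= /shiftP Sj /shiftP Si; apply/shiftP.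
      by have /= := SB Si Sj; rewrite scalerBr opprD addrACA.
    apply: le_lt_trans (bound _ _ Sij) _; apply: le_lt_trans (hnm_sub _ y _) _.
    rewrite hnmC; have := ltrD (kP _ ki) (kP _ kj).
    by rewrite -splitr.
  exists x; apply/shiftP; apply: selfadjoint_closed => e e0.
  pose K := 1 + cabs l.
  have K0 : 0 < K by rewrite ltr_pwDl // cabs_ge0.
  have eK : 0 < e / 2 / K by rewrite !divr_gt0.
  have eKe : e / 2 / K <= e / 2.
    by rewrite ler_pdivrMr // ler_peMr ?lerDl ?cabs_ge0 // divr_ge0 // ltW.
  have [k1 k1P] := small _ eK; have [k2 k2P] := px _ eK.
  pose n := maxn k1 k2.
  have n1 := k1P n (leq_maxl _ _); have n2 := k2P n (leq_maxr _ _).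
  exists ((p n).1, (p n).2 + l *: (p n).1); split => /=.
  - by have [+ _] := pP n; case: (p n) => a b /shiftP.
  - by rewrite hnmC; apply: lt_le_trans n2 _; apply: le_trans eKe _; lra.
  - rewrite opprD addrACA -scalerBr; apply: le_lt_trans (hnmD _ _) _.
    rewrite hnmZ hnmC [hnm (x - _)]hnmC; rewrite hnmC in n1.
    move: n1 n2; rewrite !ltr_pdivlMr // /K.
    have := hnm_ge0 ((p n).2 - y); have := hnm_ge0 ((p n).1 - x).
    have := mulr_ge0 (hnm_ge0 ((p n).2 - y)) (cabs_ge0 l).
    by nra.
have Rg_total y : Rg y.
  apply: (orthogonal_compl2 cH sRg cRg) => z oz.
  suff -> : z = 0 by rewrite inner0r.
  apply: noeig; rewrite -Sadj => p Sp /=.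
  have : inner z (p.2 - l *: p.1) = 0.
    by apply: oz; exists p.1; apply/shiftP; rewrite subrK; case: p Sp.
  rewrite innerBr innerZr => /eqP; rewrite subr_eq0 => /eqP E.
  by rewrite innerZr conjCK [LHS]innerC E (rmorphM Num.conj) /= conjCK -innerC.
split=> [y|].
  have [x Sx] := Rg_total y; exists x; split => // x' Sx'.
  have Sd : op_shift S l (x - x', 0).
    move/shiftP : Sx => Sx; move/shiftP : Sx' => Sx'; apply/shiftP.
    by have := SB Sx Sx' => /=; rewrite opprD addrACA subrr -scalerBr.
  have := bound _ _ Sd; rewrite hnm0 => h.
  apply/eqP; rewrite -subr_eq0; apply/eqP/hnm_eq0/eqP.
  by rewrite eq_le hnm_ge0 andbT -(pmulr_rle0 _ c0).
exists (c^-1)%:C%C => x y /bound h.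
by rewrite !hnmE -(rmorphM (real_complex R)) lecR ler_pdivlMl.
Qed.

(** [inner p.2 p.1] is real, so the imaginary part of [inner (p.2 - l *: p.1) p.1] is
    [- Im l |p.1|^2]; Cauchy-Schwarz concludes. *)
Lemma selfadjoint_im_bound (l : R[i]) p : S p ->
  `|Im l| * hnm p.1 <= hnm (p.2 - l *: p.1).
Proof.
move=> Sp; have [->|p0] := eqVneq (hnm p.1) 0; first by rewrite mulr0 hnm_ge0.
have pp : 0 < hnm p.1 by rewrite lt_def p0 hnm_ge0.
rewrite -(ler_pM2r pp); apply: le_trans (cauchy_schwarz _ _).
apply: le_trans (ge_Im_cabs _).
have Ip : Im (inner p.2 p.1) = 0.
  have := selfadjoint_sym Sp Sp; rewrite [inner p.1 p.2]innerC.
  by case: (inner p.2 p.1) => a b /= [] /eqP; rewrite -subr_eq0 opprK -mulr2n mulrn_eq0 /= => /eqP.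
rewrite innerBl innerZl inner_diag raddfB /= Ip sub0r normrN.
by case: l => a b /=; rewrite mulr0 add0r normrM [`|hnm _ ^+ 2|]ger0_norm ?sqr_ge0 // -mulrA.
Qed.

Lemma selfadjoint_spectrum_real : spectrum S `<=` range (real_complex R).
Proof.
move=> l Sl; apply: contrapT => nl; apply: Sl.
have l0 : Im l != 0.
  apply/eqP => l0; apply: nl; exists (Re l) => //.
  by case: l l0 => a b /= ->.
apply: (@selfadjoint_resolvent l `|Im l|); first by rewrite normr_gt0.
  by move=> p; exact: selfadjoint_im_bound.
move=> x Sx; have := selfadjoint_im_bound l^* Sx; rewrite /= subrr hnm0.
have -> : `|Im l^*| = `|Im l| by case: (l) => a b /=; rewrite normrN.
rewrite pmulr_rle0 ?normr_gt0 // => h; apply/hnm_eq0/eqP.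
by rewrite eq_le h hnm_ge0.
Qed.

End resolvent.

Lemma bessel_inequality (R : realType) (H : innerProductType R[i]) (I : eqType)
    (e : I -> H) (s : seq I) (k : H) :
  (forall i, i \in s -> hnm (e i) = 1) ->
  {in s &, forall i j, i != j -> inner (e i) (e j) = 0} -> uniq s ->
  \sum_(i <- s) cabs (inner (e i) k) ^+ 2 <= hnm k ^+ 2.
Proof.
move=> e1 eo us.
(* [k'] is what remains of [k] after its projections are removed. The first clause says that vectors
   orthogonal to the family do not notice the removal, which is what the next [e i] requires in the
   induction. *)
suff [k' [_ ->]] : exists k', (forall v, (forall i, i \in s -> inner v (e i) = 0) ->
    inner v k' = inner v k) /\
    \sum_(i <- s) cabs (inner (e i) k) ^+ 2 = hnm k ^+ 2 - hnm k' ^+ 2.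
  by rewrite lerBlDr lerDl sqr_ge0.
elim: s e1 eo us => [|i s IHs] e1 eo us; first by exists k; rewrite big_nil subrr.
move: us => /= /andP[si us].
have [|||k' [k'P k'E]] := IHs => //.
- by move=> j js; rewrite e1 // inE js orbT.
- by move=> j j' js j's; apply: eo; rewrite inE ?js ?j's orbT.
have ik : inner (e i) k' = inner (e i) k.
  apply: k'P => j js; apply: eo; rewrite ?mem_head ?inE ?js ?orbT //.
  by apply: contraNneq si => ->.
set c := inner (e i) k in ik *.
exists (k' - c^* *: e i); split.
  move=> v vo; rewrite innerBr innerZr vo ?mem_head // mulr0 subr0.
  by apply: k'P => j js; rewrite vo // inE js orbT.
rewrite big_cons k'E.
have o : inner (k' - c^* *: e i) (c^* *: e i) = 0.
  rewrite innerZr innerBl innerZl inner_diag e1 ?mem_head // expr1n mulr1.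
  by rewrite innerC ik -/c subrr mulr0.
have := hnm_pythagoras o; rewrite subrK hnmZ cabs_conj e1 ?mem_head // mulr1 => ->.
by ring.
Qed.

(** * Finitely many eigenvalues in bounded intervals *)

Section discrete_spectrum.
Variables (R : realType) (H : innerProductType R[i]).
Variable B : set (H * H).
Hypothesis BZ : forall a p, B p -> B (a *: p.1, a *: p.2).
Hypothesis Bsym : forall p q, B p -> B q -> inner p.2 q.1 = inner p.1 q.2.
Hypothesis Best : forall e : R, 0 < e -> exists ks : seq H, forall p, B p -> ehrling e ks p.

(** A count: by the Ehrling inequality every unit eigenvector has a definite share in the finitely
    many directions [ks], while by Bessel's inequality orthonormal vectors together can spend at
    most [|k|^2] on each [k]. The resulting bound on their number is [K]. *)
Lemma finite_eigenvalues (c : R) :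
  finite_set [set r : R | `|r| <= c /\ exists2 x, x != 0 & B (x, r%:C%C *: x) /\ r != 0].
Proof.
set E := [set r | _]; apply: contrapT => infE.
have [|c0] := leP c 0.
  move=> c0; apply: infE; apply: (@sub_finite_set _ _ [set 0]); last exact: finite_set1.
  by move=> r [rc _]; apply/eqP; rewrite -normr_le0 (le_trans rc).
(* With [e = 1 / (2 c)] the norm term of a unit eigenvector is at most 1/2, so [c] times the sum of
   its functionals is at least 1/2. *)
have [ks ksP] := Best (divr_gt0 ltr01 (mulr_gt0 (ltr0n R 2) c0)).
(* In [a <= d + a^2 / d], summed over [ks], this [d] leaves at most [1 / (4 c)] to the constant
   terms, so the squares must supply the other [1 / (4 c)]. *)
pose d := (4 * c * ((size ks)%:R + 1))^-1.
have d0 : 0 < d by rewrite invr_gt0 !mulr_gt0 // ltr_wpDl.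
pose K := 4 * c / d * \sum_(k <- ks) hnm k ^+ 2.
have K0 : 0 <= K.
  apply: mulr_ge0; last by rewrite sumr_ge0 // => k _; exact: sqr_ge0.
  by rewrite ltW // divr_gt0 // mulr_gt0.
have [A [uA AP cA]] : exists A : seq R,
    [/\ uniq A, forall r, r \in A -> E r & ((Num.trunc K).+1 <= size A)%N].
  have [A AE cA] := infinite_set_fset (Num.trunc K).+1 infE.
  by exists (finmap.enum_fset A); split => //; exact: finmap.fset_uniq.
have /choice[e eP] : forall r : R, exists x : H, E r ->
    [/\ hnm x = 1, B (x, r%:C%C *: x) & r != 0].
  move=> r; case: (pselect (E r)) => [|nE]; last by exists 0.
  move=> [_ [x x0 [Bx r0]]].
  have nx : hnm x != 0 by apply: contra x0 => /eqP/hnm_eq0 ->.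
  exists ((hnm x)^-1%:C%C *: x) => _; split=> //.
    by rewrite hnmZ cabsR ger0_norm ?invr_ge0 ?hnm_ge0 // mulVf.
  by have := BZ (hnm x)^-1%:C%C Bx; rewrite /= !scalerA mulrC.
have orth : {in A &, forall r r', r != r' -> inner (e r) (e r') = 0}.
  move=> r r' /AP/eP[_ Br _] /AP/eP[_ Br' _] rr'.
  have := Bsym Br Br'; rewrite /= innerZl innerZr => /eqP.
  have -> : (r'%:C%C)^* = r'%:C%C :> R[i] by rewrite conj_Creal // complex_real.
  rewrite -subr_eq0 -mulrBl mulf_eq0 -rmorphB /= => /orP[|/eqP //].
  by rewrite -(rmorph0 (real_complex R)) (inj_eq (@complexI R)) subr_eq0 (negPf rr').
have lower r : r \in A -> 1 <= 4 * c / d * \sum_(k <- ks) cabs (inner (e r) k) ^+ 2.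
  move=> rA; have [e1 Be r0] := eP _ (AP _ rA); have [rc _] := AP _ rA.
  have := ksP _ Be; rewrite /ehrling /= hnmZ e1 cabsR mulr1.
  have -> : \sum_(k <- ks) cabs (inner (r%:C%C *: e r) k) =
      `|r| * \sum_(k <- ks) cabs (inner (e r) k).
    by rewrite mulr_sumr; apply: eq_bigr => k _; rewrite innerZl cabsM cabsR.
  have s0 : 0 <= \sum_(k <- ks) cabs (inner (e r) k).
    by rewrite sumr_ge0 // => k _; exact: cabs_ge0.
  have : \sum_(k <- ks) cabs (inner (e r) k) <=
      d * (size ks)%:R + \sum_(k <- ks) cabs (inner (e r) k) ^+ 2 / d.
    rewrite -[(size ks)%:R](_ : \sum_(k <- ks) 1 = _); last first.
      by rewrite big_const_seq count_predT iter_addr addr0.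
    rewrite mulr_sumr -big_split /=; apply: ler_sum => k _; rewrite mulr1.
    move: (cabs_ge0 (inner (e r) k)); move: (cabs _) => a a0.
    rewrite -(ler_pM2r d0) mulrDl divfK ?lt0r_neq0 //.
    have := sqr_ge0 (a - d); have := sqr_ge0 d; have := sqr_ge0 a; nra.
  rewrite -mulr_suml; move: (\sum_(k <- ks) cabs _ ^+ 2) => s2.
  have dE : 4 * c * (d * (size ks)%:R) <= 1.
    have : d * (4 * c * ((size ks)%:R + 1)) = 1.
      by rewrite mulVf // lt0r_neq0 // !mulr_gt0 // ltr_wpDl.
    by have := mulr_gt0 c0 d0; nra.
  have rs : `|r| * \sum_(k <- ks) cabs (inner (e r) k) <=
      c * \sum_(k <- ks) cabs (inner (e r) k) by rewrite ler_wpM2r.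
  have h2 : 1 / (2 * c) * `|r| <= 1 / 2.
    rewrite mulrC mulrA mulr1 ler_pdivrMr ?mulr_gt0 //.
    by move: rc; move: `|r| => t; lra.
  rewrite (_ : 4 * c / d * s2 = 4 * c * (s2 / d)); last by rewrite mulrA mulrAC.
  move: (s2 / d) rs s0 h2 dE => s3; move: (\sum_(k <- ks) _) (`|r| * _) => s1 s4.
  by move=> h3 h4 h5 h6 h7 h8; have := ler_wpM2l (ltW c0) h7; nra.
have : ((Num.trunc K).+1)%:R <= K.
  apply: (@le_trans _ _ (size A)%:R); first by rewrite ler_nat.
  rewrite -[(size A)%:R](_ : \sum_(r <- A) 1 = _); last first.
    by rewrite big_const_seq count_predT iter_addr addr0.
  apply: (@le_trans _ _ (\sum_(r <- A) 4 * c / d * \sum_(k <- ks) cabs (inner (e r) k) ^+ 2)).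
    by rewrite big_seq [leRHS]big_seq; apply: ler_sum => r; exact: lower.
  rewrite -mulr_sumr /K ler_wpM2l //.
    by rewrite ltW // divr_gt0 // mulr_gt0.
  rewrite exchange_big /=; apply: ler_sum => k _.
  apply: bessel_inequality => //.
  by move=> r /AP/eP[].
by apply/negP; rewrite -ltNge; exact: truncnS_gt.
Qed.

End discrete_spectrum.

Theorem sharp_spectral_theory (R : realType) (H : innerProductType R[i])
    (C : set (H * H)) : @hcomplete R H -> C (0, 0) ->
  (forall a p q, C p -> C q -> C (a *: p.1 + q.1, a *: p.2 + q.2)) ->
  (forall p q, C p -> C q -> inner p.2 q.1 = inner p.1 q.2) ->
  op_ran C `<=` op_dom C ->
  (forall e : R, 0 < e -> exists ks : seq H, forall p q, C p -> C q ->
    hnm p.2 <= 1 -> hnm q.2 <= 1 ->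
    cabs (inner p.1 q.2) <= e + \sum_(k <- ks) cabs (inner p.2 k)) ->
  [/\ compact_domain_embedding (reduced (sharp C)),
      selfadjoint (sharp C),
      spectrum (sharp C) `<=` range (real_complex R)
    & limit_point [set r : R | spectrum (sharp C) (r%:C)%C] = set0].
Proof.
move=> cH C0 CP Csym Cran Cest.
have Sadj := sharp_adjoint cH C0 CP Csym Cest.
have S0 : sharp C (0, 0).
  split; first by move=> p _ /=; rewrite !inner0r.
  by apply: subset_closure; exists (0, 0).
have SP := sharp_subspace C0 CP.
(* If [r] is not an eigenvalue, [sharp_bounded_below] puts it in the resolvent set. An eigenvector
   for [r != 0] equals [r^-1 (r x)], hence lies in the closure of the range and belongs to the
   inverse graph. *)
have eig (r : R) : spectrum (sharp C) (r%:C)%C -> r != 0 ->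
    exists2 x, x != 0 & inv_graph C (x, r%:C%C *: x).
  move=> Sr r0; apply: contrapT => nx; apply: Sr.
  have rc0 : r%:C%C != 0 :> R[i].
    by rewrite -(rmorph0 (real_complex R)) (inj_eq (@complexI R)).
  have noeig x : sharp C (x, r%:C%C *: x) -> x = 0.
    move=> Sx; apply: contrapT => /eqP x0; apply: nx; exists x => //.
    have [Ax Mx] := Sx; split=> //; split => //=.
    have := subspaceZ (r%:C%C)^-1 (closure_subspace (op_ran_subspace C0 CP)) Mx.
    by rewrite /= scalerA mulVf // scale1r.
  have [c c0 cP] := sharp_bounded_below cH C0 CP Csym Cest rc0 noeig.
  apply: (selfadjoint_resolvent cH S0 SP Sadj c0 cP) => x.
  rewrite (_ : (r%:C%C)^* = r%:C%C :> R[i]); first exact: noeig.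
  by rewrite conj_Creal // complex_real.
split.
- exact: sharp_compact.
- by split; [exact: sharp_dense|].
- exact: selfadjoint_spectrum_real.
apply/seteqP; split => // r0 /limit_point_infinite_setP lim.
(* A limit point would put infinitely many spectral values within distance 1 of [r0]; apart from 0
   they are eigenvalues of modulus at most [|r0| + 1]. *)
apply: (lim (ball r0 1)); first exact: nbhsx_ballx.
set E := [set r : R | `|r| <= `|r0| + 1 /\
  exists2 x, x != 0 & inv_graph C (x, r%:C%C *: x) /\ r != 0].
apply: (@sub_finite_set _ _ (E `|` [set 0])).
  move=> r []; rewrite -ball_normE /= => br Sr.
  have [->|rn0] := eqVneq r 0; [by right|left; split].
    rewrite -lerBlDl; apply: le_trans (ltW br).
    by rewrite distrC; apply: le_trans (ler_dist_dist _ _); rewrite ler_norm.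
  by have [x x0 Bx] := eig r Sr rn0; exists x.
rewrite finite_setU; split; last exact: finite_set1.
apply: finite_eigenvalues.
- move=> a p [Ap [M1 M2]].
  have sM := closure_subspace (op_ran_subspace C0 CP).
  split; last by split; exact: (subspaceZ a sM).
  by move=> q Cq /=; rewrite !innerZr Ap.
- exact: inv_graph_sym.
- exact: inv_graph_ehrling.
Qed.

(** * Completeness of L_2 *)

Section Riesz_Fischer.
Context d (T : measurableType d) (R : realType).
Variable mu : {measure set T -> \bar R}.

Lemma Lfun2P (f : T -> R) : f \in Lfun mu 2%:E <->
  measurable_fun setT f /\ mu.-integrable setT (EFin \o (fun x => f x ^+ 2)).
Proof.
split=> [fL|[mf /integrableP[_ fi]]].
  split; last exact: Lfun2_integrable_sqr.
  by move: fL; rewrite inE => /andP[+ _]; rewrite inE.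
rewrite inE; apply/andP; split; rewrite inE //= /finite_norm unlock.
apply: poweR_lty; apply: le_lt_trans fi; rewrite le_eqVlt; apply/orP; left.
apply/eqP; apply: eq_integral => x _ /=.
by rewrite normrX powR_mulrn.
Qed.

Lemma Lfun2B (u v : T -> R) : u \in Lfun mu 2%:E -> v \in Lfun mu 2%:E ->
  (fun x => u x - v x) \in Lfun mu 2%:E.
Proof.
have le12 : (1 <= 2%:E :> \bar R)%E by rewrite lee_fin ler1n.
have [_ LP] := Lfun_submod_closed mu le12 => uL vL.
rewrite (_ : (fun x => _) = -1 *: v + u); first exact: LP.
by apply/funext => x; rewrite -[RHS]/(-1 * v x + u x) mulN1r addrC.
Qed.

(** The squared increments weighted by [2 ^+ k] still have a sum [h] with integral at most [2 c]. As
    [(a + b)^2 <= 2 a^2 + 2 b^2], chaining the increments gives [(f m - f k)^2 <= 2 * 2^-1 ^+ k * h]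
    pointwise, which yields both the almost everywhere limit and the rate. *)
Lemma Lfun2_fast_cvg (f : nat -> T -> R) (c : R) : 0 <= c ->
  (forall k, f k \in Lfun mu 2%:E) ->
  (forall k, \int[mu]_x ((f k.+1 x - f k x) ^+ 2) <= c * 4^-1 ^+ k) ->
  exists2 g, g \in Lfun mu 2%:E &
    forall k, \int[mu]_x ((f k x - g x) ^+ 2) <= 4 * c * 2^-1 ^+ k.
Proof.
move=> c0 fL fc.
have LB := Lfun2B.
have mf k : measurable_fun setT (f k) by case/Lfun2P: (fL k).
pose D k x := (f k.+1 x - f k x) ^+ 2.
have mD k : measurable_fun setT (D k).
  by apply: measurable_funX; exact: measurable_funB.
have iD k : mu.-integrable setT (EFin \o D k).
  by have /Lfun2P[] := LB _ _ (fL k.+1) (fL k).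
pose t k x := (2 ^+ k * D k x)%:E.
have t0 k x : (0 <= t k x)%E.
  by rewrite lee_fin; apply: mulr_ge0; [exact: exprn_ge0|exact: sqr_ge0].
have mt k : measurable_fun setT (t k).
  by apply/measurable_EFinP; apply: measurable_funM.
pose h x := (\sum_(k <oo) t k x)%E.
have mh : measurable_fun setT h by exact: ge0_emeasurable_sum.
have h0 x : (0 <= h x)%E by exact: nneseries_ge0.
have It k : (\int[mu]_x t k x <= (c * 2^-1 ^+ k)%:E)%E.
  rewrite (_ : integral _ _ _ = (\int[mu]_x (2 ^+ k * D k x))%:E); last first.
    rewrite /Rintegral fineK // integrable_fin_num //.
    exact: (integrableZl measurableT (2 ^+ k) (iD k)).
  rewrite lee_fin RintegralZl //.
  apply: le_trans (ler_wpM2l _ (fc k)) _; first exact: exprn_ge0.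
  rewrite mulrCA -exprMn (_ : 2 * 4^-1 = 2^-1 :> R) //.
  by rewrite (_ : 4 = 2 * 2 :> R) ?invfM ?mulrA ?mulfV ?mul1r //; ring.
have Ih : (\int[mu]_x h x <= (2 * c)%:E)%E.
  rewrite integral_nneseries //.
  apply: lime_le; first by apply: is_cvg_nneseries => k _ _; exact: integral_ge0.
  apply: nearW => m.
  apply: (@le_trans _ _ (\sum_(0 <= k < m) (c * 2^-1 ^+ k)%:E)%E).
    by apply: lee_sum => k _.
  rewrite sumEFin lee_fin.
  suff -> : \sum_(0 <= k < m) c * 2^-1 ^+ k = 2 * c - 2 * c * 2^-1 ^+ m.
    by rewrite gerBl mulr_ge0 ?exprn_ge0 ?mulr_ge0.
  elim: m => [|m IHm]; first by rewrite big_geq // mulr1 subrr.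
  rewrite big_nat_recr //= IHm exprS.
  have z2 : 2 * 2^-1 = 1 :> R by rewrite mulfV.
  move: (2^-1) z2 => z z2; move: (z ^+ m) => w.
  have -> : 2 * c * (z * w) = c * w * (2 * z) by ring.
  by rewrite z2; ring.
have ih : mu.-integrable setT h.
  apply/integrableP; split => //.
  under eq_integral do rewrite gee0_abs //.
  exact: le_lt_trans Ih (ltry _).
pose A := [set x | h x \is a fin_num].
have mA : measurable A.
  rewrite (_ : A = h @^-1` [set~ +oo%E]).
    by rewrite -[_ @^-1` _]setTI; apply: mh => //; apply: measurableC; exact: emeasurable_set1.
  apply/seteqP; split=> x; rewrite /A /=.
    by move=> hx hoo; move: hx; rewrite hoo.
  by move=> hx; rewrite ge0_fin_numE // lt_neqAle leey andbT; apply/eqP.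
have part x k m : (k <= m)%N -> A x ->
    (f m x - f k x) ^+ 2 <= 2 * 2^-1 ^+ k * fine (h x).
  move=> km Ax.
  have part1 : (f m x - f k x) ^+ 2 <=
      2 * 2^-1 ^+ k * \sum_(k <= j < m) 2 ^+ j * D j x.
    (* Induction on [m - k] with [m] fixed: each step doubles the error, and the factor [2^-1 ^+ k]
       absorbs the doubling. *)
    elim: {km}(m - k)%N {-2}k (subnKC km) => [|i IHi] {}k E.
      by rewrite -E addn0 subrr expr0n big_geq // mulr0.
    have km : (k < m)%N by rewrite -E -addSnnS leq_addr.
    have {}E : (k.+1 + i = m)%N by rewrite addSnnS.
    have h1 := IHi _ E; rewrite [2^-1 ^+ _]exprS mulrA mulfV // mul1r in h1.
    rewrite (big_ltn km) mulrDr.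
    have -> : 2 * 2^-1 ^+ k * (2 ^+ k * D k x) = 2 * D k x.
      by rewrite mulrA -[2 * _ * _]mulrA -exprMn mulVf // expr1n mulr1.
    move: h1; move: (\sum_(_ <= j < _) _) => s; rewrite /D => h1.
    have -> : 2 * 2^-1 ^+ k * s = 2 * (2^-1 ^+ k * s) by rewrite mulrA.
    have := sqr_ge0 (f m x - f k.+1 x - (f k.+1 x - f k x)).
    by move: h1; move: (2^-1 ^+ k * s) => w; nra.
  apply: le_trans part1 _; rewrite ler_wpM2l // ?mulr_ge0 ?exprn_ge0 ?invr_ge0 //.
  rewrite -lee_fin fineK // -sumEFin.
  apply: (@le_trans _ _ (\sum_(0 <= j < m) t j x)%E); last exact: nneseries_lim_ge.
  by rewrite [leRHS](big_cat_nat (n := k)) //= leeDr // sume_ge0.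
(* Off [A], up to a null set the whole space, the sequence is replaced by 0; it then converges
   everywhere and its limit is measurable. *)
pose f' k x := f k x * \1_A x.
have mf' k : measurable_fun setT (f' k) by apply: measurable_funM.
have f'A k x : A x -> f' k x = f k x by move=> Ax; rewrite /f' indicE mem_set // mulr1.
have f'N k x : ~ A x -> f' k x = 0 by move=> Ax; rewrite /f' indicE memNset // mulr0.
have cf' x : cvg (f' ^~ x @ \oo).
  have [Ax|nAx] := pselect (A x); last first.
    rewrite (_ : f' ^~ x = cst 0); first exact: is_cvg_cst.
    by apply/funext => k; rewrite f'N.
  apply/cauchy_cvgP/cauchy_exP => e e0.
  have : 2 * fine (h x) * 2^-1 ^+ k @[k --> \oo] --> (0 : R).
    rewrite -(mulr0 (2 * fine (h x))); apply: cvgM; first exact: cvg_cst.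
    by apply: cvg_expr; rewrite ger0_norm ?invr_ge0 // invf_lt1 // ltr1n.
  move=> /cvgrPdist_lt/(_ _ (exprn_gt0 2 e0))[k _ kP].
  exists (f' k x); exists k => // m /= km.
  rewrite -ball_normE /= !f'A // distrC -(ltr_pXn2r (n := 2)) ?nnegrE ?(ltW e0) //.
  rewrite real_normK ?num_real //; apply: le_lt_trans (part _ _ _ km Ax) _.
  have := kP k (leqnn k); rewrite /= sub0r normrN mulrAC.
  by apply: le_lt_trans; rewrite ler_norm.
pose g x := lim (f' ^~ x @ \oo).
have mg : measurable_fun setT g.
  by apply: (measurable_fun_cvg mf') => x _; exact: cf'.
have fg x k : A x -> (f k x - g x) ^+ 2 <= 2 * 2^-1 ^+ k * fine (h x).
  move=> Ax.
  have cu : (f k x - f' m x) ^+ 2 @[m --> \oo] --> (f k x - g x) ^+ 2.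
    by apply: (cvgM (cvgB (cvg_cst _) (cf' x)) (cvgB (cvg_cst _) (cf' x))).
  rewrite -(cvg_lim _ cu) //; apply: limr_le; first by apply/cvg_ex; exists ((f k x - g x) ^+ 2).
  exists k => // m /= km; rewrite f'A // -sqrrN opprB.
  exact: part.
have Ak : {ae mu, forall x, A x}.
  by have := integrable_ae measurableT ih; apply: filterS => x /(_ I).
have mfg k : measurable_fun setT (fun x => (f k x - g x) ^+ 2).
  by apply: measurable_funX; exact: measurable_funB.
have Ifg k : (\int[mu]_x ((f k x - g x) ^+ 2)%:E <= (4 * c * 2^-1 ^+ k)%:E)%E.
  have k0 : 0 <= 2 * 2^-1 ^+ k :> R by rewrite mulr_ge0 ?exprn_ge0.
  apply: (@le_trans _ _ (\int[mu]_x ((2 * 2^-1 ^+ k)%:E * h x))%E).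
    apply: ae_ge0_le_integral => //.
    - by move=> x _; rewrite lee_fin sqr_ge0.
    - exact/measurable_EFinP.
    - by move=> x _; rewrite mule_ge0.
    - exact: measurable_funeM.
    - apply: filterS Ak => x Ax _.
      by rewrite -[h x]fineK // -EFinM lee_fin; exact: fg.
  rewrite ge0_integralZl_EFin //.
  apply: le_trans (lee_wpmul2l _ Ih) _ => //.
  by rewrite -EFinM lee_fin; lra.
have fgL k : (fun x => f k x - g x) \in Lfun mu 2%:E.
  apply/Lfun2P; split; first exact: measurable_funB.
  apply/integrableP; split; first exact/measurable_EFinP.
  under eq_integral do rewrite /= ger0_norm ?sqr_ge0 //.
  exact: le_lt_trans (Ifg k) (ltry _).
exists g.
  rewrite (_ : g = fun x => f 0 x - (f 0 x - g x)); first exact: LB.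
  by apply/funext => x; rewrite subKr.
move=> k; rewrite -lee_fin /Rintegral fineK //.
by apply: integrable_fin_num => //; case/Lfun2P: (fgL k).
Qed.

End Riesz_Fischer.

Section L2_completeness.
Context d (T : measurableType d) (R : realType).
Variable mu : {measure set T -> \bar R}.
Variable n : nat.

Local Open Scope quotient_scope.

Lemma Re_Lfun2 (f : L2fun mu n) j : (fun x => Re (f x 0 j)) \in Lfun mu 2%:E.
Proof. by have /asboolP/(_ j)[] := L2fun_prop f. Qed.

Lemma Im_Lfun2 (f : L2fun mu n) j : (fun x => Im (f x 0 j)) \in Lfun mu 2%:E.
Proof. by have /asboolP/(_ j)[] := L2fun_prop f. Qed.

Lemma Rintegral_sum (I : Type) (s : seq I) (F : I -> T -> R) :
  (forall i, mu.-integrable setT (EFin \o F i)) ->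
  \int[mu]_x (\sum_(i <- s) F i x) = \sum_(i <- s) \int[mu]_x F i x.
Proof.
move=> iF.
have iS (r : seq I) : mu.-integrable setT (EFin \o (fun x => \sum_(i <- r) F i x)).
  elim: r => [|i r IHr].
    rewrite (_ : _ \o _ = cst 0%E); first exact: integrable0.
    by apply/funext => x /=; rewrite big_nil.
  rewrite (_ : _ \o _ = ((EFin \o F i) \+ (EFin \o (fun x => (\sum_(i <- r) F i x)%R)))%E).
    exact: integrableD.
  by apply/funext => x /=; rewrite big_cons.
elim: s => [|i s IHs].
  rewrite big_nil; under eq_Rintegral do rewrite big_nil.
  by rewrite Rintegral_cst // mul0r.
rewrite big_cons -IHs -RintegralD //.
by apply: eq_Rintegral => x _; rewrite big_cons.
Qed.

Lemma hnm_L2E (f : L2fun mu n) : hnm (\pi_(L2 mu n) f : L2 mu n) ^+ 2 =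
  \sum_j (\int[mu]_x (Re (f x 0 j) ^+ 2) + \int[mu]_x (Im (f x 0 j) ^+ 2)).
Proof.
have := inner_diag (\pi_(L2 mu n) f : L2 mu n).
have -> : inner (\pi_(L2 mu n) f : L2 mu n) (\pi_(L2 mu n) f) = dotf mu f f by exact: L2dotE.
move/(congr1 Re) => /= <-.
have i1 j := Lfun2_integrable_sqr (Re_Lfun2 f j).
have i2 j := Lfun2_integrable_sqr (Im_Lfun2 f j).
transitivity (\int[mu]_x \sum_j (Re (f x 0 j) ^+ 2 + Im (f x 0 j) ^+ 2)).
  apply: eq_Rintegral => x _; rewrite /hdot raddf_sum /=; apply: eq_bigr => j _.
  by case: (f x 0 j) => a b /=; rewrite mulrN opprK !expr2.
rewrite Rintegral_sum => [|j]; last exact: (integrableD measurableT (i1 j) (i2 j)).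
by apply: eq_bigr => j _; rewrite RintegralD.
Qed.

Lemma Re_sqr_le_hnm (f : L2fun mu n) j :
  \int[mu]_x (Re (f x 0 j) ^+ 2) <= hnm (\pi_(L2 mu n) f : L2 mu n) ^+ 2.
Proof.
rewrite hnm_L2E (bigD1 j) //= -addrA lerDl addr_ge0 ?sumr_ge0 // => [|i _];
  by rewrite ?addr_ge0 // Rintegral_ge0 // => x _; exact: sqr_ge0.
Qed.

Lemma Im_sqr_le_hnm (f : L2fun mu n) j :
  \int[mu]_x (Im (f x 0 j) ^+ 2) <= hnm (\pi_(L2 mu n) f : L2 mu n) ^+ 2.
Proof.
rewrite hnm_L2E (bigD1 j) //= addrAC lerDr addr_ge0 ?sumr_ge0 // => [|i _];
  by rewrite ?addr_ge0 // Rintegral_ge0 // => x _; exact: sqr_ge0.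
Qed.

Lemma pi_L2B (f g : L2fun mu n) :
  \pi_(L2 mu n) (f - g) = \pi_(L2 mu n) f - \pi_(L2 mu n) g.
Proof. by rewrite raddfB. Qed.

Lemma pi_reprB (u v : L2 mu n) : u - v = \pi_(L2 mu n) (repr u - repr v).
Proof. by rewrite pi_L2B !reprK. Qed.

(** A subsequence with increments below [2^-1 ^+ k] converges in the real and imaginary part of each
    component, and a Cauchy sequence follows its subsequence. *)
Lemma L2_complete : hcomplete (L2 mu n).
Proof.
move=> u cu.
have /choice[N NP] : forall k : nat, exists N, forall i j : nat, (N <= i)%N -> (N <= j)%N ->
    hnm (u i - u j) < 2^-1 ^+ k.
  by move=> k; apply: cu; rewrite exprn_gt0 // invr_gt0.
(* The maximum over all earlier thresholds makes [phi m] exceed [N k] for every [k <= m]. *)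
pose phi k := (\max_(i < k.+1) N i)%N.
have Nphi k m : (k <= m)%N -> (N k <= phi m)%N.
  by move=> km; apply: (@leq_bigmax_cond _ predT (fun i : 'I_m.+1 => N i) (Ordinal (km : (k < m.+1)%N))).
pose v k : L2fun mu n := repr (u (phi k)).
have vE k m : \pi_(L2 mu n) (v k - v m) = u (phi k) - u (phi m) by rewrite -pi_reprB.
have step k : hnm (u (phi k.+1) - u (phi k)) ^+ 2 <= 1 * 4^-1 ^+ k.
  rewrite mul1r (_ : 4^-1 = 2^-1 ^+ 2); last by rewrite expr2 -invfM -natrM.
  rewrite -exprM mulnC exprM ler_pXn2r ?nnegrE ?hnm_ge0 ?exprn_ge0 ?invr_ge0 //.
  by apply: ltW; apply: NP; apply: Nphi.
have /choice[gr grP] : forall j, exists g, g \in Lfun mu 2%:E /\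
    forall k, \int[mu]_x ((Re (v k x 0 j) - g x) ^+ 2) <= 4 * 1 * 2^-1 ^+ k.
  move=> j; have [||k|g gL gP] := @Lfun2_fast_cvg _ T R mu (fun k x => Re (v k x 0 j)) 1.
  - exact: ler01.
  - by move=> k; exact: Re_Lfun2.
  - apply: le_trans (step k); rewrite -vE; apply: le_trans (Re_sqr_le_hnm _ j).
    rewrite le_eqVlt; apply/orP; left; apply/eqP; apply: eq_Rintegral => x _.
    by rewrite L2funBE !mxE raddfB.
  - by exists g.
have /choice[gi giP] : forall j, exists g, g \in Lfun mu 2%:E /\
    forall k, \int[mu]_x ((Im (v k x 0 j) - g x) ^+ 2) <= 4 * 1 * 2^-1 ^+ k.
  move=> j; have [||k|g gL gP] := @Lfun2_fast_cvg _ T R mu (fun k x => Im (v k x 0 j)) 1.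
  - exact: ler01.
  - by move=> k; exact: Im_Lfun2.
  - apply: le_trans (step k); rewrite -vE; apply: le_trans (Im_sqr_le_hnm _ j).
    rewrite le_eqVlt; apply/orP; left; apply/eqP; apply: eq_Rintegral => x _.
    by rewrite L2funBE !mxE raddfB.
  - by exists g.
pose G x : 'rV[R[i]]_n := \row_j Complex (gr j x) (gi j x).
have GL : G \in @square_integrable _ T R mu n.
  apply/asboolP => j; split.
    by rewrite (_ : (fun x => _) = gr j) ?(grP j).1 //; apply/funext => x; rewrite mxE.
  by rewrite (_ : (fun x => _) = gi j) ?(giP j).1 //; apply/funext => x; rewrite mxE.
pose g := L2Fun GL.
(* There are [n] components with two real parts each, every one contributing at most
   [4 * 2^-1 ^+ k]. *)
have lim k : hnm (u (phi k) - \pi_(L2 mu n) g) ^+ 2 <= n%:R * 8 * 2^-1 ^+ k.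
  rewrite (_ : u (phi k) - _ = \pi_(L2 mu n) (v k - g)); last by rewrite pi_L2B reprK.
  rewrite hnm_L2E -mulrA -[n%:R](_ : \sum_(j < n) 1 = _); last first.
    by rewrite sumr_const card_ord.
  rewrite mulr_suml; apply: ler_sum => j _.
  have := (grP j).2 k; have := (giP j).2 k.
  have -> : \int[mu]_x (Re (v k x 0 j) - gr j x) ^+ 2 = \int[mu]_x (Re ((v k - g) x 0 j) ^+ 2).
    by apply: eq_Rintegral => x _; rewrite L2funBE !mxE raddfB.
  have -> : \int[mu]_x (Im (v k x 0 j) - gi j x) ^+ 2 = \int[mu]_x (Im ((v k - g) x 0 j) ^+ 2).
    by apply: eq_Rintegral => x _; rewrite L2funBE !mxE raddfB.
  by lra.
exists (\pi_(L2 mu n) g) => e e0.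
have e20 : 0 < e / 2 by rewrite divr_gt0.
have small (c a : R) : 0 < a -> exists K : nat, forall k : nat, (K <= k)%N -> c * 2^-1 ^+ k < a.
  move=> a0; have : c * 2^-1 ^+ k @[k --> \oo] --> (0 : R).
    rewrite -(mulr0 c); apply: cvgM; first exact: cvg_cst.
    by apply: cvg_expr; rewrite ger0_norm ?invr_ge0 // invf_lt1 // ltr1n.
  move=> /cvgrPdist_lt/(_ _ a0)[k _ kP]; exists k => m km.
  by have := kP m km; rewrite /= sub0r normrN; apply: le_lt_trans; rewrite ler_norm.
have [K1 K1P] := small (n%:R * 8) _ (exprn_gt0 2 e20).
have [K2 K2P] := small 1 _ e20.
pose k := maxn K1 K2.
exists (N k) => m Nm; apply: le_lt_trans (hnm_sub _ (u (phi k)) _) _.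
rewrite [e]splitr ltrD //.
  apply: lt_trans (K2P k (leq_maxr _ _)); rewrite mul1r.
  by apply: NP => //; exact: Nphi.
rewrite -(ltr_pXn2r (n := 2)) ?nnegrE ?hnm_ge0 ?(ltW e20) //.
by apply: le_lt_trans (lim k) _; apply: K1P; rewrite leq_maxl.
Qed.

End L2_completeness.

(** * Test functions on the space and the curl estimate *)

Section integration_space3.
Variable R : realType.
Local Notation mR := (measurableTypeR R).
Local Notation E := (R * R * R)%type.
Implicit Types (f g : E -> R) (v x : E) (r : R).

Definition intg f : R := \int[@lebesgue3 R]_x f x.

(** The norm of [R * R * R] is the maximum norm, so the support lies in a box, a product of three
    intervals. *)
Definition ccont r f := continuous f /\ forall x, r < `|x| -> f x = 0.

Lemma norm3_le x r : (`|x| <= r) = [&& `|x.1.1| <= r, `|x.1.2| <= r & `|x.2| <= r].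
Proof. by case: x => [[a b] c]; rewrite !prod_normE /= !ge_max andbA. Qed.

Let K r : set E := `[- r, r] `*` `[- r, r] `*` `[- r, r].

Let KE r : K r = [set x | `|x| <= r].
Proof.
by apply/seteqP; split=> x; rewrite /K /= norm3_le !in_itv /= -!ler_norml;
  [move=> [[-> ->] ->]|move=> /and3P[-> -> ->]].
Qed.

Let measurableK r : measurable (K r : set (mR * mR * mR)).
Proof. by apply: measurableX => //; exact: measurableX. Qed.

Let finiteK r : (lebesgue3 (K r) < +oo)%E.
Proof.
set I : set mR := `[- r, r]%classic.
have -> : lebesgue3 (K r) =
    (lebesgue_measure I * lebesgue_measure I * lebesgue_measure I)%E.
  rewrite [LHS]product_measure1E //; last exact: measurableX.
  by congr (_ * _)%E; exact: product_measure1E.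
have fin : lebesgue_measure I \is a fin_num.
  by rewrite /I lebesgue_measure_itv /=; case: ifP.
by rewrite -ge0_fin_numE ?mule_ge0 // !fin_numM.
Qed.

Lemma lebesgue3_box r : 0 <= r -> lebesgue3 [set x : E | `|x| <= r] = ((2 * r) ^+ 3)%:E.
Proof.
move=> r0; rewrite -KE; set I : set mR := `[- r, r]%classic.
have -> : lebesgue3 (K r) =
    (lebesgue_measure I * lebesgue_measure I * lebesgue_measure I)%E.
  rewrite [LHS]product_measure1E //; last exact: measurableX.
  by congr (_ * _)%E; exact: product_measure1E.
have -> : lebesgue_measure I = (2 * r)%:E.
  rewrite /I lebesgue_measure_itv /= lte_fin; case: ltP => [_|rr].
    by rewrite -EFinB; congr EFin; ring.
  by rewrite (_ : r = 0) ?mulr0 //; apply/eqP; rewrite eq_le r0 andbT; lra.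
by rewrite -!EFinM; congr EFin; ring.
Qed.

Lemma measurable_box r : measurable ([set x : E | `|x| <= r] : set (mR * mR * mR)).
Proof. by rewrite -KE. Qed.

Lemma lebesgue3_sigma_finite : sigma_finite setT (@lebesgue3 R).
Proof.
exists (fun n => K n%:R) => [|n]; last by split; [exact: measurableK|exact: finiteK].
apply/seteqP; split => // x _; exists (Num.trunc `|x|).+1 => //.
by rewrite KE /= ltW // truncnS_gt.
Qed.

HB.instance Definition _ := @Measure_isSigmaFinite.Build _ _ _ (@lebesgue3 R)
  lebesgue3_sigma_finite.

Lemma continuous_measurable3 f :
  continuous f -> measurable_fun setT (f : mR * mR * mR -> mR).
Proof.
move=> cf; apply: (measurability _ (RGenOpens.measurableE R)).
move=> _ [_ [a [b ->] <-]]; rewrite setTI; apply: open_measurable3.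
by apply: open_comp => [x _|]; [exact: cf|exact: interval_open].
Qed.

Lemma ccont_bounded r f : ccont r f -> exists2 M, 0 < M & forall x, `|f x| <= M.
Proof.
move=> [cf f0].
have : compact (f @` K r).
  apply: (@continuous_compact _ _ f (K r)); first exact: continuous_subspaceT.
  by apply: compact_setX; [apply: compact_setX|]; exact: segment_compact.
move=> /(@compact_bounded _ R^o)[M [_ MP]].
exists (`|M| + 1); first by rewrite ltr_wpDl.
move=> x; have [xr|xr] := leP `|x| r.
  apply: (MP (`|M| + 1)); first by rewrite ltr_pwDr // ler_norm.
  by exists x => //; rewrite KE.
by rewrite f0 // normr0 addr_ge0.
Qed.

Lemma ccont_integrable r f : ccont r f -> (@lebesgue3 R).-integrable setT (EFin \o f).
Proof.
move=> cf; have [M M0 MP] := ccont_bounded cf; case: cf => cf f0.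
rewrite (_ : EFin \o f = (EFin \o f) \_ (K r)).
  rewrite -integrable_mkcond //.
  apply: measurable_bounded_integrable => //.
  - exact: finiteK.
  - by apply: measurable_funTS; exact: continuous_measurable3.
  - by exists M; split; rewrite ?num_real // => N MN x _ /=; exact: le_trans (MP x) (ltW MN).
apply/funext => x; rewrite patchE; case: ifPn => // xK.
rewrite /= f0 // ltNge; apply: contra xK => xr.
by rewrite inE KE.
Qed.

Definition translate3 v : mR * mR * mR -> mR * mR * mR := fun x => (x : E) + v.

Lemma measurable_translate3 v : measurable_fun setT (translate3 v).
Proof.
apply: measurable_fun_pair.
  apply: measurable_fun_pair.
    by apply: measurable_funD => //; apply: measurableT_comp => //.
  by apply: measurable_funD => //; apply: measurableT_comp => //.
by apply: measurable_funD => //.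
Qed.

HB.instance Definition _ v := isMeasurableFun.Build _ _ _ _ (translate3 v) (measurable_translate3 v).

Lemma lebesgue_measureD (a : R) (A : set mR) : measurable A ->
  lebesgue_measure ((fun z : mR => (z : R) + a : mR) @^-1` A) = lebesgue_measure A.
Proof.
have ma : measurable_fun setT ((fun z : mR => (z : R) + a : mR)).
  by apply: measurable_funD.
pose f_mixin := isMeasurableFun.Build _ _ _ _ _ ma.
pose f_pack : {mfun mR >-> mR} := HB.pack (fun z : mR => (z : R) + a : mR) f_mixin.
move=> mA; apply/esym.
apply: (@lebesgue_measure_unique R (pushforward (@lebesgue_measure R) f_pack)) => //.
move=> _ [[x y] _ <-].
rewrite [RHS]/(lebesgue_measure ((fun z : R => z + a) @^-1` `]x, y]%classic)).
have -> : (fun z : R => z + a) @^-1` `]x, y]%classic = `]x - a, y - a]%classic.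
  by apply/seteqP; split=> z; rewrite /= !in_itv /= ltrBlDr lerBrDr.
rewrite -[RHS]/(lebesgue_measure `]x - a, y - a]%classic).
by rewrite !lebesgue_measure_itv /= !lte_fin ltrD2r -!EFinB opprB addrA subrK.
Qed.

(** Rectangles determine the product measure, and the preimage of a rectangle is a rectangle. *)
Lemma product_measure_preimage d1 d2 (T1 : measurableType d1) (T2 : measurableType d2)
    (m1 : {sigma_finite_measure set T1 -> \bar R})
    (m2 : {sigma_finite_measure set T2 -> \bar R}) (f1 : T1 -> T1) (f2 : T2 -> T2) :
  measurable_fun setT f1 -> measurable_fun setT f2 ->
  (forall A, measurable A -> m1 (f1 @^-1` A) = m1 A) ->
  (forall A, measurable A -> m2 (f2 @^-1` A) = m2 A) ->
  forall A, measurable A ->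
    (m1 \x m2)%E ((fun p => (f1 p.1, f2 p.2)) @^-1` A) = (m1 \x m2)%E A.
Proof.
move=> mf1 mf2 inv1 inv2 A mA.
have mf : measurable_fun setT (fun p : T1 * T2 => (f1 p.1, f2 p.2)).
  by apply: measurable_fun_pair; exact: measurableT_comp.
pose f_mixin := isMeasurableFun.Build _ _ _ _ _ mf.
pose f_pack : {mfun (T1 * T2)%type >-> (T1 * T2)%type} :=
  HB.pack (fun p : T1 * T2 => (f1 p.1, f2 p.2)) f_mixin.
apply/esym; apply: (product_measure_unique (m' := pushforward (m1 \x m2)%E f_pack)) => //.
move=> B C mB mC.
change ((m1 \x m2)%E ((f1 @^-1` B) `*` (f2 @^-1` C)) = (m1 B * m2 C)%E).
have mB' : measurable (f1 @^-1` B) by rewrite -[_ @^-1` _]setTI; exact: mf1.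
have mC' : measurable (f2 @^-1` C) by rewrite -[_ @^-1` _]setTI; exact: mf2.
rewrite (product_measure1E m1 m2 mB' mC').
by congr (_ * _)%E; [exact: inv1|exact: inv2].
Qed.

Let lebesgue2 : set (mR * mR) -> \bar R :=
  (@lebesgue_measure R \x @lebesgue_measure R)%E.

HB.instance Definition _ := Measure.on lebesgue2.

Let lebesgue2_sigma_finite : sigma_finite setT lebesgue2.
Proof.
exists (fun n => (`[- n%:R, n%:R]%classic : set mR) `*` (`[- n%:R, n%:R]%classic : set mR)).
  apply/seteqP; split => // -[x y] _.
  exists (Num.trunc (Num.max `|x| `|y|)).+1 => //.
  have := truncnS_gt (Num.max `|x| `|y|); rewrite gt_max => /andP[/ltW xn /ltW yn].
  by split; rewrite /= in_itv /= -ler_norml.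
move=> n; set I : set mR := `[- n%:R, n%:R]%classic.
have mI : measurable I by rewrite /I.
split; first exact: measurableX.
have -> : lebesgue2 (I `*` I) = (lebesgue_measure I * lebesgue_measure I)%E.
  exact: product_measure1E.
have fin : lebesgue_measure I \is a fin_num.
  by rewrite /I lebesgue_measure_itv /=; case: ifP.
by rewrite -ge0_fin_numE ?mule_ge0 // !fin_numM.
Qed.

HB.instance Definition _ := @Measure_isSigmaFinite.Build _ _ _ lebesgue2
  lebesgue2_sigma_finite.

(** [lebesgue3] is a product of a product, so invariance is lifted from the line in two stages,
    through [lebesgue2]. *)
Lemma lebesgue3_translate v (A : set (mR * mR * mR)) : measurable A ->
  lebesgue3 (translate3 v @^-1` A) = lebesgue3 A.
Proof.
have mD (a : R) : measurable_fun setT (fun z : mR => (z : R) + a : mR).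
  exact: measurable_funD.
have mD2 : measurable_fun setT (fun p : mR * mR =>
    ((p.1 : R) + v.1.1 : mR, (p.2 : R) + v.1.2 : mR)).
  by apply: measurable_fun_pair; [apply: measurableT_comp (mD _) _|apply: measurableT_comp (mD _) _].
have inv2 B : measurable B -> @lebesgue2
    ((fun p : mR * mR => ((p.1 : R) + v.1.1 : mR, (p.2 : R) + v.1.2 : mR)) @^-1` B) =
    @lebesgue2 B.
  move=> mB; exact: (product_measure_preimage (mD v.1.1) (mD v.1.2)
    (lebesgue_measureD v.1.1) (lebesgue_measureD v.1.2) mB).
move=> mA.
exact: (@product_measure_preimage _ _ _ _ lebesgue2 (@lebesgue_measure R) _ _
  mD2 (mD v.2) inv2 (lebesgue_measureD v.2) A mA).
Qed.

Lemma ccont_shift r f v : ccont r f -> ccont (r + `|v|) (fun x => f (x + v)).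
Proof.
move=> [cf f0]; split=> [x|x rx].
  apply: (continuous_comp (f := fun x => x + v)); last exact: cf.
  by apply: cvgD; [exact: cvg_id|exact: cvg_cst].
apply: f0; rewrite -(ltrD2r `|v|); apply: lt_le_trans rx _.
by rewrite -{1}(addrK v x) ler_normB.
Qed.

Lemma intg_shift r f v : ccont r f -> intg (fun x => f (x + v)) = intg f.
Proof.
move=> cf; rewrite /intg /Rintegral; congr fine.
have mf : measurable_fun setT (EFin \o f : mR * mR * mR -> \bar R).
  by apply/measurable_EFinP; apply: continuous_measurable3; case: cf.
have := @integral_pushforward _ _ _ _ R (translate3 v) (measurable_translate3 v) (@lebesgue3 R) setT
  (EFin \o f) mf (ccont_integrable (ccont_shift v cf)) measurableT.
move=> <-.
by apply: eq_measure_integral => A mA _; exact: lebesgue3_translate.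
Qed.

End integration_space3.

(** * Test functions and cross-correlations *)

Section test_functions.
Variable R : realType.
Local Notation E := (R * R * R)%type.
Implicit Types (f g : E -> R) (v x : E) (r s t : R) (j : 'I_3).

Definition ctest r f := smooth f /\ forall x, r < `|x| -> f x = 0.

Lemma ctest_ccont r f : ctest r f -> ccont r f.
Proof. by move=> [sf f0]; split => //; exact: (sf [::]).1. Qed.

Lemma smooth_partial f j : smooth f -> smooth (partial j f).
Proof.
move=> sf s; have -> : foldr (@partial R) (partial j f) s = foldr (@partial R) f (rcons s j).
  by rewrite foldr_rcons.
exact: sf.
Qed.

Lemma partial_near0 f j x : (\forall y \near x, f y = 0) -> partial j f x = 0.
Proof.
move=> f0; rewrite /partial -[RHS](derive_cst (0 : R) x (e3 R j)).
exact: near_eq_derive.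
Qed.

Lemma ctest_partial r f j : ctest r f -> ctest r (partial j f).
Proof.
move=> [sf f0]; split=> [|x rx]; first exact: smooth_partial.
apply: partial_near0.
have : open [set y : E | r < `|y|].
  rewrite (_ : mkset _ = (fun y : E => `|y|) @^-1` [set t | r < t]) //.
  by apply: open_comp => [y _|]; [exact: norm_continuous|exact: open_gt].
move=> oB; have : nbhs x [set y : E | r < `|y|] by exact: open_nbhs_nbhs.
by apply: filterS => y ry; rewrite f0.
Qed.

Lemma ctest_is_derive r f j x t : ctest r f ->
  is_derive t (1 : R) (fun t => f (x + t *: e3 R j)) (partial j f (x + t *: e3 R j)).
Proof.
move=> [sf _].
have df := (sf [::]).2 (x + t *: e3 R j) j.
have -> : partial j f (x + t *: e3 R j) = 'D_(e3 R j) f (x + t *: e3 R j) by [].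
have E1 : (fun h : R => h^-1 *: (((fun t => f (x + t *: e3 R j)) \o shift t) (h *: 1) -
    f (x + t *: e3 R j))) =
    (fun h : R => h^-1 *: ((f \o shift (x + t *: e3 R j)) (h *: e3 R j) - f (x + t *: e3 R j))).
  apply/funext => h /=; congr (_ *: (f _ - _)).
  by rewrite scalerDl addrCA [h *: 1]mulr1.
apply: DeriveDef; first by rewrite /derivable E1; exact: df.
by rewrite /derive E1.
Qed.

Lemma ctest_mvt r f j x s : ctest r f ->
  exists2 c, `|c| <= `|s| & f (x + s *: e3 R j) - f x = partial j f (x + c *: e3 R j) * s.
Proof.
move=> cf; pose phi t := f (x + t *: e3 R j).
have dphi t := ctest_is_derive j x t cf.
have cphi (a b : R) : {within `[a, b], continuous phi}.
  by apply: derivable_within_continuous => t _; case: (dphi t).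
have phi0 : f x = phi 0 by rewrite /phi scale0r addr0.
have [s0|s0] := leP 0 s.
  have [c] := MVT_segment s0 (fun t _ => dphi t) (cphi 0 s).
  rewrite in_itv /= => /andP[c0 cs] E.
  exists c; first by rewrite !ger0_norm.
  by rewrite phi0 -/(phi s) /phi E subr0.
have [c] := MVT_segment (ltW s0) (fun t _ => dphi t) (cphi s 0).
rewrite in_itv /= => /andP[sc c0] E.
exists c; first by rewrite !ler0_norm ?lerN2 // ltW.
by apply: oppr_inj; rewrite opprB phi0 {1}/phi E sub0r mulrN.
Qed.

(** Two uses of the mean value theorem give an expansion with one constant for all [x]. Being
    uniform, it can be integrated against a compactly supported function, and so replaces
    differentiation under the integral sign in [xcorr_quad]. *)
Lemma ctest_quad r f j : ctest r f -> exists2 M, 0 < M & forall x s,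
  `|f (x + s *: e3 R j) - f x - s * partial j f x| <= M * s ^+ 2.
Proof.
move=> cf; have cf1 := ctest_partial j cf.
have [M M0 MP] := ccont_bounded (ctest_ccont (ctest_partial j cf1)).
exists M => // x s.
have [c cs ->] := ctest_mvt j x s cf.
rewrite [s * _]mulrC -mulrBl.
have [c' _ ->] := ctest_mvt j x c cf1.
rewrite !normrM -(real_normK (num_real s)) expr2 mulrA ler_pM //.
by rewrite ler_pM.
Qed.

Lemma quad_unique (phi : R -> R) (a b K L : R) :
  (forall s, `|phi s - phi 0 - s * a| <= K * s ^+ 2) ->
  (forall s, `|phi s - phi 0 - s * b| <= L * s ^+ 2) -> a = b.
Proof.
move=> ha hb.
have K0 : 0 <= K by have := ha 1; rewrite expr1n mulr1; exact: le_trans.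
have L0 : 0 <= L by have := hb 1; rewrite expr1n mulr1; exact: le_trans.
apply/eqP; rewrite -subr_eq0 -normr_le0; apply/ler_addgt0Pr => e e0; rewrite add0r.
pose s := e / (K + L + 1).
have KL : 0 < K + L + 1 by rewrite ltr_wpDl // addr_ge0.
have s0 : 0 < s by rewrite divr_gt0.
rewrite -(ler_pM2l s0) -[X in X * `|_|](gtr0_norm s0) -normrM.
have -> : s * (a - b) = (phi s - phi 0 - s * b) - (phi s - phi 0 - s * a) by ring.
apply: le_trans (ler_normB _ _) _; apply: le_trans (lerD (hb s) (ha s)) _.
have -> : e = s * (K + L + 1) by rewrite /s divfK // lt0r_neq0.
by have := sqr_ge0 s; nra.
Qed.

Lemma intgD r r' f g : ccont r f -> ccont r' g ->
  intg (fun x => f x + g x) = intg f + intg g.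
Proof.
move=> cf cg; rewrite /intg RintegralD //; first exact: ccont_integrable cf.
exact: ccont_integrable cg.
Qed.

Lemma intgB r r' f g : ccont r f -> ccont r' g ->
  intg (fun x => f x - g x) = intg f - intg g.
Proof.
move=> cf cg; rewrite /intg RintegralB //; first exact: ccont_integrable cf.
exact: ccont_integrable cg.
Qed.

Lemma intgZ r f a : ccont r f -> intg (fun x => a * f x) = a * intg f.
Proof. by move=> cf; rewrite /intg RintegralZl //; exact: ccont_integrable cf. Qed.

Lemma le_intg r r' f g : ccont r f -> ccont r' g -> (forall x, f x <= g x) -> intg f <= intg g.
Proof.
move=> cf cg fg; apply: le_Rintegral => //; first exact: ccont_integrable cf.
exact: ccont_integrable cg.
Qed.

Lemma ccont_norm r f : ccont r f -> ccont r (fun x => `|f x|).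
Proof.
move=> [cf f0]; split=> [x|x /f0 ->]; last by rewrite normr0.
by apply: (continuous_comp (g := fun y : R => `|y|)); [exact: cf|exact: norm_continuous].
Qed.

Lemma le_norm_intg r f : ccont r f -> `|intg f| <= intg (fun x => `|f x|).
Proof. by move=> cf; apply: le_normr_Rintegral => //; exact: ccont_integrable cf. Qed.

Lemma ccontM r r' f g : ccont r f -> ccont r' g -> ccont r' (fun x => f x * g x).
Proof.
move=> [cf f0] [cg g0]; split=> [x|x /g0 ->]; last by rewrite mulr0.
by apply: cvgM; [exact: cf|exact: cg].
Qed.

Lemma ccontD r f g : ccont r f -> ccont r g -> ccont r (fun x => f x + g x).
Proof.
move=> [cf f0] [cg g0]; split=> [x|x rx]; last by rewrite f0 // g0 // addr0.
by apply: cvgD; [exact: cf|exact: cg].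
Qed.

Lemma ccontB r f g : ccont r f -> ccont r g -> ccont r (fun x => f x - g x).
Proof.
move=> [cf f0] [cg g0]; split=> [x|x rx]; last by rewrite f0 // g0 // subr0.
by apply: cvgB; [exact: cf|exact: cg].
Qed.

Lemma ccontZ r f a : ccont r f -> ccont r (fun x => a * f x).
Proof.
move=> [cf f0]; split=> [x|x rx]; last by rewrite f0 // mulr0.
by apply: cvgM; [exact: cvg_cst|exact: cf].
Qed.

(** Cross-correlation as a function of the shift: translations pass from one factor to the other,
    and derivatives in [v] are derivatives of [f]. *)
Definition xcorr f g v : R := intg (fun x => f (x + v) * g x).

Lemma ccont_xcorr r r' f g v : ccont r f -> ccont r' g ->
  ccont r' (fun x => f (x + v) * g x).
Proof. by move=> cf cg; exact: ccontM (ccont_shift v cf) cg. Qed.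

Lemma xcorrC r r' f g v : ccont r f -> ccont r' g -> xcorr f g v = xcorr g f (- v).
Proof.
move=> cf cg; have := intg_shift v (ccont_xcorr (- v) cg cf).
by rewrite /xcorr => <-; congr intg; apply/funext => x; rewrite addrK mulrC.
Qed.

Lemma xcorrBl r f f' g v : ccont r f -> ccont r f' -> ccont r g ->
  xcorr (fun x => f x - f' x) g v = xcorr f g v - xcorr f' g v.
Proof.
move=> cf cf' cg; rewrite /xcorr -(intgB (ccont_xcorr v cf cg) (ccont_xcorr v cf' cg)).
by congr intg; apply/funext => x; rewrite mulrBl.
Qed.

Lemma xcorrBr r f g g' v : ccont r f -> ccont r g -> ccont r g' ->
  xcorr f (fun x => g x - g' x) v = xcorr f g v - xcorr f g' v.
Proof.
move=> cf cg cg'; rewrite /xcorr -(intgB (ccont_xcorr v cf cg) (ccont_xcorr v cf cg')).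
by congr intg; apply/funext => x; rewrite mulrBr.
Qed.

Lemma xcorr_quad r f g j : ctest r f -> ccont r g -> exists2 K, 0 <= K & forall v s,
  `|xcorr f g (v + s *: e3 R j) - xcorr f g v - s * xcorr (partial j f) g v| <= K * s ^+ 2.
Proof.
move=> tf cg; have [M M0 MP] := ctest_quad j tf.
have cf := ctest_ccont tf; have cf1 := ctest_ccont (ctest_partial j tf).
exists (M * intg (fun x => `|g x|)).
  by apply: mulr_ge0; [exact: ltW|apply: Rintegral_ge0 => x _; exact: normr_ge0].
move=> v s; rewrite /xcorr.
have c1 := ccont_xcorr (v + s *: e3 R j) cf cg.
have c2 := ccont_xcorr v cf cg.
have c3 := ccontZ s (ccont_xcorr v cf1 cg).
rewrite -(intgB c1 c2) -(intgZ s (ccont_xcorr v cf1 cg)) -(intgB (ccontB c1 c2) c3).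
apply: le_trans (le_norm_intg (ccontB (ccontB c1 c2) c3)) _.
rewrite mulrAC -(intgZ _ (ccont_norm cg)).
apply: le_intg (ccont_norm (ccontB (ccontB c1 c2) c3)) (ccontZ _ (ccont_norm cg)) _ => x.
by rewrite mulrA -!mulrBl normrM addrA ler_wpM2r.
Qed.

(** Shifting [f] by [v] amounts to shifting [g] by [- v]. Expanding the correlation in the shift in
    both ways gives two first-order coefficients, and [quad_unique] identifies them. *)
Lemma xcorr_ibp r f g j v : ctest r f -> ctest r g ->
  xcorr (partial j f) g v = - xcorr f (partial j g) v.
Proof.
move=> tf tg; have cf := ctest_ccont tf; have cg := ctest_ccont tg.
have cg1 := ctest_ccont (ctest_partial j tg).
have [K _ KP] := xcorr_quad j tf cg; have [L _ LP] := xcorr_quad j tg cf.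
apply: (@quad_unique (fun s => xcorr f g (v + s *: e3 R j)) _ _ K L) => s.
  by have := KP v s; rewrite scale0r addr0.
have := LP (- v) (- s); rewrite scale0r addr0 (xcorrC _ cf cg) (xcorrC v cf cg).
rewrite (xcorrC v cf cg1) scaleNr -opprD sqrrN.
by rewrite mulrN !mulNr.
Qed.

#[local] Opaque partial intg xcorr.

(** Both sides are the derivative along [e3 R k] of [xcorr f (partial i g) = - xcorr (partial i f)
    g] as a function of the shift, so second derivatives of [f] are never interchanged. *)
Lemma xcorr_partialC r f g i k v : ctest r f -> ctest r g ->
  xcorr (partial i f) (partial k g) v = xcorr (partial k f) (partial i g) v.
Proof.
move=> tf tg.
have ti := ctest_partial i tf; have tgi := ctest_partial i tg.
have [K _ KP] := xcorr_quad k ti (ctest_ccont tg).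
have [L _ LP] := xcorr_quad k tf (ctest_ccont tgi).
have E w : xcorr (partial i f) g w = - xcorr f (partial i g) w := xcorr_ibp i w tf tg.
have E1 : xcorr (partial k (partial i f)) g v = - xcorr (partial k f) (partial i g) v.
  apply: (@quad_unique (fun s => xcorr (partial i f) g (v + s *: e3 R k)) _ _ K L) => s.
    by have := KP v s; rewrite scale0r addr0.
  have := LP v s; rewrite scale0r addr0 (E v) (E (v + s *: e3 R k)).
  move: (xcorr f _ _) (xcorr f _ _) (xcorr (partial k f) _ _) => a b c.
  by rewrite -normrN; congr (`|_| <= _); ring.
exact: oppr_inj (etrans (esym (xcorr_ibp k v ti tg)) E1).
Qed.

End test_functions.

(** * The curl of real fields *)

Section curl_calculus.
Variable R : realType.
Local Notation E := (R * R * R)%type.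
Local Notation e3 := (e3 R).
Implicit Types (f g : E -> R) (v x : E) (r s t : R) (i j k : 'I_3).

Lemma smooth_comb (a : R) f g : smooth f -> smooth g ->
  smooth (fun x => a * f x + g x) /\
  forall j x, partial j (fun x => a * f x + g x) x = a * partial j f x + partial j g x.
Proof.
move=> sf sg.
have step (F G : E -> R) j : (forall x, derivable F x (e3 j)) -> (forall x, derivable G x (e3 j)) ->
    partial j (fun x => a * F x + G x) = (fun x => a * partial j F x + partial j G x) /\
    forall x, derivable (fun x => a * F x + G x) x (e3 j).
  move=> dF dG.
  have E1 : (fun x => a * F x + G x) = (a \*: F) + G by [].
  split; last by move=> x; rewrite E1; apply: derivableD => //; exact: derivableZ.
  by apply/funext => x; rewrite /partial E1 deriveD ?deriveZ //; exact: derivableZ.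
have all (s : seq 'I_3) : foldr (@partial R) (fun x => a * f x + g x) s =
    (fun x => a * foldr (@partial R) f s x + foldr (@partial R) g s x).
  elim: s => // j s /= ->.
  by have [-> _] := step _ _ j (fun x => (sf s).2 x j) (fun x => (sg s).2 x j).
split; last first.
  by move=> j x; have [-> _] := step _ _ j (fun x => (sf [::]).2 x j) (fun x => (sg [::]).2 x j).
move=> s; rewrite all; split.
  move=> x; apply: cvgD; last exact: (sg s).1.
  by apply: cvgM; [exact: cvg_cst|exact: (sf s).1].
move=> x j; have [_] := step _ _ j (fun x => (sf s).2 x j) (fun x => (sg s).2 x j).
exact.
Qed.

Lemma smooth0 : smooth (fun _ : E => 0 : R).
Proof.
have E0 (s : seq 'I_3) : foldr (@partial R) (fun=> 0) s = fun=> 0.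
  elim: s => // j s /= ->; apply/funext => x; exact: derive_cst.
by move=> s; rewrite E0; split=> [x|x j]; [exact: cst_continuous|exact: derivable_cst].
Qed.

Lemma ctest_comb r (a : R) f g : ctest r f -> ctest r g -> ctest r (fun x => a * f x + g x).
Proof.
move=> [sf f0] [sg g0]; split; first exact: (smooth_comb a sf sg).1.
by move=> x rx; rewrite f0 // g0 // mulr0 addr0.
Qed.

Lemma ctestB r f g : ctest r f -> ctest r g -> ctest r (fun x => f x - g x).
Proof.
move=> cf cg; have := ctest_comb (-1) cg cf; congr (ctest r _).
by apply/funext => x; rewrite mulN1r addrC.
Qed.

#[local] Opaque partial intg xcorr.

(** Complex fields are treated through their real and imaginary parts; this is the curl of such a
    part, with the cyclic indices of [curl_field]. *)
Definition curlr (Phi : 'I_3 -> E -> R) i x : R :=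
  partial (i + 1) (Phi (i + 2)) x - partial (i + 2) (Phi (i + 1)) x.

Lemma ctest_curlr r (Phi : 'I_3 -> E -> R) i :
  (forall i, ctest r (Phi i)) -> ctest r (curlr Phi i).
Proof. by move=> cP; apply: ctestB; exact: ctest_partial. Qed.

Lemma ord3P (j : 'I_3) : [/\ j + 1 + 1 = j + 2, j + 1 + 2 = j, j + 2 + 1 = j & j + 2 + 2 = j + 1].
Proof. by case: j => [[|[|[|//]]]] lt; split; exact: val_inj. Qed.

Lemma sum_ord3_shift (F : 'I_3 -> R) : \sum_i F (i + 1) = \sum_i F i.
Proof. by rewrite [RHS](reindex_inj (addIr 1)). Qed.

(** Exchanging the derivatives of the two factors turns the second half of the curl into its first
    half with the index shifted cyclically by one, so the two sums cancel. *)
Lemma grad_curl_orth r f (Phi : 'I_3 -> E -> R) v : ctest r f ->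
  (forall i, ctest r (Phi i)) -> \sum_i xcorr (partial i f) (curlr Phi i) v = 0.
Proof.
move=> cf cP.
have E i : xcorr (partial i f) (curlr Phi i) v =
    xcorr (partial i f) (partial (i + 1) (Phi (i + 2))) v -
    xcorr (partial (i + 2) f) (partial i (Phi (i + 1))) v.
  rewrite -(xcorr_partialC i (i + 2) v cf (cP (i + 1))).
  exact: (xcorrBr v (ctest_ccont (ctest_partial i cf))
    (ctest_ccont (ctest_partial (i + 1) (cP (i + 2))))
    (ctest_ccont (ctest_partial (i + 2) (cP (i + 1))))).
rewrite (eq_bigr _ (fun i _ => E i)) sumrB -[X in _ - X]sum_ord3_shift.
apply/eqP; rewrite subr_eq0; apply/eqP; apply: eq_bigr => i _.
by have [-> -> _ _] := ord3P i.
Qed.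

Lemma curlr_sym r (Psi Phi : 'I_3 -> E -> R) :
  (forall i, ctest r (Psi i)) -> (forall i, ctest r (Phi i)) ->
  \sum_i intg (fun x => curlr Psi i x * Phi i x) = \sum_i intg (fun x => Psi i x * curlr Phi i x).
Proof.
move=> cP cQ.
have X0 f g : intg (fun x => f x * g x) = xcorr f g 0.
  by congr intg; apply/funext => x; rewrite addr0.
have L i : intg (fun x => curlr Psi i x * Phi i x) =
    xcorr (partial (i + 1) (Psi (i + 2))) (Phi i) 0 - xcorr (partial (i + 2) (Psi (i + 1))) (Phi i) 0.
  by rewrite X0; apply: xcorrBl; apply: ctest_ccont => //; apply: ctest_partial.
have Rr i : intg (fun x => Psi i x * curlr Phi i x) =
    xcorr (partial (i + 2) (Psi i)) (Phi (i + 1)) 0 - xcorr (partial (i + 1) (Psi i)) (Phi (i + 2)) 0.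
  rewrite X0 (xcorr_ibp (i + 2) 0 (cP i) (cQ (i + 1))) (xcorr_ibp (i + 1) 0 (cP i) (cQ (i + 2))).
  rewrite opprK addrC; apply: xcorrBr; apply: ctest_ccont => //; exact: ctest_partial.
rewrite (eq_bigr _ (fun i _ => L i)) (eq_bigr _ (fun i _ => Rr i)) !sumrB.
congr (_ - _).
  rewrite -[LHS]sum_ord3_shift; apply: eq_bigr => i _.
  by have [-> -> _ _] := ord3P i.
rewrite -[RHS]sum_ord3_shift; apply: eq_bigr => i _.
by have [-> -> _ _] := ord3P i.
Qed.

(** [c] is 0, 1 or -1; keeping only [|c| <= 1] lets later estimates treat the three positions of [i]
    alike. *)
Lemma curl_diff (Psi : 'I_3 -> E -> R) j i : exists k, exists2 c : R, `|c| <= 1 &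
  forall x, partial j (Psi i) x - partial i (Psi j) x = c * curlr Psi k x.
Proof.
have [e11 e12 e21 e22] := ord3P j.
have [->|[->|->]] : i = j \/ i = j + 1 \/ i = j + 2.
  case: (eqVneq i j) => [->|ij]; first by left.
  case: (eqVneq i (j + 1)) => [->|ij1]; first by right; left.
  right; right; case: j i {e11 e12 e21 e22} ij ij1 => [[|[|[|//]]]] lt [[|[|[|//]]]] lt' // h1 h2;
    try (by exact: val_inj); exfalso; try (by move/eqP: h1; apply; exact: val_inj);
    by move/eqP: h2; apply; exact: val_inj.
- by exists j, 0 => [|x]; rewrite ?normr0 // subrr mul0r.
- exists (j + 2), 1 => [|x]; first by rewrite normr1.
  by rewrite mul1r /curlr e21 e22.
- exists (j + 1), (-1) => [|x]; first by rewrite normrN1.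
  by rewrite mulN1r /curlr e11 e12 opprB.
Qed.

End curl_calculus.

(** * Lipschitz bounds and Fubini for correlations *)

Section correlation_bounds.
Variable R : realType.
Local Notation mR := (measurableTypeR R).
Local Notation E := (R * R * R)%type.
Local Notation e3 := (e3 R).
Implicit Types (f g p q : E -> R) (v x z : E) (r s t h : R) (i j k : 'I_3).

Definition coord3 v j : R := if j == 0 then v.1.1 else if j == 1 then v.1.2 else v.2.

Lemma coord3E v : v = coord3 v 0 *: e3 0 + coord3 v 1 *: e3 1 + coord3 v 2 *: e3 2.
Proof.
rewrite /coord3 /e3 /=.
by case: v => [[a b] c]; congr (_, _, _);
  rewrite /= ?mulr1 ?mulr0 ?addr0 ?add0r // /GRing.scale /= ?mulr1 ?mulr0 ?addr0 ?add0r.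
Qed.

Lemma le_coord3 v j : `|coord3 v j| <= `|v|.
Proof.
have := lexx `|v|; rewrite {1}norm3_le /coord3 => /and3P[? ? ?].
by case: ifP => // _; case: ifP.
Qed.

(** The increment is walked along the three axes, and in the maximum norm each leg is at most
    [|v|]. *)
Lemma axis_lipschitz (F : E -> R) (L : R) :
  (forall x j s, `|F (x + s *: e3 j) - F x| <= L * `|s|) ->
  forall x v, `|F (x + v) - F x| <= 3 * L * `|v|.
Proof.
move=> FL x v.
have L0 : 0 <= L.
  by have := FL 0 0 1; rewrite normr1 mulr1; exact: le_trans.
rewrite [in F (x + v)](coord3E v) !addrA.
set a := x + _; set b := a + _.
have -> : F (b + coord3 v 2 *: e3 2) - F x =
  (F (b + coord3 v 2 *: e3 2) - F b) + (F b - F a) + (F a - F x) by ring.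
apply: le_trans (ler_normD _ _) _; apply: le_trans (lerD (ler_normD _ _) (lexx _)) _.
have := FL b 2 (coord3 v 2); have := FL a 1 (coord3 v 1); have := FL x 0 (coord3 v 0).
have := ler_wpM2l L0 (le_coord3 v 0); have := ler_wpM2l L0 (le_coord3 v 1).
by have := ler_wpM2l L0 (le_coord3 v 2); rewrite -/a -/b; lra.
Qed.

Lemma ctest_lipschitz r f : ctest r f -> exists2 L, 0 <= L &
  forall x v, `|f (x + v) - f x| <= L * `|v|.
Proof.
move=> cf.
have [M0 _ M0P] := ccont_bounded (ctest_ccont (ctest_partial 0 cf)).
have [M1 _ M1P] := ccont_bounded (ctest_ccont (ctest_partial 1 cf)).
have [M2 _ M2P] := ccont_bounded (ctest_ccont (ctest_partial 2 cf)).
have MP j x : `|partial j f x| <= `|M0| + `|M1| + `|M2|.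
  have [h0 h1 h2] := And3 (ler_norm M0) (ler_norm M1) (ler_norm M2).
  have [k0 k1 k2] := And3 (normr_ge0 M0) (normr_ge0 M1) (normr_ge0 M2).
  have := M0P x; have := M1P x; have := M2P x.
  have : j = 0 \/ j = 1 \/ j = 2.
    case: j => [[|[|[|//]]]] lt; [left|right; left|right; right]; exact: val_inj.
  by move=> [->|[->|->]]; move: (partial _ _ _) => a; move: (partial _ _ _) => b;
    move: (partial _ _ _) => c; lra.
exists (3 * (`|M0| + `|M1| + `|M2|)); first by rewrite mulr_ge0 // !addr_ge0.
apply: axis_lipschitz => x j s; have [c _ ->] := ctest_mvt j x s cf.
by rewrite normrM ler_wpM2r.
Qed.

Lemma intg_ge0 f : (forall x, 0 <= f x) -> 0 <= intg f.
Proof. by move=> f0; apply: Rintegral_ge0. Qed.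

Lemma xcorr_lipschitz r r' f g (L : R) : ccont r f -> ccont r' g ->
  (forall x v, `|f (x + v) - f x| <= L * `|v|) ->
  forall z v, `|xcorr f g (z + v) - xcorr f g z| <= L * `|v| * intg (fun x => `|g x|).
Proof.
move=> cf cg fL z v; rewrite /xcorr.
have c1 := ccont_xcorr (z + v) cf cg; have c2 := ccont_xcorr z cf cg.
rewrite -(intgB c1 c2); apply: le_trans (le_norm_intg (ccontB c1 c2)) _.
rewrite -(intgZ _ (ccont_norm cg)).
apply: (le_intg (ccont_norm (ccontB c1 c2)) (ccontZ _ (ccont_norm cg))) => x.
by rewrite -mulrBl normrM addrA ler_wpM2r.
Qed.

Lemma xcorr_supp r r' f g v : ccont r f -> ccont r' g -> r + r' < `|v| -> xcorr f g v = 0.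
Proof.
move=> [_ f0] [_ g0] rv; rewrite /xcorr (_ : (fun x => _) = cst 0).
  by rewrite /intg Rintegral_cst // mul0r.
apply/funext => x /=; have [xr|xr] := leP `|x| r'; last by rewrite g0 // mulr0.
rewrite f0 ?mul0r //; have : `|v| <= `|x + v| + `|x|.
  by rewrite -{1}(addrK x v) [v + x]addrC ler_normB.
by move: (`|x + v|) (`|x|) (`|v|) xr rv => a b c; lra.
Qed.

Lemma lipschitz_continuous (F : E -> R) (L : R) :
  (forall x v, `|F (x + v) - F x| <= L * `|v|) -> continuous F.
Proof.
move=> FL x; apply/cvgrPdist_lt => e e0.
have L0 : 0 < `|L| + 1 by rewrite ltr_wpDl.
have d0 : 0 < e / (`|L| + 1) by rewrite divr_gt0.
have := nbhsx_ballx x _ d0; apply: filterS => y.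
rewrite -ball_normE /= => xy; rewrite distrC -[y](subrK x) [y - x + x]addrC.
apply: le_lt_trans (FL x (y - x)) _.
move: xy; rewrite ltr_pdivlMr // distrC.
have := ler_wpM2r (normr_ge0 (y - x)) (ler_norm L); have := normr_ge0 (y - x).
by move: (`|y - x|) => t; nra.
Qed.

Lemma ctest_xcorr_ccont r r' f g : ctest r f -> ccont r' g -> ccont (r + r') (xcorr f g).
Proof.
move=> tf cg; have cf := ctest_ccont tf; have [L L0 LP] := ctest_lipschitz tf.
split; last by move=> v; exact: xcorr_supp.
apply: (@lipschitz_continuous _ (L * intg (fun x => `|g x|))) => x v.
by rewrite mulrAC; exact: xcorr_lipschitz cf cg LP x v.
Qed.

Lemma EFin_intg r f : ccont r f -> (\int[@lebesgue3 R]_x (f x)%:E)%E = (intg f)%:E.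
Proof.
move=> cf; rewrite /intg /Rintegral fineK //.
by apply: integrable_fin_num => //; exact: ccont_integrable cf.
Qed.

(** Fubini for [f (x + w + v) * g x * p w]. When [p] is a kernel, averaging the correlation of [f]
    with [g] amounts to correlating the averaged [f] with [g]. *)
Lemma xcorr_xcorr r f g p v : ccont r f -> ccont r g -> ccont r p ->
  xcorr (xcorr f g) p v = xcorr (xcorr f p) g v.
Proof.
move=> cf cg cp.
pose F (wx : (mR * mR * mR) * (mR * mR * mR)) : R :=
  f ((wx.2 : E) + ((wx.1 : E) + v)) * g wx.2 * p wx.1.
have mf : measurable_fun setT (f : mR * mR * mR -> mR) by exact: continuous_measurable3 cf.1.
have mg : measurable_fun setT (g : mR * mR * mR -> mR) by exact: continuous_measurable3 cg.1.
have mp : measurable_fun setT (p : mR * mR * mR -> mR) by exact: continuous_measurable3 cp.1.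
have madd : measurable_fun setT (fun wx : (mR * mR * mR) * (mR * mR * mR) =>
    (wx.2 : E) + ((wx.1 : E) + v) : mR * mR * mR).
  by apply: measurable_fun_pair; [apply: measurable_fun_pair|];
    apply: measurable_funD => //; do ?apply: measurable_funD => //;
    do 3?apply: measurableT_comp => //.
have mF : measurable_fun setT F.
  apply: measurable_funM; last by apply: measurableT_comp.
  apply: measurable_funM; last by apply: measurableT_comp.
  exact: (measurableT_comp mf madd).
have [M M0 MP] := ccont_bounded cf.
pose B (wx : (mR * mR * mR) * (mR * mR * mR)) : R := M * (`|g wx.2| * `|p wx.1|).
have mB : measurable_fun setT B.
  by apply: measurable_funM => //; apply: measurable_funM; apply: measurableT_comp => //;
    apply: measurableT_comp.
have iB : (@lebesgue3 R \x @lebesgue3 R)%E.-integrable setT (EFin \o B).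
  apply/integrable12ltyP; first exact/measurable_EFinP.
  rewrite (_ : (fun x => _) = (fun w => (`|p w| * (M * intg (fun x => `|g x|)))%:E)).
    have := EFin_intg (ccontZ (M * intg (fun x => `|g x|)) (ccont_norm cp)).
    by under eq_integral do rewrite mulrC; move=> ->; rewrite ltry.
  apply/funext => w /=.
  rewrite -(intgZ M (ccont_norm cg)) -(intgZ _ (ccontZ M (ccont_norm cg))).
  rewrite -(EFin_intg (ccontZ _ (ccontZ M (ccont_norm cg)))).
  apply: eq_integral => x _; rewrite /B /= ger0_norm.
    by congr EFin; ring.
  by rewrite !mulr_ge0 // ltW.
have iF : (@lebesgue3 R \x @lebesgue3 R)%E.-integrable setT (EFin \o F).
  apply: le_integrable iB => //; first exact/measurable_EFinP.
  move=> [w x] _; rewrite /= lee_fin [leRHS]ger0_norm ?mulr_ge0 ?(ltW M0) //.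
  by rewrite /F /B /= !normrM -mulrA ler_wpM2r ?mulr_ge0.
change (fine (\int[@lebesgue3 R]_w (xcorr f g (w + v) * p w)%:E)%E =
  fine (\int[@lebesgue3 R]_x (xcorr f p (x + v) * g x)%:E)%E); congr fine.
have inner1 w : ((xcorr f g (w + v) * p w)%:E = \int[@lebesgue3 R]_x (EFin \o F) (w, x))%E.
  rewrite mulrC -(intgZ (p w) (ccont_xcorr (w + v) cf cg)).
  rewrite -(EFin_intg (ccontZ _ (ccont_xcorr (w + v) cf cg))).
  by apply: eq_integral => x _; rewrite /F /= mulrC.
have inner2 x : ((xcorr f p (x + v) * g x)%:E = \int[@lebesgue3 R]_w (EFin \o F) (w, x))%E.
  rewrite mulrC -(intgZ (g x) (ccont_xcorr (x + v) cf cp)).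
  rewrite -(EFin_intg (ccontZ _ (ccont_xcorr (x + v) cf cp))).
  apply: eq_integral => w _; rewrite /F /= [x + (w + v)]addrCA.
  by congr EFin; ring.
under eq_integral => w _ do rewrite inner1.
under [RHS]eq_integral => x _ do rewrite inner2.
exact: (Fubini iF).
Qed.

End correlation_bounds.

(** * The averaging kernel and finite nets *)

Section tent.
Variable R : realType.
Local Notation E := (R * R * R)%type.
Implicit Types (f g p q : E -> R) (v x z : E) (r s t h : R).

(** The averaging kernel: nonnegative, supported in the box of radius [h] and 1-Lipschitz.
    Derivatives always fall on the other factor of a correlation, so Lipschitz continuity is
    enough. *)
Definition tent h x : R := Num.max 0 (h - `|x|).

Lemma tent_ge0 h x : 0 <= tent h x.
Proof. by rewrite /tent le_max lexx. Qed.

Lemma tent_lipschitz h x v : `|tent h (x + v) - tent h x| <= 1 * `|v|.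
Proof.
have := ler_dist_dist (x + v) x; rewrite (_ : x + v - x = v); last by rewrite addrAC subrr add0r.
rewrite /tent mul1r; move: (`|x + v|) (`|x|) (`|v|) => a b c.
rewrite !ler_norml => /andP[h1 h2]; rewrite !maxEle.
by case: ifPn => h3; case: ifPn => h4; apply/andP; rewrite -?ltNge in h3 h4; lra.
Qed.

Lemma tent_ccont h : ccont h (tent h).
Proof.
split; first exact: lipschitz_continuous (@tent_lipschitz h).
by move=> x hx; rewrite /tent max_l // subr_le0 ltW.
Qed.

Lemma intg_tent_gt0 h : 0 < h -> 0 < intg (tent h).
Proof.
move=> h0; have h20 : 0 < h / 2 by rewrite divr_gt0.
rewrite -lte_fin -(EFin_intg (tent_ccont h)).
apply: (@lt_le_trans _ _ (\int[@lebesgue3 R]_(x in [set x : E | (`|x| <= h / 2)%R]) (h / 2)%:E)%E).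
  rewrite integral_cst; last exact: measurable_box.
  have E0 := lebesgue3_box (ltW h20).
  change (0 < (h / 2)%:E * @lebesgue3 R [set x : E | (`|x| <= h / 2)%R])%E.
  by rewrite E0 -EFinM lte_fin mulr_gt0 // exprn_gt0 // mulr_gt0.
apply: (@le_trans _ _ (\int[@lebesgue3 R]_(x in [set x : E | (`|x| <= h / 2)%R]) (tent h x)%:E)%E).
  apply: ge0_le_integral => //.
  - exact: measurable_box.
  - by move=> x _; rewrite lee_fin ltW.
  - apply/measurable_EFinP; apply: measurable_funTS.
    exact: continuous_measurable3 (tent_ccont h).1.
  - move=> x /= xh; rewrite lee_fin /tent le_max; apply/orP; right.
    by move: (`|x|) xh => a; lra.
apply: ge0_subset_integral => //.
- exact: measurable_box.
- by apply/measurable_EFinP; exact: continuous_measurable3 (tent_ccont h).1.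
- by move=> x _; rewrite lee_fin tent_ge0.
Qed.

(** From [2 |g| <= 1 + g^2], where 1 is replaced by [tent (r + 1)], which is at least 1 on the box
    supporting [g] and integrable. *)
Lemma intg_norm_le r g : ccont r g -> intg (fun x => g x ^+ 2) <= 1 ->
  intg (fun x => `|g x|) <= (intg (tent (r + 1)) + 1) / 2.
Proof.
move=> cg g1.
have cg2 : ccont r (fun x => g x ^+ 2).
  by rewrite (_ : (fun x => _) = fun x => g x * g x) //; exact: (ccontM cg cg).
have cr : ccont (r + 1) (fun x => g x ^+ 2).
  by split; [exact: cg2.1|move=> x rx; apply: cg2.2; apply: lt_trans rx; rewrite ltrDl].
apply: (@le_trans _ _ (intg (fun x => 2^-1 * (tent (r + 1) x + g x ^+ 2)))); last first.
  rewrite (intgZ _ (ccontD (tent_ccont _) cr)) (intgD (tent_ccont _) cr).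
  by rewrite mulrC ler_wpM2r ?invr_ge0 // lerD2l.
apply: (le_intg (ccont_norm cg) (ccontZ _ (ccontD (tent_ccont _) cr))) => x.
have [xr|xr] := leP `|x| r; last first.
  by rewrite cg.2 // normr0 expr0n addr0 mulr_ge0 ?invr_ge0 // tent_ge0.
rewrite -(real_normK (num_real (g x))) ler_pdivlMl //.
have : 1 <= tent (r + 1) x by rewrite /tent le_max; apply/orP; right; move: (`|x|) xr => a; lra.
by have := sqr_ge0 (`|g x| - 1); move: (`|g x|) => a; move: (tent _ _) => b; nra.
Qed.

(** Over [n] equal steps the linear terms add up to [C |b - a|] and the quadratic errors to
    [K (b - a)^2 / n], which is arbitrarily small. *)
Lemma quad_lipschitz (phi dphi : R -> R) (K C : R) :
  (forall t s, `|phi (t + s) - phi t - s * dphi t| <= K * s ^+ 2) ->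
  (forall t, `|dphi t| <= C) -> forall a b, `|phi b - phi a| <= C * `|b - a|.
Proof.
move=> hK hC a b.
have K0 : 0 <= K by have := hK 0 1; rewrite expr1n mulr1; exact: le_trans.
have step t s : `|phi (t + s) - phi t| <= C * `|s| + K * s ^+ 2.
  have -> : phi (t + s) - phi t = phi (t + s) - phi t - s * dphi t + s * dphi t by ring.
  apply: le_trans (ler_normD _ _) _; rewrite addrC lerD //.
  by rewrite normrM mulrC ler_wpM2r.
have chain s n : `|phi (a + n%:R * s) - phi a| <= n%:R * (C * `|s| + K * s ^+ 2).
  elim: n => [|n IHn]; first by rewrite !mul0r addr0 subrr normr0.
  have -> : a + n.+1%:R * s = (a + n%:R * s) + s by rewrite -natr1; ring.
  have -> : phi (a + n%:R * s + s) - phi a =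
    phi (a + n%:R * s + s) - phi (a + n%:R * s) + (phi (a + n%:R * s) - phi a) by ring.
  apply: le_trans (ler_normD _ _) _; rewrite -natr1 mulrDl mul1r addrC.
  exact: lerD.
apply/ler_addgt0Pr => e e0.
pose D := K * (b - a) ^+ 2.
have D0 : 0 <= D by rewrite mulr_ge0 // sqr_ge0.
pose n := (Num.trunc (D / e)).+1.
have n0 : 0 < n%:R :> R by rewrite ltr0n.
have nD : D / n%:R <= e.
  by rewrite ler_pdivrMr // mulrC -ler_pdivrMr // ltW // truncnS_gt.
have := chain ((b - a) / n%:R) n.
rewrite [n%:R * ((b - a) / n%:R)]mulrC divfK ?lt0r_neq0 // [a + _]addrC subrK => h.
apply: le_trans h _; rewrite mulrDr normrM (gtr0_norm (_ : 0 < n%:R^-1)) ?invr_gt0 //.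
have -> : n%:R * (C * (`|b - a| * n%:R^-1)) = C * `|b - a|.
  by field; rewrite lt0r_neq0.
rewrite lerD2l (le_trans _ nD) // le_eqVlt; apply/orP; left; apply/eqP.
by rewrite /D; field; rewrite lt0r_neq0.
Qed.

Lemma interval_net r (d : R) : 0 < d -> exists ts : seq R,
  forall t, `|t| <= r -> exists2 u, u \in ts & `|t - u| < d.
Proof.
move=> d0; exists [seq i%:R * d - r | i <- iota 0 (Num.truncn (2 * r / d)).+1] => t.
rewrite ler_norml => /andP[rt tr].
have t0 : 0 <= (t + r) / d by rewrite divr_ge0 ?(ltW d0) // -[r]opprK subr_ge0.
exists ((Num.truncn ((t + r) / d))%:R * d - r).
  apply/mapP; exists (Num.truncn ((t + r) / d)) => //.
  rewrite mem_iota /= add0n ltnS le_truncn // ler_pM2r ?invr_gt0 //.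
  by rewrite mulrDl mul1r lerD2r.
have /andP[] := truncn_itv t0; rewrite -natr1; move: (_%:R) => a.
rewrite ler_pdivlMr // ltr_pdivrMr // mulrDl mul1r => h1 h2.
by rewrite ger0_norm; lra.
Qed.

Lemma box_net r (d : R) : 0 < d -> exists zs : seq E,
  forall z, `|z| <= r -> exists2 z', z' \in zs & `|z - z'| < d.
Proof.
move=> d0; have [ts net] := interval_net r d0.
exists (allpairs pair (allpairs pair ts ts) ts).
move=> [[a b] c]; rewrite !prod_normE /= !ge_max => /andP[/andP[ar br] cr].
have [[a' a'P ha] [b' b'P hb] [c' c'P hc]] := And3 (net _ ar) (net _ br) (net _ cr).
exists (a', b', c'); first by apply: allpairs_f => //; exact: allpairs_f.
by rewrite /= !prod_normE /= !gt_max ha hb hc.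
Qed.

End tent.

(** * The estimate of the pairing *)

Section curl_estimate.
Variable R : realType.
Local Notation E := (R * R * R)%type.
Implicit Types (f g p q : E -> R) (v x y z : E) (r s t h : R) (Psi Phi : 'I_3 -> E -> R).

Lemma ccont_le r r' f : r <= r' -> ccont r f -> ccont r' f.
Proof. by move=> rr [cf f0]; split=> // x r'x; apply: f0; exact: le_lt_trans r'x. Qed.

Lemma ccont_sum n r (f : 'I_n -> E -> R) : (forall i, ccont r (f i)) ->
  ccont r (fun x => \sum_i f i x) /\ intg (fun x => \sum_i f i x) = \sum_i intg (f i).
Proof.
move=> cf; suff H (u : seq 'I_n) : ccont r (fun x => \sum_(i <- u) f i x) /\
    intg (fun x => \sum_(i <- u) f i x) = \sum_(i <- u) intg (f i) by exact: H.
elim: u => [|i u [IH1 IH2]].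
  have E0 : (fun x : E => \sum_(j <- [::]) f j x) = (fun x => 0 * 0).
    by apply/funext => x; rewrite big_nil mul0r.
  have c0 : ccont r (fun _ : E => 0 : R) by split=> // x; exact: cvg_cst.
  by rewrite E0; split; [exact: ccontZ c0|rewrite (intgZ _ c0) mul0r big_nil].
have E1 : (fun x : E => \sum_(j <- i :: u) f j x) =
    (fun x => f i x + \sum_(j <- u) f j x).
  by apply/funext => x; rewrite big_cons.
rewrite E1 /= big_cons -IH2; split; first exact: ccontD.
exact: intgD (cf i) IH1.
Qed.

Lemma xcorrZl r r' f g a v : ccont r f -> ccont r' g ->
  xcorr (fun x => a * f x) g v = a * xcorr f g v.
Proof.
move=> cf cg; rewrite /xcorr -(intgZ _ (ccont_xcorr v cf cg)).
by congr intg; apply/funext => x; rewrite mulrA.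
Qed.

Lemma xcorr_suml n r r' (f : 'I_n -> E -> R) g v : (forall i, ccont r (f i)) -> ccont r' g ->
  xcorr (fun x => \sum_i f i x) g v = \sum_i xcorr (f i) g v.
Proof.
move=> cf cg; rewrite /xcorr -(ccont_sum (fun i => ccont_xcorr v (cf i) cg)).2.
by congr intg; apply/funext => x; rewrite mulr_suml.
Qed.

Lemma xcorr_le r r' f g (M : R) v : ccont r f -> ccont r' g -> (forall x, `|f x| <= M) ->
  `|xcorr f g v| <= M * intg (fun x => `|g x|).
Proof.
move=> cf cg fM; have cfg := ccont_xcorr v cf cg.
apply: le_trans (le_norm_intg cfg) _; rewrite -(intgZ _ (ccont_norm cg)).
apply: (le_intg (ccont_norm cfg) (ccontZ _ (ccont_norm cg))) => x.
by rewrite normrM ler_wpM2r.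
Qed.

Lemma xcorr_le1 r f g v : ccont r f -> ccont r g ->
  intg (fun x => f x ^+ 2) <= 1 -> intg (fun x => g x ^+ 2) <= 1 -> `|xcorr f g v| <= 1.
Proof.
move=> cf cg f1 g1; have cfg := ccont_xcorr v cf cg.
have cf2 : ccont r (fun x => f x ^+ 2) := ccontM cf cf.
have cg2 : ccont r (fun x => g x ^+ 2) := ccontM cg cg.
have sh := ccont_shift v cf2.
have rv : r <= r + `|v| by rewrite lerDl.
have cg2' := ccont_le rv cg2.
have h1 : intg (fun x => 2^-1 * (f (x + v) ^+ 2 + g x ^+ 2)) <= 1.
  rewrite (intgZ _ (ccontD sh cg2')) (intgD sh cg2') (intg_shift v cf2) ler_pdivrMl // mulr1.
  exact: lerD.
apply: le_trans h1; apply: le_trans (le_norm_intg cfg) _.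
apply: (le_intg (ccont_norm cfg) (ccontZ _ (ccontD sh cg2'))) => x.
rewrite normrM ler_pdivlMl // -(real_normK (num_real (f _))) -(real_normK (num_real (g x))).
by have := sqr_ge0 (`|f (x + v)| - `|g x|); move: `|f _| `|g x| => a b; nra.
Qed.

Lemma xcorrE f g v : xcorr f g v = intg (fun x => f (x + v) * g x).
Proof. by []. Qed.

#[local] Opaque partial intg xcorr.

Lemma curl_diff_xcorr r r' Psi g j i v : (forall i, ctest r (Psi i)) -> ccont r' g ->
  exists k, exists2 c : R, `|c| <= 1 &
    xcorr (fun x => partial j (Psi i) x - partial i (Psi j) x) g v = c * xcorr (curlr Psi k) g v.
Proof.
move=> tP cg; have [k [c c1 cE]] := curl_diff Psi j i; exists k, c => //.
rewrite -(xcorrZl _ _ (ctest_ccont (ctest_curlr k tP)) cg).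
by congr (xcorr _ g v); apply/funext.
Qed.

Lemma xcorr_curl_diff_le r r' Psi g j i v (M : R) : (forall i, ctest r (Psi i)) -> ccont r' g ->
  (forall k, `|xcorr (curlr Psi k) g v| <= M) ->
  `|xcorr (fun x => partial j (Psi i) x - partial i (Psi j) x) g v| <= M.
Proof.
move=> tP cg hM; have [k [c c1 ->]] := curl_diff_xcorr j i v tP cg.
by rewrite normrM; apply: le_trans (hM k); rewrite ler_piMl.
Qed.

Definition pairing Psi Phi v : R := \sum_i xcorr (Psi i) (curlr Phi i) v.

(** The derivative of [pairing] along axis [j]; subtracting the gradient of [Psi j] does not change
    it, by [grad_curl_orth]. *)
Definition dpairing Psi Phi j v : R :=
  \sum_i xcorr (fun x => partial j (Psi i) x - partial i (Psi j) x) (curlr Phi i) v.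

Section pairing.
Variables (r : R) (Psi Phi : 'I_3 -> E -> R).
Hypothesis tPsi : forall i, ctest r (Psi i).
Hypothesis tPhi : forall i, ctest r (Phi i).
Let tG i := ctest_curlr i tPhi.
Let cG i := ctest_ccont (tG i).
Let tQ j i : ctest r (fun x => partial j (Psi i) x - partial i (Psi j) x) :=
  ctestB (ctest_partial j (tPsi i)) (ctest_partial i (tPsi j)).

Lemma pairing_quad j : exists2 K, 0 <= K & forall v s,
  `|pairing Psi Phi (v + s *: e3 R j) - pairing Psi Phi v - s * dpairing Psi Phi j v| <= K * s ^+ 2.
Proof.
have /fin_all_exists2[K K0 hK] i := xcorr_quad j (tPsi i) (cG i).
exists (\sum_i K i) => [|v s]; first exact: sumr_ge0.
have -> : dpairing Psi Phi j v = \sum_i xcorr (partial j (Psi i)) (curlr Phi i) v.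
  have D i : xcorr (fun x => partial j (Psi i) x - partial i (Psi j) x) (curlr Phi i) v =
     xcorr (partial j (Psi i)) (curlr Phi i) v - xcorr (partial i (Psi j)) (curlr Phi i) v.
    exact: (xcorrBl v (ctest_ccont (ctest_partial j (tPsi i)))
      (ctest_ccont (ctest_partial i (tPsi j))) (cG i)).
  rewrite /dpairing (eq_bigr _ (fun i _ => D i)) sumrB.
  apply: etrans (subr0 _); congr (_ - _); exact: (grad_curl_orth v (tPsi j) tPhi).
rewrite /pairing mulr_sumr -!sumrB mulr_suml; apply: le_trans (ler_norm_sum _ _ _) _.
by apply: ler_sum => i _; exact: hK.
Qed.

Lemma dpairing_le (M : R) j v : (forall k i, `|xcorr (curlr Psi k) (curlr Phi i) v| <= M) ->
  `|dpairing Psi Phi j v| <= 3 * M.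
Proof.
move=> hM; apply: le_trans (ler_norm_sum _ _ _) _.
rewrite (_ : 3 * M = \sum_(i < 3) M); last by rewrite sumr_const card_ord mulr_natl.
by apply: ler_sum => i _; exact: (xcorr_curl_diff_le j i tPsi (cG i) (fun k => hM k i)).
Qed.

Hypothesis Psi1 : forall k, intg (fun x => curlr Psi k x ^+ 2) <= 1.
Hypothesis Phi1 : forall k, intg (fun x => curlr Phi k x ^+ 2) <= 1.

(** 9 is 3 axes times 3 components, since every correlation of components of the two curls is at
    most 1. *)
Lemma pairing_lipschitz v w :
  `|pairing Psi Phi (v + w) - pairing Psi Phi v| <= 9 * `|w|.
Proof.
have -> : 9 = 3 * 3 :> R by rewrite -natrM.
apply: axis_lipschitz => {v w} x j s; have [K K0 hK] := pairing_quad j.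
have := @quad_lipschitz R (fun t => pairing Psi Phi (x + t *: e3 R j))
  (fun t => dpairing Psi Phi j (x + t *: e3 R j)) K 3 _ _ 0 s.
rewrite scale0r addr0 subr0; apply=> [t u|t].
  by rewrite scalerDl addrA; exact: hK.
have := @dpairing_le 1 j (x + t *: e3 R j); rewrite mulr1; apply=> k i.
exact: (xcorr_le1 _ (ctest_ccont (ctest_curlr k tPsi)) (cG i)).
Qed.

Lemma pairing_ccont : ccont (r + r) (pairing Psi Phi).
Proof.
exact: (ccont_sum (fun i => ctest_xcorr_ccont (tPsi i) (cG i))).1.
Qed.

Lemma dpairing_ccont j : ccont (r + r) (dpairing Psi Phi j).
Proof.
exact: (ccont_sum (fun i => ctest_xcorr_ccont (tQ j i) (cG i))).1.
Qed.

(* The pairing at 0 is compared with its average against the tent function,    *)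
(* and this average is transported along the first axis until the supports are *)
(* disjoint.                                                                   *)
Lemma pairing_bound h (S : R) : 0 <= r -> 0 < h ->
  (forall k z, `|xcorr (curlr Psi k) (tent h) z| <= S) ->
  `|pairing Psi Phi 0| <=
    9 * h + 3 * (r + r + h + 1) * ((intg (tent (r + 1) : E -> R) + 1) / 2) / intg (tent h : E -> R) * S.
Proof.
move=> r0 h0 hS.
set A := (_ + 1) / 2; set c := intg (tent h : E -> R); set L := r + r + h + 1.
have c0 : 0 < c := intg_tent_gt0 h0.
have S0 : 0 <= S by apply: le_trans (hS 0 0).
have ct := tent_ccont h : ccont h (tent h : E -> R).
pose J t := xcorr (pairing Psi Phi) (tent h) (t *: e3 R 0).
(* On the support of the tent [|x| <= h], and there the pairing differs from its value at 0 by at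
   most [9 * h]. *)
have J0 : `|J 0 - pairing Psi Phi 0 * c| <= 9 * h * c.
  have cM := ccont_xcorr 0 pairing_ccont ct.
  rewrite /J scale0r /c -(intgZ _ ct) -(intgB cM (ccontZ (pairing Psi Phi 0) ct)) -(intgZ _ ct).
  have cB := ccontB cM (ccontZ (pairing Psi Phi 0) ct).
  apply: le_trans (le_norm_intg cB) _; apply: (le_intg (ccont_norm cB) (ccontZ (9 * h) ct)) => x.
  rewrite addr0 -mulrBl normrM (ger0_norm (tent_ge0 h x)).
  have [xh|xh] := leP `|x| h; last by rewrite ct.2 // !mulr0.
  rewrite ler_wpM2r ?tent_ge0 //; have := pairing_lipschitz 0 x; rewrite add0r => /le_trans; apply.
  by rewrite ler_wpM2l.
have [K K0 hK] := pairing_quad 0.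
have rh : r <= r + h by rewrite lerDl ltW.
have hr : h <= r + h by rewrite lerDr.
have dJ t : `|xcorr (dpairing Psi Phi 0) (tent h) (t *: e3 R 0)| <= 3 * (S * A).
  rewrite (xcorr_suml _ (fun i => ctest_xcorr_ccont (tQ 0 i) (cG i)) ct).
  apply: le_trans (ler_norm_sum _ _ _) _.
  rewrite (_ : 3 * _ = \sum_(i < 3) (S * A)); last by rewrite sumr_const card_ord mulr_natl.
  apply: ler_sum => i _.
  (* Fubini moves the tent onto the factor made of components of [curlr Psi], where [hS] applies;
     [A] bounds the L_1 norm of [curlr Phi i]. *)
  rewrite (xcorr_xcorr _ (ccont_le rh (ctest_ccont (tQ 0 i))) (ccont_le rh (cG i)) (ccont_le hr ct)).
  have cX := ctest_xcorr_ccont (tQ 0 i) ct.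
  apply: le_trans (xcorr_le _ cX (cG i) _) (ler_wpM2l S0 (intg_norm_le (cG i) (Phi1 i))) => z.
  exact: (xcorr_curl_diff_le 0 i tPsi ct (fun k => hS k z)).
have JL : `|J L - J 0| <= 3 * (S * A) * `|L - 0|.
  apply: (@quad_lipschitz R J (fun t => xcorr (dpairing Psi Phi 0) (tent h) (t *: e3 R 0))
    (K * intg (fun x : E => `|tent h x|)) _ _ dJ) => t s.
  have cM z := ccont_xcorr z pairing_ccont ct.
  have cD := ccont_xcorr (t *: e3 R 0) (dpairing_ccont 0) ct.
  have ch := ccont_norm ct.
  rewrite mulrAC -(intgZ _ ch).
  have cB := ccontB (ccontB (cM ((t + s) *: e3 R 0)) (cM (t *: e3 R 0))) (ccontZ s cD).
  have -> : J (t + s) - J t - s * xcorr (dpairing Psi Phi 0) (tent h) (t *: e3 R 0) =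
      intg (fun x => pairing Psi Phi (x + (t + s) *: e3 R 0) * tent h x -
        pairing Psi Phi (x + t *: e3 R 0) * tent h x -
        s * (dpairing Psi Phi 0 (x + t *: e3 R 0) * tent h x)).
    rewrite (intgB (ccontB (cM ((t + s) *: e3 R 0)) (cM (t *: e3 R 0))) (ccontZ s cD)).
    by rewrite (intgB (cM ((t + s) *: e3 R 0)) (cM (t *: e3 R 0))) (intgZ _ cD).
  apply: le_trans (le_norm_intg cB) _; apply: (le_intg (ccont_norm cB) (ccontZ _ ch)) => x.
  by rewrite mulrA -!mulrBl normrM ler_wpM2r // scalerDl addrA; exact: hK.
have L0 : 0 <= L by rewrite /L !addr_ge0 // ltW.
(* [L] exceeds [r + r + h], the sum of the radii of the two supports. *)
have JL0 : J L = 0.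
  apply: (xcorr_supp pairing_ccont ct); apply: lt_le_trans (le_coord3 _ 0).
  have -> : coord3 (L *: e3 R 0) 0 = L by rewrite /coord3 eqxx; exact: mulr1.
  by rewrite ger0_norm // /L ltrDl.
move: JL J0; rewrite JL0 sub0r normrN subr0 (ger0_norm L0) => JL J0.
rewrite -(ler_pM2r c0) mulrDl; apply: le_trans (_ : 9 * h * c + 3 * (S * A) * L <= _); last first.
  by rewrite lerD2l le_eqVlt; apply/orP; left; apply/eqP; field; rewrite lt0r_neq0.
rewrite -{1}(gtr0_norm c0) -normrM.
move: J0 JL; move: (J 0) (pairing Psi Phi 0 * c) => a b h1 h2.
rewrite -[b](subKr a); apply: le_trans (ler_normB _ _) _.
by rewrite addrC; exact: lerD.
Qed.
End pairing.

(** The tent is 1-Lipschitz and the L_1 norm of [q] is at most [A], so the correlation is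
    [A]-Lipschitz in the shift. It vanishes off the box of radius [r + h], and a net of mesh [e / A]
    in this box serves all [q] at once. *)
Lemma xcorr_net r h (e : R) : 0 < e -> exists zs : seq E, forall q, ccont r q ->
  intg (fun x => q x ^+ 2) <= 1 -> forall y,
  `|xcorr q (tent h) y| <= e + \sum_(z <- zs) `|xcorr q (tent h) z|.
Proof.
move=> e0; have ct := tent_ccont h : ccont h (tent h : E -> R).
set A := (intg (tent (r + 1) : E -> R) + 1) / 2.
have A0 : 0 < A.
  by rewrite divr_gt0 // ltr_wpDl // intg_ge0 // => x; exact: tent_ge0.
have [zs net] := box_net (r + h) (divr_gt0 e0 A0); exists zs => q cq q1 y.
have s0 : 0 <= \sum_(z <- zs) `|xcorr q (tent h) z| by exact: sumr_ge0.
have [yr|yr] := leP `|y| (r + h); last first.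
  by rewrite (xcorr_supp cq ct yr) normr0 addr_ge0 // ltW.
have [z zzs yz] := net y yr.
apply: le_trans (_ : e + `|xcorr q (tent h) z| <= _); last first.
  rewrite lerD2l (big_rem z) //= lerDl; exact: sumr_ge0.
rewrite -lerBlDr; apply: le_trans (lerB_dist _ _) _.
rewrite !(xcorrC _ cq ct) -[- y](subrK (- z)) [_ - _ - _]addrC.
apply: le_trans (xcorr_lipschitz ct cq (@tent_lipschitz R h) (- z) _) _.
rewrite mul1r -[leRHS](divfK (lt0r_neq0 A0)) ler_pM //.
- by apply: intg_ge0.
- by rewrite opprK addrC distrC ltW.
- exact: intg_norm_le cq q1.
Qed.

Theorem real_curl_estimate r (e : R) : 0 <= r -> 0 < e -> exists ks : seq (E -> R),
  (forall k, k \in ks -> exists r', ccont r' k) /\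
  forall Psi Phi, (forall i, ctest r (Psi i)) -> (forall i, ctest r (Phi i)) ->
  (forall i, intg (fun x => curlr Psi i x ^+ 2) <= 1) ->
  (forall i, intg (fun x => curlr Phi i x ^+ 2) <= 1) ->
  `|\sum_i intg (fun x => Psi i x * curlr Phi i x)| <=
    e + \sum_(k <- ks) \sum_i `|intg (fun x => curlr Psi i x * k x)|.
Proof.
(* With this [h] the averaging error [9 * h] is half of [e]. *)
move=> r0 e0; pose h := e / 18.
have h0 : 0 < h by rewrite divr_gt0.
have ct := tent_ccont h : ccont h (tent h : E -> R).
pose D := 3 * (r + r + h + 1) * ((intg (tent (r + 1) : E -> R) + 1) / 2) / intg (tent h : E -> R).
have D0 : 0 <= D.
  rewrite /D !mulr_ge0 ?invr_ge0 ?(ltW (intg_tent_gt0 h0)) // ?addr_ge0 ?(ltW h0) //.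
  by apply: intg_ge0 => x; exact: tent_ge0.
(* The error of the net is multiplied by [D] and still stays below [e / 2]; [D + 1] keeps the
   divisor positive. *)
have d0 : 0 < e / (2 * (D + 1)) by rewrite divr_gt0 // mulr_gt0 // ltr_wpDl.
have [zs net] := xcorr_net r h d0.
(* Correlating with the tent at shift [z] is integrating against the tent centred at [z]; the factor
   [D] is put into the kernel. *)
exists [seq (fun x => D * tent h (x - z)) | z <- zs]; split.
  move=> _ /mapP[z _ ->]; exists (h + `|- z|).
  exact: (ccontZ D (ccont_shift (- z) ct)).
move=> Psi Phi tPsi tPhi Psi1 Phi1.
pose S := e / (2 * (D + 1)) + \sum_(z <- zs) \sum_i `|xcorr (curlr Psi i) (tent h) z|.
have cP i := ctest_ccont (ctest_curlr i tPsi).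
have hS k y : `|xcorr (curlr Psi k) (tent h) y| <= S.
  apply: le_trans (net _ (cP k) (Psi1 k) y) _; rewrite lerD2l ler_sum // => z _.
  rewrite (bigD1 k) //= lerDl; exact: sumr_ge0.
have := pairing_bound tPsi tPhi Psi1 Phi1 r0 h0 hS; rewrite -/D.
have -> : pairing Psi Phi 0 = \sum_i intg (fun x => Psi i x * curlr Phi i x).
  apply: eq_bigr => i _; rewrite xcorrE; congr intg.
  by apply/funext => x; rewrite addr0.
move=> /le_trans; apply.
have -> : \sum_(k <- [seq (fun x => D * tent h (x - z)) | z <- zs]) \sum_i
    `|intg (fun x => curlr Psi i x * k x)| =
    D * \sum_(z <- zs) \sum_i `|xcorr (curlr Psi i) (tent h) z|.
  rewrite big_map mulr_sumr; apply: eq_bigr => z _; rewrite mulr_sumr; apply: eq_bigr => i _.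
  rewrite (xcorrC _ (cP i) ct) xcorrE -{2}(ger0_norm D0) -normrM.
  rewrite -(intgZ _ (ccont_xcorr (- z) ct (cP i))); congr (`|intg _|).
  by apply/funext => x; rewrite mulrCA [curlr _ _ _ * _]mulrC.
rewrite mulrDr addrA lerD2r.
have -> : 9 * h = e / 2 by rewrite /h; field.
rewrite [leRHS]splitr lerD2l mulrA ler_pdivrMr ?mulr_gt0 // ?ltr_wpDl //.
have -> : e / 2 * (2 * (D + 1)) = D * e + e by field.
by rewrite lerDl ltW.
Qed.

End curl_estimate.

(** * The curl operator *)

Section L2_pairing.
Context d (T : measurableType d) (R : realType).
Variable mu : {measure set T -> \bar R}.
Variable n : nat.
Implicit Types f g : L2fun mu n.

Lemma Lfun2_mul_integrable (u v : T -> R) : u \in Lfun mu 2%:E -> v \in Lfun mu 2%:E ->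
  mu.-integrable setT (EFin \o (fun x => u x * v x)).
Proof. by move=> uL vL; apply/Lfun1_integrable; exact: Lfun2_mul_Lfun1. Qed.

Lemma dotfE f g : dotf mu f g = Complex
  (\sum_j \int[mu]_x (Re (f x 0 j) * Re (g x 0 j)) +
   \sum_j \int[mu]_x (Im (f x 0 j) * Im (g x 0 j)))
  (\sum_j \int[mu]_x (Im (f x 0 j) * Re (g x 0 j)) -
   \sum_j \int[mu]_x (Re (f x 0 j) * Im (g x 0 j))).
Proof.
have rf j := Re_Lfun2 f j; have jf j := Im_Lfun2 f j.
have rg j := Re_Lfun2 g j; have jg j := Im_Lfun2 g j.
rewrite /dotf /cintegral -big_split -sumrB; congr Complex.
- transitivity (\int[mu]_x \sum_j
      (Re (f x 0 j) * Re (g x 0 j) + Im (f x 0 j) * Im (g x 0 j))).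
    apply: eq_Rintegral => x _; rewrite /hdot raddf_sum /=; apply: eq_bigr => j _.
    by case: (f x 0 j) (g x 0 j) => a b [u v] /=; rewrite mulrN opprK.
  rewrite Rintegral_sum => [|j].
    by apply: eq_bigr => j _; rewrite RintegralD // ; exact: Lfun2_mul_integrable.
  exact: (integrableD measurableT (Lfun2_mul_integrable (rf j) (rg j))
    (Lfun2_mul_integrable (jf j) (jg j))).
- transitivity (\int[mu]_x \sum_j
      (Im (f x 0 j) * Re (g x 0 j) - Re (f x 0 j) * Im (g x 0 j))).
    apply: eq_Rintegral => x _; rewrite /hdot raddf_sum /=; apply: eq_bigr => j _.
    by case: (f x 0 j) (g x 0 j) => a b [u v] /=; rewrite mulrN addrC.
  rewrite Rintegral_sum => [|j].
    by apply: eq_bigr => j _; rewrite RintegralB // ; exact: Lfun2_mul_integrable.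
  exact: (integrableB measurableT (Lfun2_mul_integrable (jf j) (rg j))
    (Lfun2_mul_integrable (rf j) (jg j))).
Qed.

End L2_pairing.

(** * Complex test fields *)

Section test_fields.
Variable R : realType.
Local Notation E := (R * R * R)%type.
Implicit Types (Omega : set E) (g : E -> R[i]) (Psi Phi : E -> 'rV[R[i]]_3).

(** The exact support is traded for any compact subset of [Omega] off which [g] vanishes, which
    makes sums and derivatives easy to handle. *)
Lemma test_functionP Omega g : test_function Omega g <->
  [/\ smooth (Re \o g), smooth (Im \o g) &
    exists2 K, compact K /\ K `<=` Omega & forall x, ~ K x -> g x = 0].
Proof.
split=> [[sr si cs sO]|[sr si [K [cK KO] g0]]].
  split => //; exists (closure [set x | g x != 0]) => // x; apply: contra_notP => /eqP gx.
  exact: subset_closure.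
have clK : closed K by apply: compact_closed => //; exact: norm_hausdorff.
have sK : closure [set x | g x != 0] `<=` K.
  rewrite (_ : K = closure K); last exact/closure_id.
  by apply: closure_subset => x /=; apply: contra_neqP => /g0.
split => //; first by apply: (subclosed_compact _ cK sK); exact: closed_closure.
exact: subset_trans KO.
Qed.

Lemma test_function_comb Omega (a : R[i]) f g : test_function Omega f ->
  test_function Omega g -> test_function Omega (fun x => a * f x + g x).
Proof.
move=> /test_functionP[rf jf [K [cK KO] f0]] /test_functionP[rg jg [L [cL LO] g0]].
apply/test_functionP; split.
- have -> : Re \o (fun x => a * f x + g x) =
      fun x => Re a * (Re \o f) x + (- Im a * (Im \o f) x + (Re \o g) x).
    apply/funext => x /=; case: a (f x) (g x) => a b [c d] [e e'] /=.
    by rewrite mulNr addrA.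
  exact: (smooth_comb _ rf (smooth_comb _ jf rg).1).1.
- have -> : Im \o (fun x => a * f x + g x) =
      fun x => Re a * (Im \o f) x + (Im a * (Re \o f) x + (Im \o g) x).
    by apply/funext => x /=; case: a (f x) (g x) => a b [c d] [e e'] /=; rewrite addrA.
  exact: (smooth_comb _ jf (smooth_comb _ rf jg).1).1.
exists (K `|` L); first by split; [exact: compactU|rewrite subUset].
by move=> x /not_orP[/f0 -> /g0 ->]; rewrite mulr0 addr0.
Qed.

Lemma test_function_cpartial Omega g j : test_function Omega g ->
  test_function Omega (cpartial j g).
Proof.
move=> /test_functionP[rg jg [K [cK KO] g0]]; apply/test_functionP; split.
- exact: smooth_partial rg.
- exact: smooth_partial jg.
exists K => // x Kx; have oK : open (~` K).
  by apply: closed_openC; apply: compact_closed => //; exact: norm_hausdorff.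
have nx : \forall y \near x, (~` K) y by exact: open_nbhs_nbhs.
by rewrite /cpartial !partial_near0 //; apply: filterS nx => y /g0 /= ->.
Qed.

Lemma test_field_comb Omega (a : R[i]) Psi Phi : test_field Omega Psi ->
  test_field Omega Phi -> test_field Omega (fun x => a *: Psi x + Phi x).
Proof.
move=> tP tF j; rewrite (_ : (fun x => _) = fun x => a * Psi x 0 j + Phi x 0 j).
  exact: test_function_comb.
by apply/funext => x; rewrite !mxE.
Qed.

Lemma test_field_curl Omega Psi : test_field Omega Psi -> test_field Omega (curl_field Psi).
Proof.
move=> tP j; rewrite (_ : (fun x => _) =
    fun x => - 1 * cpartial (j + 2) (fun y => Psi y 0 (j + 1)) x +
      cpartial (j + 1) (fun y => Psi y 0 (j + 2)) x).
  by apply: test_function_comb; exact: test_function_cpartial.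
by apply/funext => x; rewrite !mxE mulN1r addrC.
Qed.

Definition Re_field Psi i (x : E) : R := Re (Psi x 0 i).
Definition Im_field Psi i (x : E) : R := Im (Psi x 0 i).

Lemma Re_curl_field Psi : Re_field (curl_field Psi) = curlr (Re_field Psi).
Proof. by apply/funext => i; apply/funext => x; rewrite /Re_field mxE raddfB. Qed.

Lemma Im_curl_field Psi : Im_field (curl_field Psi) = curlr (Im_field Psi).
Proof. by apply/funext => i; apply/funext => x; rewrite /Im_field mxE raddfB. Qed.

Lemma curl_field_comb (a : R[i]) Psi Phi Omega : test_field Omega Psi -> test_field Omega Phi ->
  curl_field (fun x => a *: Psi x + Phi x) =
  (fun x => a *: curl_field Psi x + curl_field Phi x).
Proof.
move=> tP tF.
have D j k x : cpartial j (fun y => (a *: Psi y + Phi y) 0 k) x =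
    a * cpartial j (fun y => Psi y 0 k) x + cpartial j (fun y => Phi y 0 k) x.
  have /test_functionP[rf jf _] := tP k; have /test_functionP[rg jg _] := tF k.
  rewrite /cpartial.
  have -> : Re \o (fun y => (a *: Psi y + Phi y) 0 k) = fun y =>
      Re a * (Re \o (fun y => Psi y 0 k)) y + (- Im a * (Im \o (fun y => Psi y 0 k)) y +
      (Re \o (fun y => Phi y 0 k)) y).
    apply/funext => y /=; rewrite !mxE; case: a (Psi y 0 k) (Phi y 0 k) => a b [c d] [e e'] /=.
    by rewrite mulNr addrA.
  have -> : Im \o (fun y => (a *: Psi y + Phi y) 0 k) = fun y =>
      Re a * (Im \o (fun y => Psi y 0 k)) y + (Im a * (Re \o (fun y => Psi y 0 k)) y +
      (Im \o (fun y => Phi y 0 k)) y).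
    apply/funext => y /=; rewrite !mxE; case: a (Psi y 0 k) (Phi y 0 k) => a b [c d] [e e'] /=.
    by rewrite addrA.
  rewrite (smooth_comb _ rf (smooth_comb _ jf rg).1).2 (smooth_comb _ jf rg).2.
  rewrite (smooth_comb _ jf (smooth_comb _ rf jg).1).2 (smooth_comb _ rf jg).2.
  by case: a => a b; rewrite mulNr !addrA.
apply/funext => x; apply/rowP => j; rewrite !mxE !D.
by rewrite opprD addrACA mulrBr.
Qed.

End test_fields.

(** * The operator on test fields in L_2 *)

Section curl_operator.
Variable R : realType.
Local Notation E := (R * R * R)%type.
Local Notation mR := (measurableTypeR R).
Variables (Omega : set E) (oOmega : open Omega).
Implicit Types (f : E -> R) (g : E -> R[i]).
Local Notation on := (lebesgue_on oOmega).
Local Open Scope quotient_scope.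

Let mO := open_measurable3 oOmega.

(** This links [L2Omega], where the measure is restricted, to the calculus on the whole space. *)
Lemma integral_lebesgue_on (F : E -> \bar R) : (forall x, ~ Omega x -> F x = 0%E) ->
  (\int[on]_x F x = \int[@lebesgue3 R]_x F x)%E.
Proof.
move=> F0; have E0 : F = F \_ Omega.
  by apply/funext => x; rewrite patchE; case: ifPn => // /negP/[!inE]/F0.
rewrite E0 -!integral_mkcond; apply: eq_measure_integral => A mA AO.
by rewrite -[LHS]/(lebesgue3 (A `&` Omega)) setIidl.
Qed.

Lemma Rintegral_lebesgue_on f : (forall x, ~ Omega x -> f x = 0) -> \int[on]_x f x = intg f.
Proof.
by move=> f0; rewrite /intg /Rintegral integral_lebesgue_on // => x Ox; rewrite f0.
Qed.

Lemma Lfun2_lebesgue_on f : measurable_fun setT (f : mR * mR * mR -> mR) ->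
  (forall x, ~ Omega x -> f x = 0) ->
  (@lebesgue3 R).-integrable setT (EFin \o (fun x => f x ^+ 2)) -> f \in Lfun on 2%:E.
Proof.
move=> mf f0 /integrableP[m2 i2]; apply/Lfun2P; split; first exact: mf.
apply/integrableP; split; first exact: m2.
by rewrite integral_lebesgue_on // => x Ox; rewrite /= f0 // expr0n /= normr0.
Qed.

Lemma ctest_Lfun2 r f : ctest r f -> (forall x, ~ Omega x -> f x = 0) -> f \in Lfun on 2%:E.
Proof.
move=> tf f0; have cf := ctest_ccont tf.
apply: Lfun2_lebesgue_on => //; first by apply: continuous_measurable3; case: cf.
exact: (ccont_integrable (ccontM cf cf)).
Qed.

Lemma ccont_patch_Lfun2 r f : ccont r f -> f \_ Omega \in Lfun on 2%:E.
Proof.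
move=> cf; apply: Lfun2_lebesgue_on.
- apply/(measurable_restrictT _ mO); apply: measurable_funTS.
  by apply: continuous_measurable3; case: cf.
- by move=> x Ox; rewrite patchE; case: ifPn => //; rewrite inE.
- rewrite (_ : _ \o _ = (EFin \o (fun x => f x * f x)) \_ Omega).
    apply/(integrable_mkcond _ mO); apply: (@integrableS _ _ _ _ setT) => //.
    exact: (ccont_integrable (ccontM cf cf)).
  by apply/funext => x /=; rewrite !patchE; case: ifPn => //; rewrite expr0n.
Qed.

Section bounded_domain.
Variable r : R.
Hypothesis Or : forall x, Omega x -> `|x| <= r.

Lemma test_field_out Psi i x : test_field Omega Psi -> ~ Omega x ->
  Re_field Psi i x = 0 /\ Im_field Psi i x = 0.
Proof.
move=> tP Ox; have /test_functionP[_ _ [K [_ KO] g0]] := tP i.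
by rewrite /Re_field /Im_field g0 // => /KO.
Qed.

Lemma test_field_ctest Psi : test_field Omega Psi ->
  (forall i, ctest r (Re_field Psi i)) /\ (forall i, ctest r (Im_field Psi i)).
Proof.
move=> tP; split=> i; have /test_functionP[rg jg _] := tP i.
  split=> // x rx; have [|e _] := @test_field_out Psi i x tP _.
    by move=> /Or; rewrite leNgt rx.
  exact: e.
split=> // x rx; have [|_ e] := @test_field_out Psi i x tP _.
  by move=> /Or; rewrite leNgt rx.
exact: e.
Qed.

Lemma test_field_square_integrable Psi : test_field Omega Psi ->
  (Psi : mR * mR * mR -> _) \in @square_integrable _ _ R on 3.
Proof.
move=> tP; have [rP jP] := test_field_ctest tP; apply/asboolP => j; split.
  by apply: ctest_Lfun2 (rP j) _ => x /(test_field_out j tP)[].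
by apply: ctest_Lfun2 (jP j) _ => x /(test_field_out j tP)[].
Qed.

(** The L_2 vector that represents integration of the [i]-th component against [f]. Cutting [f] to
    [Omega] leaves its pairing with fields vanishing off [Omega] unchanged. *)
Definition cutoff_field f i (x : E) : 'rV[R[i]]_3 :=
  \row_j if j == i then ((f \_ Omega) x)%:C%C else 0.

Lemma cutoff_field_square_integrable r' f i : ccont r' f ->
  (cutoff_field f i : mR * mR * mR -> _) \in @square_integrable _ _ R on 3.
Proof.
move=> cf; have z0 : (fun=> 0 : R) \in Lfun on 2%:E.
  apply: Lfun2_lebesgue_on => //.
  rewrite (_ : _ \o _ = cst 0%E); first exact: integrable0.
  by apply/funext => x /=; rewrite expr0n.
apply/asboolP => j; split; case: (eqVneq j i) => ji.
- rewrite (_ : (fun x => _) = f \_ Omega); first exact: ccont_patch_Lfun2 cf.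
  by apply/funext => x; rewrite mxE ji eqxx.
- by rewrite (_ : (fun x => _) = fun=> 0) //; apply/funext => x; rewrite mxE (negbTE ji).
- by rewrite (_ : (fun x => _) = fun=> 0) //; apply/funext => x; rewrite mxE ji eqxx.
- by rewrite (_ : (fun x => _) = fun=> 0) //; apply/funext => x; rewrite mxE (negbTE ji).
Qed.

Definition real_pairing (F G : 'I_3 -> E -> R) : R := \sum_j intg (fun x => F j x * G j x).

(** One factor vanishing off [Omega] suffices to integrate over the whole space, so [g] is
    arbitrary. The complex product splits into four real pairings, the form in which the curl
    estimate is stated. *)
Lemma inner_test_field (f g : L2fun on 3) : test_field Omega f ->
  inner (\pi_(L2 on 3) f : L2Omega oOmega) (\pi_(L2 on 3) g) = Complex
    (real_pairing (Re_field f) (Re_field g) + real_pairing (Im_field f) (Im_field g))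
    (real_pairing (Im_field f) (Re_field g) - real_pairing (Re_field f) (Im_field g)).
Proof.
move=> tf.
have -> : inner (\pi_(L2 on 3) f : L2Omega oOmega) (\pi_(L2 on 3) g) = dotf on f g.
  exact: L2dotE.
have I (u v : E -> R) : (forall x, ~ Omega x -> u x = 0) ->
    \int[on]_x (u x * v x) = intg (fun x => u x * v x).
  by move=> u0; apply: Rintegral_lebesgue_on => x /u0 ->; rewrite mul0r.
have IR j v := @I (Re_field f j) v (fun x Ox => (test_field_out j tf Ox).1).
have II j v := @I (Im_field f j) v (fun x Ox => (test_field_out j tf Ox).2).
have A : \sum_j \int[on]_x (Re (f x 0 j) * Re (g x 0 j)) =
    real_pairing (Re_field f) (Re_field g) := eq_bigr _ (fun j _ => IR j (Re_field g j)).
have B : \sum_j \int[on]_x (Im (f x 0 j) * Im (g x 0 j)) =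
    real_pairing (Im_field f) (Im_field g) := eq_bigr _ (fun j _ => II j (Im_field g j)).
have C : \sum_j \int[on]_x (Im (f x 0 j) * Re (g x 0 j)) =
    real_pairing (Im_field f) (Re_field g) := eq_bigr _ (fun j _ => II j (Re_field g j)).
have D : \sum_j \int[on]_x (Re (f x 0 j) * Im (g x 0 j)) =
    real_pairing (Re_field f) (Im_field g) := eq_bigr _ (fun j _ => IR j (Im_field g j)).
exact: (etrans (dotfE f g) (f_equal2 (@Complex R) (f_equal2 +%R A B)
  (f_equal2 (fun a b => a - b) C D))).
Qed.

Lemma curl_c_comb a p q : curl_c oOmega p -> curl_c oOmega q ->
  curl_c oOmega (a *: p.1 + q.1, a *: p.2 + q.2).
Proof.
move=> [Psi [Phi [tP eP ->]]] [Psi' [Phi' [tP' eP' ->]]] /=.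
exists (a *: Psi + Psi'), (a *: Phi + Phi'); split.
- exact: test_field_comb.
- rewrite [RHS](curl_field_comb a tP tP') -eP -eP'.
  by [].
- congr (_, _).
    by rewrite pi_L2D -pi_L2scale.
  by rewrite pi_L2D -pi_L2scale.
Qed.

Lemma curl_c_sym p q : curl_c oOmega p -> curl_c oOmega q ->
  inner p.2 q.1 = inner p.1 q.2.
Proof.
move=> [Psi [Phi [tP eP ->]]] [Psi' [Phi' [tP' eP' ->]]] /=.
have tF : test_field Omega Phi by rewrite eP; exact: test_field_curl.
rewrite !inner_test_field // eP eP' !Re_curl_field !Im_curl_field.
have [rP jP] := test_field_ctest tP; have [rP' jP'] := test_field_ctest tP'.
rewrite /real_pairing; congr Complex; [congr (_ + _)|congr (_ - _)]; exact: (@curlr_sym R r).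
Qed.

Lemma curl_c_ran : op_ran (curl_c oOmega) `<=` op_dom (curl_c oOmega).
Proof.
move=> _ [_ [Psi [Phi [tP eP ->]]] <-] /=.
have tF : test_field Omega Phi by rewrite eP; exact: test_field_curl.
exists (\pi_(L2 on 3) Phi, \pi_(L2 on 3) (L2Fun (test_field_square_integrable (test_field_curl tF)))) => //.
by exists Phi, (L2Fun (test_field_square_integrable (test_field_curl tF))).
Qed.

Lemma curl_c0 : curl_c oOmega (0, 0).
Proof.
have t0 : test_field Omega (fun=> 0).
  move=> j; apply/test_functionP; split.
  - by rewrite (_ : _ \o _ = fun=> 0); [exact: smooth0|apply/funext => x /=; rewrite mxE].
  - by rewrite (_ : _ \o _ = fun=> 0); [exact: smooth0|apply/funext => x /=; rewrite mxE].
  - by exists set0; [split; [exact: compact0|exact: sub0set]|move=> x _; rewrite mxE].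
have t1 := test_field_curl t0.
have c0 : curl_c oOmega (\pi_(L2 on 3) (L2Fun (test_field_square_integrable t0)),
    \pi_(L2 on 3) (L2Fun (test_field_square_integrable t1))).
  by exists (L2Fun (test_field_square_integrable t0)), (L2Fun (test_field_square_integrable t1)).
(* The zero pair is obtained as [- p + p], which avoids computing the classes of the zero field and
   of its curl. *)
by have := curl_c_comb (-1) c0 c0; rewrite /= !scaleN1r !addNr.
Qed.

Lemma test_field_le1 (f : L2fun on 3) : test_field Omega f ->
  hnm (\pi_(L2 on 3) f : L2Omega oOmega) <= 1 -> forall i,
  intg (fun x => Re_field f i x ^+ 2) <= 1 /\ intg (fun x => Im_field f i x ^+ 2) <= 1.
Proof.
move=> tf f1 i.
have h1 : hnm (\pi_(L2 on 3) f : L2Omega oOmega) ^+ 2 <= 1.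
  by rewrite expr_le1 // hnm_ge0.
have hR := le_trans (Re_sqr_le_hnm f i) h1; have hI := le_trans (Im_sqr_le_hnm f i) h1.
split; rewrite -Rintegral_lebesgue_on.
- exact: hR.
- by move=> x Ox; rewrite (test_field_out i tf Ox).1 expr0n.
- exact: hI.
- by move=> x Ox; rewrite (test_field_out i tf Ox).2 expr0n.
Qed.

Lemma real_pairing_cutoff (F : 'I_3 -> E -> R) (k : E -> R) i :
  (forall j x, ~ Omega x -> F j x = 0) ->
  real_pairing F (Re_field (cutoff_field k i)) = intg (fun x => F i x * k x) /\
  real_pairing F (Im_field (cutoff_field k i)) = 0.
Proof.
move=> F0; have i0 : intg (fun _ : E => 0 : R) = 0.
  by rewrite /intg Rintegral_cst // mul0r.
split.
  rewrite /real_pairing (bigD1 i) //= big1 => [|j ji].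
    rewrite addr0; congr intg; apply/funext => x; rewrite /Re_field mxE eqxx patchE.
    by case: ifPn => //= /negP/[!inE]/F0 ->; rewrite !mul0r.
  rewrite -[RHS]i0; congr intg; apply/funext => x.
  by rewrite /Re_field mxE (negbTE ji) mulr0.
rewrite /real_pairing big1 // => j _; rewrite -[RHS]i0; congr intg; apply/funext => x.
by rewrite /Im_field mxE; case: ifP => _; rewrite /= mulr0.
Qed.

(** The cut-off kernel is real, so the two integrals are the real and imaginary parts of a single
    inner product. *)
Lemma cutoff_vector (k : E -> R) i : (exists r', ccont r' k) ->
  exists v : L2Omega oOmega, forall f : L2fun on 3, test_field Omega f ->
  `|intg (fun x => Re_field f i x * k x)| <= cabs (inner (\pi_(L2 on 3) f : L2Omega oOmega) v) /\
  `|intg (fun x => Im_field f i x * k x)| <= cabs (inner (\pi_(L2 on 3) f : L2Omega oOmega) v).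
Proof.
move=> [r' ck]; exists (\pi_(L2 on 3) (L2Fun (cutoff_field_square_integrable i ck))) => f tf.
rewrite (inner_test_field _ tf).
have [-> ->] := @real_pairing_cutoff (Re_field f) k i (fun j x Ox => (test_field_out j tf Ox).1).
have [-> ->] := @real_pairing_cutoff (Im_field f) k i (fun j x Ox => (test_field_out j tf Ox).2).
rewrite addr0 subr0; split; [exact: (ge_Re_cabs (Complex _ _))|exact: (ge_Im_cabs (Complex _ _))].
Qed.

Lemma curl_c_estimate (e : R) : 0 <= r -> 0 < e -> exists ks : seq (L2Omega oOmega),
  forall p q, curl_c oOmega p -> curl_c oOmega q -> hnm p.2 <= 1 -> hnm q.2 <= 1 ->
  cabs (inner p.1 q.2) <= e + \sum_(k <- ks) cabs (inner p.2 k).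
Proof.
move=> r0 e0; have e40 : 0 < e / 4 by rewrite divr_gt0.
have [ks [cks est]] := real_curl_estimate r0 e40.
have /choice[V VP] : forall ki : (E -> R) * 'I_3, exists v : L2Omega oOmega, ki.1 \in ks ->
    forall f : L2fun on 3, test_field Omega f ->
    `|intg (fun x => Re_field f ki.2 x * ki.1 x)| <=
      cabs (inner (\pi_(L2 on 3) f : L2Omega oOmega) v) /\
    `|intg (fun x => Im_field f ki.2 x * ki.1 x)| <=
      cabs (inner (\pi_(L2 on 3) f : L2Omega oOmega) v).
  move=> [k i] /=; case: (boolP (k \in ks)) => [/cks ck|_]; last by exists 0.
  by have [v vP] := cutoff_vector i ck; exists v.
pose vs := [seq V (k, i) | k <- ks, i <- index_enum 'I_3]%SEQ.
(* Each of the four real pairings uses [e / 4] and one copy of the functionals. *)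
exists (vs ++ vs ++ vs ++ vs) => _ _ [Psi [Phi [tP eP ->]]] [Psi' [Phi' [tP' eP' ->]]] /= n1 n1'.
have tF : test_field Omega Phi by rewrite eP; exact: test_field_curl.
have tF' : test_field Omega Phi' by rewrite eP'; exact: test_field_curl.
have [rP jP] := test_field_ctest tP; have [rP' jP'] := test_field_ctest tP'.
have eR : Re_field Phi = curlr (Re_field Psi) by rewrite eP Re_curl_field.
have eI : Im_field Phi = curlr (Im_field Psi) by rewrite eP Im_curl_field.
have eR' : Re_field Phi' = curlr (Re_field Psi') by rewrite eP' Re_curl_field.
have eI' : Im_field Phi' = curlr (Im_field Psi') by rewrite eP' Im_curl_field.
pose S := \sum_(k <- vs) cabs (inner (\pi_(L2 on 3) Phi : L2Omega oOmega) k).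
have SE : S = \sum_(k <- ks) \sum_i cabs (inner (\pi_(L2 on 3) Phi : L2Omega oOmega) (V (k, i))).
  by rewrite /S /vs big_allpairs_dep.
have bR G : (forall i, ctest r (G i)) -> (forall i, intg (fun x => curlr G i x ^+ 2) <= 1) ->
    `|real_pairing (Re_field Psi) (curlr G)| <= e / 4 + S.
  move=> tG G1; apply: le_trans (est _ _ rP tG _ G1) _.
    by move=> i; rewrite -eR; exact: (test_field_le1 tF n1 i).1.
  rewrite lerD2l SE big_seq [leRHS]big_seq; apply: ler_sum => k kks; apply: ler_sum => i _.
  by rewrite -eR; exact: (VP (k, i) kks Phi tF).1.
have bI G : (forall i, ctest r (G i)) -> (forall i, intg (fun x => curlr G i x ^+ 2) <= 1) ->
    `|real_pairing (Im_field Psi) (curlr G)| <= e / 4 + S.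
  move=> tG G1; apply: le_trans (est _ _ jP tG _ G1) _.
    by move=> i; rewrite -eI; exact: (test_field_le1 tF n1 i).2.
  rewrite lerD2l SE big_seq [leRHS]big_seq; apply: ler_sum => k kks; apply: ler_sum => i _.
  by rewrite -eI; exact: (VP (k, i) kks Phi tF).2.
have nR i : intg (fun x => curlr (Re_field Psi') i x ^+ 2) <= 1.
  by rewrite -eR'; exact: (test_field_le1 tF' n1' i).1.
have nI i : intg (fun x => curlr (Im_field Psi') i x ^+ 2) <= 1.
  by rewrite -eI'; exact: (test_field_le1 tF' n1' i).2.
rewrite !big_cat /= -/S (inner_test_field _ tP) eR' eI'.
apply: le_trans (cabs_le_ReIm _) _ => /=.
have := (bR _ rP' nR, bR _ jP' nI, bI _ rP' nR, bI _ jP' nI) => -[[[]]].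
move: (real_pairing _ _) (real_pairing _ _) (real_pairing _ _) (real_pairing _ _) => a b c d.
move=> h1 h2 h3 h4; apply: le_trans (lerD (ler_normD _ _) (ler_normB _ _)) _.
have -> : e + (S + (S + (S + S))) =
    e / 4 + S + (e / 4 + S) + (e / 4 + S + (e / 4 + S)) by field.
exact: lerD (lerD h1 h4) (lerD h3 h2).
Qed.

End bounded_domain.
End curl_operator.

(** * Closures of graphs *)

Section closure_adjoint.
Variables (R : realType) (H : innerProductType R[i]).
Implicit Types A : set (H * H).

(** Both sides of the adjoint relation are continuous in [p], so it passes from [A] to its closure
    in the product. *)
Lemma adjoint_closure A : adjoint (closure A) = adjoint A.
Proof.
apply/seteqP; split=> q hq p pA; first by apply: hq; exact: subset_closure.
apply/eqP; rewrite -subr_eq0; apply/eqP/cabs_eq0.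
set z := _ - _; have q0 : 0 < hnm q.1 + hnm q.2 + 1 by rewrite ltr_wpDl // addr_ge0 // hnm_ge0.
apply/eqP; rewrite eq_le cabs_ge0 andbT; apply/ler_addgt0Pr => e e0; rewrite add0r.
have d0 : 0 < e / (hnm q.1 + hnm q.2 + 1) by rewrite divr_gt0.
have [|p' [Ap' [/= p1 p2]]] := pA [set p' : H * H |
    hnm (p.1 - p'.1) < e / (hnm q.1 + hnm q.2 + 1) /\ hnm (p.2 - p'.2) < e / (hnm q.1 + hnm q.2 + 1)].
  exists ([set x | hnm (p.1 - x) < e / (hnm q.1 + hnm q.2 + 1)],
    [set x | hnm (p.2 - x) < e / (hnm q.1 + hnm q.2 + 1)]); last by move=> x [].
  by split; apply/nbhs_hnm; exists (e / (hnm q.1 + hnm q.2 + 1)).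
have -> : z = inner (p.2 - p'.2) q.1 - inner (p.1 - p'.1) q.2.
  by rewrite /z !innerBl (hq _ Ap'); ring.
apply: le_trans (cabsB _ _) _.
apply: le_trans (lerD (cauchy_schwarz _ _) (cauchy_schwarz _ _)) _.
apply: le_trans (lerD (ler_wpM2r (hnm_ge0 _) (ltW p2)) (ler_wpM2r (hnm_ge0 _) (ltW p1))) _.
by rewrite -mulrDr -mulrA ler_piMr ?(ltW e0) // ler_pdivrMl // mulr1 lerDl.
Qed.

Lemma closure_op_ran_closure A : closure (op_ran (closure A)) = closure (op_ran A).
Proof.
apply/seteqP; split; last first.
  by apply: closure_subset => _ [p Ap <-]; exists p => //; exact: subset_closure.
rewrite [X in _ `<=` X](closure_id _).1; last exact: closed_closure.
apply: closure_subset => _ [p pA <-] U Up.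
have [|p' [Ap' Up']] := pA (snd @^-1` U); first exact: (cvg_snd Up).
by exists p'.2; split => //; exists p'.
Qed.

End closure_adjoint.

Theorem theorem5p2 (R : realType) (Omega : set (R * R * R))
  (oOmega : open Omega) (bOmega : bounded_set Omega) :
  [/\ compact_domain_embedding (reduced (curl_sharp oOmega)),
      selfadjoint (curl_sharp oOmega),
      spectrum (curl_sharp oOmega) `<=` range (real_complex R)
    & limit_point [set r : R | spectrum (curl_sharp oOmega) (r%:C)%C] = set0].
Proof.
have [r r0 Or] : exists2 r : R, 0 <= r & forall x, Omega x -> `|x| <= r.
  case: bOmega => M [_ MP]; exists (`|M| + 1); first by rewrite addr_ge0.
  by apply: MP; rewrite ltr_pwDr // ler_norm.
(* The closed operator [curl_0] disappears here, and only test fields remain to be estimated. *)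
have -> : curl_sharp oOmega = sharp (curl_c oOmega).
  by rewrite /curl_sharp /curl /curl_0 adjoint_closure closure_op_ran_closure.
apply: sharp_spectral_theory.
- exact: L2_complete.
- exact: curl_c0 Or.
- exact: curl_c_comb.
- exact: curl_c_sym Or.
- exact: curl_c_ran Or.
- by move=> e e0; exact: curl_c_estimate Or _ r0 e0.
Qed.
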